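(* There exists a universal constant $A > 0$ (not depending on any of the data below, in particular not on $G$) such that the following holds. Let $G$ be a compact metrizable group with normalized Haar measure $\mu$, let $X_1, X_2, \dots$ be i.i.d. $G$-valued random variables with distribution $\nu$ (a Borel probability measure on $G$), and set $S_k = X_1 X_2 \cdots X_k$. Suppose that $\nu$ is adapted and strictly aperiodic, and that $(\nu^{*k})_{\mathrm{abs}} \neq 0$ for some $k \ge 1$. Let $f: G \to \mathbb{R}$ be Borel measurable such that $\int_G f \, \mathrm{d}\mu = 0$, and assume $f \in L^{2+\delta}(G,\mu)$ for some $0 < \delta \le 1$ and $\sup_{c \in G} \mathbb{E} f(cX_1)^2 < \infty$. (i) If $C(f,\nu) > 0$, then there is $N_0 = N_0(f,\nu,\delta)$ such that for any integer $N \ge N_0$ \[ \sup_{x \in \mathbb{R}} \left| \Pr\left( \frac{\sum_{k=1}^N f(S_k)}{\sqrt{C(f,\nu) N}} < x \right) - \Phi(x) \right| \le A\, K\, \frac{(\log N)^{\delta/(1+\delta)}}{N^{\delta/(2+2\delta)}}, \] where $K = \Delta \left( \|f\|_{2+\delta} / \sqrt{C(f,\nu)} \right)^{(2+\delta)/(1+\delta)}$. (ii) If $C(f,\nu) = 0$, then $N^{-1/2} \sum_{k=1}^N f(S_k) \to 0$ in $L^2$ as $N \to \infty$.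
   Context: A Borel probability measure $\nu$ on $G$ is called adapted if its support (the smallest closed set of full $\nu$-measure) is not contained in any proper closed subgroup of $G$; it is called strictly aperiodic if its support is not contained in a coset of any proper closed normal subgroup of $G$. $\nu^{*k}$ denotes the $k$-fold convolution of $\nu$ (the distribution of $S_k$). Its Lebesgue decomposition with respect to $\mu$ is $\nu^{*k} = (\nu^{*k})_{\mathrm{abs}} + (\nu^{*k})_{\mathrm{sing}}$, where $(\nu^{*k})_{\mathrm{abs}}$ is absolutely continuous and $(\nu^{*k})_{\mathrm{sing}}$ is singular with respect to $\mu$. $\mu$ is normalized so that $\mu(G)=1$. $\Delta_k = \|\nu^{*k} - \mu\|_{\mathrm{TV}} = 2\sup_B |\nu^{*k}(B) - \mu(B)|$ (supremum over Borel sets $B \subseteq G$), and $\Delta = 1 + 2\sum_{k=1}^\infty \Delta_k$; under the assumptions on $\nu$, $\Delta_k \to 0$ exponentially fast, so $\Delta < \infty$. $\|f\|_p$ is the norm in $L^p(G,\mu)$. For $f \in L^2(G,\mu)$ with $\int_G f\,\mathrm{d}\mu=0$, \[ C(f,\nu) = \mathbb{E} f(U)^2 + 2\sum_{k=1}^\infty \mathbb{E} f(U) f(US_k), \] where $U$ is a $G$-valued random variable with distribution $\mu$, independent of $X_1, X_2, \dots$ (the series is absolutely convergent and $C(f,\nu) \ge 0$). $\Phi(x) = \int_{-\infty}^x (2\pi)^{-1/2} e^{-t^2/2}\,\mathrm{d}t$. *)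

(* Defs.v *)
From HB Require Import structures.
From mathcomp Require Import all_boot all_order all_algebra finmap.
From mathcomp Require Import all_classical all_reals all_analysis.

Set Implicit Arguments.
Unset Strict Implicit.
Unset Printing Implicit Defensive.

Import Order.TTheory GRing.Theory Num.Theory.
Import numFieldNormedType.Exports.

Local Open Scope classical_set_scope.
Local Open Scope ring_scope.

HB.mixin Record isTopologicalGroup G & Topological G & Group G := {
  mulg_continuous : continuous (fun p : G * G => (p.1 * p.2)%g) ;
  invg_continuous : continuous (fun x : G => (x^-1)%g) ;
}.

#[short(type="topologicalGroupType")]
HB.structure Definition TopologicalGroup :=
  {G of Topological G & Group G & isTopologicalGroup G}.

Definition metrizable (R : realType) (T : topologicalType) : Prop :=
  exists dist : T -> T -> R,
    [/\ forall x y, dist x y = 0 <-> x = y,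
        forall x y, dist x y = dist y x,
        forall x y z, dist x z <= dist x y + dist y z &
        forall x : T, nbhs x =
          filter_from [set e | 0 < e] (fun e => [set y | dist x y < e])].

HB.mixin Record isCompactMetrizable (R : realType) T & Topological T := {
  compact_setT : compact [set: T] ;
  metrizableT : metrizable R T ;
}.

HB.mixin Record isBorel d T & Topological T & Measurable d T := {
  borel_measurable : @measurable d T = <<s @open T >> ;
}.

#[short(type="compactMetrizableGroupType")]
HB.structure Definition CompactMetrizableGroup d (R : realType) :=
  {G of TopologicalGroup G & isCompactMetrizable R G
      & Measurable d G & isBorel d G}.

Lemma metrizable_second_countable (R : realType) (T : ptopologicalType) :
  metrizable R T -> compact [set: T] -> @second_countable T.
Proof.
move=> [dist [d0 ds dt dn]].
have nbhs_dist (z : T) e : 0 < e -> nbhs z [set y | dist z y < e].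
  by move=> e0; rewrite dn; exists e.
have npos n : (0:R) < n.+1%:R^-1 by [].
pose f n (z : T): set T := [set y | dist z y < n.+1%:R^-1]°.
move=> cmpt; have h n : finite_subset_cover [set: T] (f n) [set: T].
  move: cmpt; rewrite compact_cover; apply.
  - by move=> z _; rewrite /f; exact: open_interior.
  - by move=> z _; exists z => //; rewrite /f /interior; exact: nbhs_dist.
pose h' n := cid (iffLR (exists2P _ _) (h n)).
pose h'' n := projT1 (h' n).
pose B := \bigcup_n (f n) @` [set` h'' n]; exists B; [|split].
- apply: bigcup_countable => // n _; apply: finite_set_countable.
  exact/finite_image/finite_fset.
- by move=> ? [? _ [? _ <-]]; exact: open_interior.
- move=> x V /=; rewrite {1}dn => -[e /= e0 eV].
  have [|N] := @ltr_add_invr R 0 (e / 2); first by rewrite divr_gt0.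
  rewrite add0r => deleps.
  have [w wh fx] : exists2 w : T, w \in h'' N & f N w x.
    by have [_ /(_ x) [// | w ? ?]] := projT2 (h' N); exists w.
  exists (f N w); first by split => //; exists N.
  move=> z /interior_subset /= wz; apply: eV => /=.
  apply: (le_lt_trans (dt x w z)); rewrite [e]splitr ltrD//.
    rewrite ds; apply: lt_trans deleps.
    by have /= := interior_subset fx.
  exact: lt_trans deleps.
Qed.

Section measurable_mulg.
Context d (R : realType) (G : compactMetrizableGroupType d R).

Lemma group_second_countable : @second_countable G.
Proof.
apply: (@metrizable_second_countable R); [exact: metrizableT|exact: compact_setT].
Qed.

Lemma open_measurable_group (A : set G) : open A -> measurable A.
Proof. by rewrite borel_measurable => oA; exact: sub_sigma_algebra. Qed.

Lemma measurable_mulg :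
  measurable_fun [set: G * G] (fun p : G * G => (p.1 * p.2)%g).
Proof.
apply: (measurability (@open G)); first exact: borel_measurable.
move=> _ [C oC <-]; rewrite setTI.
have [B cB [Bo Bb]] := group_second_countable.
set W := _ @^-1` C.
pose I := [set UV : set G * set G | [/\ B UV.1, B UV.2 & UV.1 `*` UV.2 `<=` W]].
have -> : W = \bigcup_(UV in I) (UV.1 `*` UV.2).
  apply/seteqP; split => [[x y] Wxy|p [UV [_ _ UVW] /UVW]//].
  have [[U V] [/= /Bb Ux /Bb Vy] UVW] : nbhs (x, y) W.
    by apply: (@mulg_continuous G (x, y)); exact: open_nbhs_nbhs.
  have [U' [BU' U'x] U'U] := Ux; have [V' [BV' V'y] V'V] := Vy.
  exists (U', V') => //; split => // -[a b] [/= /U'U Ua /V'V Vb].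
  exact: UVW.
have cI : countable I.
  apply: (@sub_countable _ _ I (B `*` B)); last exact: countableX.
  by apply: subset_card_le => UV [].
rewrite bigcup_set_type; apply: countable_bigcupT_measurable.
  by rewrite (eq_countable (card_setT I)).
move=> [UV /= /set_mem[BU BV _]]; apply: measurableX;
  by apply: open_measurable_group; exact: Bo.
Qed.

End measurable_mulg.

Section convolution.
Context d (R : realType) (G : compactMetrizableGroupType d R).

Definition mulg_pair (p : G * G) : G := (p.1 * p.2)%g.

HB.instance Definition _ :=
  isMeasurableFun.Build _ _ _ _ mulg_pair (@measurable_mulg d R G).

Definition convolution (nu1 nu2 : probability G R) : probability G R :=
  distribution (nu1 \x nu2)%E mulg_pair.

Fixpoint convolution_pow (nu : probability G R) (k : nat) : probability G R :=
  if k is k'.+1 then convolution (convolution_pow nu k') nu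
  else \d_(1%g : G).

End convolution.

Section group_definitions.
Context (G : groupType).
Implicit Types H : set G.

Definition subgroup H : Prop :=
  [/\ H 1%g, forall x y, H x -> H y -> H (x * y)%g
    & forall x, H x -> H (x^-1)%g].

Definition normal_subgroup H : Prop :=
  subgroup H /\ forall g h, H h -> H (h ^ g)%g.

Definition left_coset (g : G) H : set G := [set (g * h)%g | h in H].

End group_definitions.

Section measures_on_groups.
Context d (R : realType) (G : compactMetrizableGroupType d R).
Implicit Types mu nu : probability G R.

(* Left invariance; on a compact group it implies right invariance. *)
Definition haar_probability mu : Prop :=
  forall (g : G) (B : set G), measurable B ->
    mu [set x | B (g * x)%g] = mu B.

(* As G is second countable, this intersection itself has full measure. *)
Definition support nu : set G :=
  \bigcap_(F in [set F : set G | closed F /\ nu F = 1%E]) F.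

Definition adapted nu : Prop :=
  forall H : set G, closed H -> subgroup H -> H != [set: G] ->
    ~ support nu `<=` H.

Definition strictly_aperiodic nu : Prop :=
  forall H : set G, closed H -> normal_subgroup H -> H != [set: G] ->
    forall g : G, ~ support nu `<=` left_coset g H.

End measures_on_groups.

Section measure_definitions.
Context d (T : measurableType d) (R : realType).
Local Open Scope ereal_scope.

Definition mutually_singular (m1 m2 : {measure set T -> \bar R}) : Prop :=
  exists2 N : set T, measurable N & m1 (~` N) = 0 /\ m2 N = 0.

Definition lebesgue_decomposition
    (mu nu nu_abs nu_sing : {measure set T -> \bar R}) : Prop :=
  [/\ forall B, measurable B -> nu B = nu_abs B + nu_sing B,
      nu_abs `<< mu & mutually_singular nu_sing mu].

Definition tv_distance (P Q : probability T R) : R :=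
  (2 * sup [set `|fine (P B) - fine (Q B)| | B in @measurable d T])%R.

End measure_definitions.

Section constants.
Context d (R : realType) (G : compactMetrizableGroupType d R).
Variables mu nu : probability G R.

(* The k-th term of each series below is the term of index k + 1 of the
   corresponding sum over k >= 1. *)
Definition mixing_constant : R :=
  1 + 2 * limn (series (fun k => tv_distance (convolution_pow nu k.+1) mu)).

(* (U, U S_k) is realized on G * G under the joint law mu \x nu^{*k} of
   (U, S_k). *)
Definition autocovariance (f : G -> R) (k : nat) : R :=
  fine 'E_(mu \x convolution_pow nu k)[fun p => (f p.1 * f (p.1 * p.2)%g)%R]%E.

Definition asymptotic_variance (f : G -> R) : R :=
  fine 'E_mu[fun u => (f u ^+ 2)%R]%E
  + 2 * limn (series (fun k => autocovariance f k.+1)).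

End constants.

Section random_variables.
Context d d' (Omega : measurableType d) (T : measurableType d') (R : realType).
Variable P : probability Omega R.

Definition mutually_independent (X : nat -> {RV P >-> T}) : Prop :=
  forall (J : {fset nat}) (B : nat -> set T),
    (forall j, measurable (B j)) ->
    P (\bigcap_(j in [set` J]) X j @^-1` B j) =
    (\prod_(j <- J) P (X j @^-1` B j))%E.

Definition iid (nu : probability T R) (X : nat -> {RV P >-> T}) : Prop :=
  mutually_independent X /\
  forall j B, measurable B -> distribution P (X j) B = nu B.

End random_variables.

(* The increments are numbered from 0: [X j] stands for X_(j+1), so that
   [random_walk X k] is S_k = X_1 ... X_k. *)
Definition random_walk (G : groupType) (Omega : Type) (X : nat -> Omega -> G)
    (k : nat) (w : Omega) : G := (\prod_(j < k) X j w)%g.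

Definition std_normal_cdf (R : realType) (x : R) : R :=
  \int[lebesgue_measure]_(t in `]-oo, x])
    ((Num.sqrt (2 * pi))^-1 * expR (- t ^+ 2 / 2)).

(* Main.v *)
(* Write P g (c) = int g(cx) nu(dx). Adaptedness, strict aperiodicity and the
   absolutely continuous part of some power give a Doeblin minorization
   nu^{*m} >= e mu, so that nu^{*k} tends to mu exponentially fast in total
   variation, at rates a_k with sum_k a_k < oo. As P f is bounded and mu-centred,
   h = sum_{k >= 1} P^k f is bounded and solves h = P (f + h). Hence
   sum_{k <= N} f(S_k) differs by at most 2 sup |h| from the martingale M_N with
   increments D(S_k, X_{k+1}), D(c, x) = f(cx) + h(cx) - h(c), and
   C(f, nu) = int v dmu where v(c) = int D(c, x)^2 nu(dx).

   Let u(m, t) = Phi((x - m) / sqrt t), a solution of the heat equation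
   u_t = u_mm / 2, and let w = sum_{k >= 0} P^k (v - C). Lindeberg's method
   applied to u + u_mm w / 2 along (M_k, S_k), with t_k = t_0 + C (N - k), loses
   sum_k t_k^{-1-delta/2} = O(t_0^{-delta/2}); the correction by w cancels the
   fluctuations of the conditional variance v(S_k). With
   t_0 = C N^{1/(1+delta)}, a smoothing inequality yields the rate
   O(N^{-delta/(2+2delta)}), with a constant depending on f, nu and delta. The
   factor (log N)^{delta/(1+delta)} in the theorem absorbs this constant as soon
   as N >= N_0(f, nu, delta), so that A = 1 is admissible. When C = 0,
   E M_N^2 = sum_k E v(S_k) is bounded because int v dmu = 0. *)

From HB Require Import structures.
Require Import Defs.
From mathcomp Require Import all_boot all_order all_algebra finmap.
From mathcomp Require Import all_classical all_reals all_analysis.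
From mathcomp Require Import measurable_realfun ring lra.

Set Implicit Arguments.
Unset Strict Implicit.
Unset Printing Implicit Defensive.

Import Order.TTheory GRing.Theory Num.Theory.
Import numFieldNormedType.Exports.

Local Open Scope classical_set_scope.
Local Open Scope ring_scope.

(** Minorization: a power of [nu] that dominates [e mu] on a set of positive measure dominates, once
    convolved with itself, a multiple of [mu] on a nonempty open set [V], because translation is
    continuous in measure. For [t] in the support of [nu], the sets [t^-n T_n], with [T_n] the
    points charged by the n-th power, increase; recurrence of the powers of [t] makes the closure of
    their union a closed normal subgroup, and the support of [nu] lies in its coset by [t], so this
    subgroup is [G]. By compactness one [n] is enough for the translates of [V] by points of [T_n]
    to cover [G].

    Lindeberg's method meets one obstacle: from a given starting point only the second moment of [D]
    is bounded, while the moment of order [2 + delta] is controlled on average over [mu]. The Taylor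
    remainder is therefore bounded by a truncated function whose mean over one step is at most
    [2 V / t_k], with [V] a bound on [v]. Mixing replaces the law of [S_k] by [mu] in this mean at
    the cost [2 V a_k / t_k], which is summable, and the higher moment enters only afterwards. *)

Lemma integral_probability_cst d (T : measurableType d) (R : realType)
  (P : probability T R) (c : \bar R) : (\int[P]_x c = c)%E.
Proof.
by rewrite integral_cst// -[RHS]mule1; congr (_ * _)%E; exact: probability_setT.
Qed.

(** * Integrals of real functions and Fubini's theorem *)

Notation L1 P f := (P.-integrable [set: _] (EFin \o f)) (only parsing).

Section real_integrals.
Context d (T : measurableType d) (R : realType) (P : probability T R).
Implicit Types f g : T -> R.

Lemma L1_measurable f : L1 P f -> measurable_fun setT f.
Proof. by move/measurable_int/measurable_EFinP. Qed.

Lemma L1_le f g : measurable_fun setT f -> (forall x, `|f x| <= g x) ->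
  L1 P g -> L1 P f.
Proof.
move=> mf fg; apply: le_integrable => //; first exact/measurable_EFinP.
by move=> x _ /=; rewrite lee_fin (le_trans (fg x)) ?ler_norm.
Qed.

Lemma L1_cst (c : R) : L1 P (cst c).
Proof. exact: finite_measure_integrable_cst. Qed.

Lemma L1_bounded f B : measurable_fun setT f -> (forall x, `|f x| <= B) -> L1 P f.
Proof. by move=> mf fB; apply: (L1_le mf fB); exact: L1_cst. Qed.

Lemma L1D f g : L1 P f -> L1 P g -> L1 P (fun x => f x + g x).
Proof. by move=> lf lg; exact: (integrableD measurableT lf lg). Qed.

Lemma L1B f g : L1 P f -> L1 P g -> L1 P (fun x => f x - g x).
Proof. by move=> lf lg; exact: (integrableB measurableT lf lg). Qed.

Lemma L1Z c f : L1 P f -> L1 P (fun x => c * f x).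
Proof. by move=> lf; exact: (integrableZl measurableT c lf). Qed.

Lemma L1_norm f : L1 P f -> L1 P (fun x => `|f x|).
Proof. by move=> lf; exact: (integrable_abse lf). Qed.

Lemma Rint_cst (c : R) : \int[P]_x c = c.
Proof.
by rewrite /Rintegral integral_probability_cst.
Qed.

Lemma RintD f g : L1 P f -> L1 P g ->
  \int[P]_x (f x + g x) = \int[P]_x f x + \int[P]_x g x.
Proof. by move=> lf lg; rewrite RintegralD. Qed.

Lemma RintB f g : L1 P f -> L1 P g ->
  \int[P]_x (f x - g x) = \int[P]_x f x - \int[P]_x g x.
Proof. by move=> lf lg; rewrite RintegralB. Qed.

Lemma RintZ c f : L1 P f -> \int[P]_x (c * f x) = c * \int[P]_x f x.
Proof. by move=> lf; rewrite RintegralZl. Qed.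

Lemma RintN f : L1 P f -> \int[P]_x (- f x) = - \int[P]_x f x.
Proof.
by move=> lf; rewrite -mulN1r -RintZ//; apply: eq_Rintegral => x _; rewrite mulN1r.
Qed.

Lemma Rint_le f g : L1 P f -> L1 P g -> (forall x, f x <= g x) ->
  \int[P]_x f x <= \int[P]_x g x.
Proof. by move=> lf lg fg; apply: le_Rintegral. Qed.

Lemma Rint_abs_le f g : measurable_fun setT f -> L1 P g ->
  (forall x, `|f x| <= g x) -> `|\int[P]_x f x| <= \int[P]_x g x.
Proof.
move=> mf lg fg; have lf := L1_le mf fg lg.
apply: le_trans (le_normr_Rintegral _ lf) _ => //.
by apply: Rint_le => //; exact: L1_norm.
Qed.

Lemma Rint_bounded f B : measurable_fun setT f -> (forall x, `|f x| <= B) ->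
  `|\int[P]_x f x| <= B.
Proof.
move=> mf fB; rewrite -[leRHS]Rint_cst; apply: Rint_abs_le => //; exact: L1_cst.
Qed.

Lemma EFin_Rint f : L1 P f -> (\int[P]_x f x)%:E = (\int[P]_x (f x)%:E)%E.
Proof. by move=> lf; rewrite fineK// integrable_fin_num. Qed.

Lemma L1_ge0P f : measurable_fun setT f -> (forall x, 0 <= f x) ->
  (\int[P]_x (f x)%:E < +oo)%E -> L1 P f.
Proof.
move=> mf f0 fi; apply/integrableP; split; first exact/measurable_EFinP.
by under eq_integral do rewrite /= ger0_norm//.
Qed.

End real_integrals.

Section real_fubini.
Context d1 d2 (T1 : measurableType d1) (T2 : measurableType d2) (R : realType).
Variables (P1 : probability T1 R) (P2 : probability T2 R).
Implicit Type F : T1 * T2 -> R.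

(** Tonelli's theorem applies to the positive and to the negative part, and [fine] is measurable on
    all of the extended line. *)
Lemma measurable_Rint2 F : measurable_fun setT F ->
  measurable_fun setT (fun x => \int[P2]_y F (x, y)).
Proof.
move=> mF; apply: measurableT_comp => //.
rewrite [X in measurable_fun _ X](_ : _ = fun x =>
    (\int[P2]_y (EFin \o F)^\+ (x, y) - \int[P2]_y (EFin \o F)^\- (x, y))%E); last first.
  by apply/funext => x; rewrite integralE; congr (_ - _)%E; apply: eq_integral => y _;
    rewrite ?funeposE ?funenegE.
apply: emeasurable_funB.
- apply: (measurable_fun_fubini_tonelli_F ((EFin \o F)^\+)%E) => //.
  by apply: measurable_funepos; exact/measurable_EFinP.
- apply: (measurable_fun_fubini_tonelli_F ((EFin \o F)^\-)%E) => //.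
  by apply: measurable_funeneg; exact/measurable_EFinP.
Qed.

Lemma Rint_prod12 F : L1 (P1 \x P2)%E F -> (forall x, L1 P2 (fun y => F (x, y))) ->
  \int[(P1 \x P2)%E]_z F z = \int[P1]_x \int[P2]_y F (x, y).
Proof.
move=> lF lF2; rewrite /Rintegral -(integral12_prod_meas1 lF); congr fine.
by apply: eq_integral => x _; rewrite EFin_Rint.
Qed.

Lemma Rint_prod21 F : L1 (P1 \x P2)%E F -> (forall y, L1 P1 (fun x => F (x, y))) ->
  \int[(P1 \x P2)%E]_z F z = \int[P2]_y \int[P1]_x F (x, y).
Proof.
move=> lF lF2; rewrite /Rintegral -(integral21_prod_meas1 lF); congr fine.
by apply: eq_integral => x _; rewrite EFin_Rint.
Qed.

Lemma L1_prod12 F : measurable_fun setT F -> (forall x, L1 P2 (fun y => F (x, y))) ->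
  L1 P1 (fun x => \int[P2]_y `|F (x, y)|) -> L1 (P1 \x P2)%E F.
Proof.
move=> mF lF2 /integrableP[_ lF]; apply/integrable12ltyP; first exact/measurable_EFinP.
apply: le_lt_trans lF; apply: ge0_le_integral => //.
- by move=> x _; exact: integral_ge0.
- apply: (measurable_fun_fubini_tonelli_F (fun z => `|(F z)%:E|)%E) => //.
  by apply: measurableT_comp => //; exact/measurable_EFinP.
- do 2 apply: measurableT_comp => //.
  by apply: (measurable_Rint2 (F := fun z => `|F z|)); exact: measurableT_comp.
- move=> x _ /=; rewrite ger0_norm; last by apply: Rintegral_ge0.
  by rewrite EFin_Rint//; exact: L1_norm.
Qed.

End real_fubini.

Lemma Rint_distribution d d' (T : measurableType d) (T' : measurableType d')
  (R : realType) (P : probability T R) (X : {mfun T >-> T'}) (f : T' -> R) :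
  measurable_fun setT f -> L1 P (fun x => f (X x)) ->
  \int[distribution P X]_y f y = \int[P]_x f (X x).
Proof.
by move=> mf lf; rewrite /Rintegral integral_distribution//; exact/measurable_EFinP.
Qed.

(** * Haar measure and convolution powers *)

Section haar.
Context d (R : realType) (G : compactMetrizableGroupType d R).
Implicit Types (mu nu : probability G R) (f : G -> \bar R).
Local Open Scope ereal_scope.

Lemma continuous_measurable_group (h : G -> G) :
  continuous h -> measurable_fun setT h.
Proof.
move=> ch; apply: (measurability (@open G)); first exact: borel_measurable.
move=> _ [C oC <-]; rewrite setTI; apply: open_measurable_group.
by move/continuousP: ch; exact.
Qed.

Lemma continuous_mull (g : G) : continuous (fun x : G => (g * x)%g).
Proof.
move=> x; apply: (@cvg_comp _ _ _ (fun x => (g, x)) (fun p : G * G => (p.1 * p.2)%g)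
  _ (nbhs (g, x))); last exact: (@mulg_continuous G (g, x)).
by apply: cvg_pair; [exact: cvg_cst|exact: cvg_id].
Qed.

Lemma continuous_mulr (g : G) : continuous (fun x : G => (x * g)%g).
Proof.
move=> x; apply: (@cvg_comp _ _ _ (fun x => (x, g)) (fun p : G * G => (p.1 * p.2)%g)
  _ (nbhs (x, g))); last exact: (@mulg_continuous G (x, g)).
by apply: cvg_pair; [exact: cvg_id|exact: cvg_cst].
Qed.

Lemma measurable_mull (g : G) : measurable_fun setT (fun x : G => (g * x)%g).
Proof. exact/continuous_measurable_group/continuous_mull. Qed.

Lemma measurable_mulr (g : G) : measurable_fun setT (fun x : G => (x * g)%g).
Proof. exact/continuous_measurable_group/continuous_mulr. Qed.

Lemma measurable_inv : measurable_fun setT (fun x : G => (x^-1)%g).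
Proof. exact/continuous_measurable_group/invg_continuous. Qed.

Lemma measurable_funMg d' (T : measurableType d') (g h : T -> G) :
  measurable_fun setT g -> measurable_fun setT h ->
  measurable_fun setT (fun t => (g t * h t)%g).
Proof.
move=> mg mh; apply: (measurableT_comp (@measurable_mulg d R G)
  (measurable_fun_pair mg mh)).
Qed.

Lemma haar_ge0_integral mu g f : haar_probability mu ->
  measurable_fun setT f -> (forall x, 0 <= f x) ->
  \int[mu]_x f (g * x)%g = \int[mu]_x f x.
Proof.
move=> hmu mf f0.
pose mug := pushforward mu (fun x : G => (g * x)%g).
have -> : \int[mu]_x f x = \int[mug]_x f x.
  apply: eq_measure_integral => [|mg A mA _]; first exact: measurable_mull.
  exact/esym/(hmu g A mA).
by rewrite ge0_integral_pushforward//; exact: measurable_mull.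
Qed.

(** Integrate [f (x^-1 * y)] over [mu \x mu] in both orders. Integrating in [y] first gives the
    integral of [f] by left invariance; integrating in [x] first, with [x^-1 * y = (y^-1 * x)^-1],
    gives that of [f (x^-1)]. *)
Lemma haar_ge0_integralV mu f : haar_probability mu ->
  measurable_fun setT f -> (forall x, 0 <= f x) ->
  \int[mu]_x f (x^-1)%g = \int[mu]_x f x.
Proof.
move=> hmu mf f0.
have mF : measurable_fun setT (fun p : G * G => f (p.1^-1 * p.2)%g).
  apply: (measurableT_comp mf); apply: measurable_funMg => //.
  exact: measurableT_comp measurable_inv _.
have := @fubini_tonelli _ _ _ _ _ mu mu (fun p : G * G => f (p.1^-1 * p.2)%g) mF
  (fun=> f0 _) => /=.
under eq_integral do rewrite haar_ge0_integral//.
rewrite integral_probability_cst => ->.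
under [RHS]eq_integral => y _.
  rewrite (_ : \int[mu]_x _ = \int[mu]_x f (y^-1 * x)^-1%g); last first.
    by apply: eq_integral => x _; rewrite invgM invgK.
  rewrite (haar_ge0_integral (y^-1)%g (f := fun x => f x^-1%g))//; last first.
    exact: measurableT_comp mf measurable_inv.
  over.
by rewrite integral_probability_cst.
Qed.

(** Inversion preserves [mu] and conjugates right translations into left ones. *)
Lemma haar_ge0_integralr mu g f : haar_probability mu ->
  measurable_fun setT f -> (forall x, 0 <= f x) ->
  \int[mu]_x f (x * g)%g = \int[mu]_x f x.
Proof.
move=> hmu mf f0; rewrite -[RHS]haar_ge0_integralV//.
rewrite -[LHS]haar_ge0_integralV//; last first.
  exact: measurableT_comp mf (measurable_mulr g).
rewrite -[RHS](haar_ge0_integral (g^-1)%g)//; last first.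
  exact: measurableT_comp mf measurable_inv.
by apply: eq_integral => x _; rewrite invgM invgK.
Qed.

Lemma haar_integral mu g f : haar_probability mu -> measurable_fun setT f ->
  \int[mu]_x f (g * x)%g = \int[mu]_x f x.
Proof.
move=> hmu mf; rewrite integralE [RHS]integralE.
rewrite -(haar_ge0_integral g hmu (measurable_funepos mf))//.
rewrite -(haar_ge0_integral g hmu (measurable_funeneg mf))//.
by congr (_ - _); apply: eq_integral => x _; rewrite ?funeposE ?funenegE.
Qed.

Lemma haar_integralr mu g f : haar_probability mu -> measurable_fun setT f ->
  \int[mu]_x f (x * g)%g = \int[mu]_x f x.
Proof.
move=> hmu mf; rewrite integralE [RHS]integralE.
rewrite -(haar_ge0_integralr g hmu (measurable_funepos mf))//.
rewrite -(haar_ge0_integralr g hmu (measurable_funeneg mf))//.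
by congr (_ - _); apply: eq_integral => x _; rewrite ?funeposE ?funenegE.
Qed.

Lemma ge0_integral_convolution mu nu f :
  measurable_fun setT f -> (forall x, 0 <= f x) ->
  \int[convolution mu nu]_x f x = \int[mu]_x \int[nu]_y f (x * y)%g.
Proof.
move=> mf f0; rewrite ge0_integral_distribution//.
rewrite fubini_tonelli1//=.
by apply: (measurableT_comp mf); exact: measurable_funMg.
Qed.

Lemma measurable_integral_mul nu f :
  measurable_fun setT f -> (forall x, 0 <= f x) ->
  measurable_fun setT (fun x => \int[nu]_y f (x * y)%g).
Proof.
move=> mf f0.
apply: (measurable_fun_fubini_tonelli_F (fun p : G * G => f (p.1 * p.2)%g)) => //.
by apply: (measurableT_comp mf); exact: measurable_funMg.
Qed.

Lemma ge0_integral_convolution_powD nu j k f :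
  measurable_fun setT f -> (forall x, 0 <= f x) ->
  \int[convolution_pow nu (j + k)]_x f x =
  \int[convolution_pow nu j]_x \int[convolution_pow nu k]_y f (x * y)%g.
Proof.
elim: k f => [|k IH] f mf f0.
  rewrite addn0; apply: eq_integral => x _ /=.
  by rewrite integral_dirac ?diracT ?mul1e ?mulg1//; exact: measurableT_comp mf (measurable_mull x).
rewrite addnS /= ge0_integral_convolution// IH//; last 2 first.
- exact: measurable_integral_mul.
- by move=> x; apply: integral_ge0.
apply: eq_integral => x _.
rewrite ge0_integral_convolution//; last exact: measurableT_comp mf (measurable_mull x).
by apply: eq_integral => y _; apply: eq_integral => z _; rewrite mulgA.
Qed.

End haar.

(** * Doeblin minorization *)

Section absolutely_continuous_part.
Context d (T : measurableType d) (R : realType).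
Local Open Scope ereal_scope.

(** [A] is the set where the density exceeds half the total mass of [m]. Were it null, the density
    would be at most [e] almost everywhere, and the total mass at most its own half. *)
Lemma abs_continuous_minorization (mu : probability T R)
    (m : {measure set T -> \bar R}) : m `<< mu -> m setT < +oo -> m setT != 0 ->
  exists A (e : R), [/\ measurable A, 0 < mu A, (0 < e)%R &
    forall B, measurable B -> B `<=` A -> e%:E * mu B <= m B].
Proof.
move=> mmu moo mT0.
pose nu := mfrestr measurableT moo.
have nuE B : nu B = m B by rewrite /nu /mfrestr /mrestr setIT.
have numu : nu `<< mu.
  apply/null_content_dominatesP => B mB B0.
  by rewrite nuE; move/null_content_dominatesP: mmu; exact.
have chnumu : charge_of_finite_measure nu `<< mu by exact: numu.
pose g := Radon_Nikodym (charge_of_finite_measure nu) mu.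
have ig : mu.-integrable setT g by exact: Radon_Nikodym_integrable.
have mg : measurable_fun setT g by exact: measurable_int ig.
have mE B : measurable B -> m B = \int[mu]_(x in B) g x.
  by move=> mB; rewrite -nuE; exact: (Radon_Nikodym_integral chnumu mB).
have mTgt0 : 0 < m setT by rewrite lt0e mT0 measure_ge0.
have mTfin : m setT \is a fin_num by rewrite ge0_fin_numE.
pose e := (fine (m setT) / 2)%R.
have e0 : (0 < e)%R by rewrite divr_gt0// fine_gt0// mTgt0.
pose A := [set x | e%:E < g x].
have mA : measurable A.
  by rewrite -[A]setTI; exact: emeasurable_fun_o_infty.
exists A, e; split => //.
- rewrite lt0e measure_ge0 andbT; apply/eqP => muA0.
  suff : m setT <= e%:E.
    rewrite -(fineK mTfin) lee_fin leNgt /e => /negP; apply.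
    by rewrite ltr_pdivrMr// ltr_pMr ?ltr1n// fine_gt0// mTgt0.
  rewrite mE// integralE.
  apply: (@le_trans _ _ (\int[mu]_x g^\+ x)).
    by rewrite leeBlDr ?integrable_neg_fin_num// leeDl// integral_ge0.
  apply: (@le_trans _ _ (\int[mu]_x e%:E)); last by rewrite integral_probability_cst.
  apply: ae_ge0_le_integral => //.
  + exact: measurable_funepos.
  + by move=> x _; rewrite lee_fin ltW.
  + exists A; split => // x /= /not_implyP[_]; rewrite funeposE => H.
    rewrite /A /= ltNge; apply/negP => gx; apply: H.
    by rewrite ge_max gx lee_fin ltW.
- move=> B mB BA; rewrite mE//.
  rewrite -integral_cst//; apply: ge0_le_integral => //.
  + by move=> x _; rewrite lee_fin ltW.
  + exact: measurable_funS mg.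
  + by move=> x Bx; exact: ltW (BA x Bx).
Qed.

Lemma ge0_le_integral_scale (m1 m2 : {measure set T -> \bar R}) A (e : R) f :
  measurable A -> (0 < e)%R ->
  (forall B, measurable B -> B `<=` A -> e%:E * m1 B <= m2 B) ->
  measurable_fun setT f -> (forall x, 0 <= f x) ->
  e%:E * \int[m1]_(x in A) f x <= \int[m2]_x f x.
Proof.
move=> mA e0 em mf f0.
pose em1 := mscale (NngNum (ltW e0)) m1.
have -> : e%:E * \int[m1]_(x in A) f x = \int[em1]_(x in A) f x.
  by rewrite ge0_integral_mscale//; exact: measurable_funS mf.
have -> : \int[em1]_(x in A) f x = \int[mrestr em1 mA]_(x in A) f x.
  apply: eq_measure_integral => B mB BA; rewrite /= /mrestr.
  by rewrite (_ : B `&` A = B)//; apply/setIidPl.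
apply: (@le_trans _ _ (\int[m2]_(x in A) f x)).
  apply: ge0_le_measure_integral => // B mB.
  apply: (@le_trans _ _ (m2 (B `&` A))).
    by rewrite /= /mrestr /mscale /=; apply: em => //; exact: measurableI.
  by rewrite le_measure ?inE//; exact: measurableI.
by apply: ge0_subset_integral.
Qed.

End absolutely_continuous_part.

(** * Continuity of translation in measure *)

Section translation_continuity.
Context d (R : realType) (G : compactMetrizableGroupType d R).
Local Open Scope ereal_scope.
Variable mu : probability G R.
Hypothesis hmu : haar_probability mu.

Definition ltrans (w : G) (B : set G) : set G := [set x | B (w * x)%g].

Lemma measurable_ltrans w B : measurable B -> measurable (ltrans w B).
Proof.
by move=> mB; rewrite -[ltrans _ _]setTI; exact: measurable_mull.
Qed.

Lemma measure_nondecreasing_gap (m : probability G R) (F : (set G)^nat) (U : set G) :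
  (forall n, measurable (F n)) -> measurable U ->
  {homo F : n k / (n <= k)%N >-> (n <= k)%O} -> U `<=` \bigcup_n F n ->
  forall e : R, (0 < e)%R -> exists n, m (U `\` F n) < e%:E.
Proof.
move=> mF mU ndF UF e e0.
have : m (U `\` F n) @[n --> \oo] --> m (\bigcap_n (U `\` F n)).
  apply: nonincreasing_cvg_mu.
  - by rewrite (le_lt_trans (probability_le1 _ _)) ?ltry//; exact: measurableD.
  - by move=> n; exact: measurableD.
  - by apply: bigcap_measurable => // n _; exact: measurableD.
  - move=> n k nk; apply/subsetPset => x [Ux nFx]; split => // Fx; apply: nFx.
    by move: (ndF _ _ nk) => /subsetPset; exact.
rewrite (_ : \bigcap_n _ = set0); last first.
  apply/seteqP; split => // x Fx.
  have [Ux _] := Fx 0%N I; have [n _ Fnx] := UF _ Ux.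
  by have [_] := Fx n I.
rewrite measure0 => /(_ [set x | x < e%:E]) H.
have [|n _ /(_ n (leqnn n))/= ?] := H; last by exists n.
exact: (@nbhs_open_ereal_lt _ 0%R (fun=> e)).
Qed.

(* The class of Borel sets on which translation is continuous in measure is a
   sigma-algebra; it contains the open sets because an open [U] is the union of
   the interiors of [{x | W_n x <= U}] for a countable basis [W_n] at [1]. *)
Lemma measure_ltrans_near (B : set G) : measurable B ->
  forall e : R, (0 < e)%R ->
  \forall w \near (1%g : G), mu (B `\` ltrans w B) < e%:E.
Proof.
rewrite [d.-measurable]borel_measurable => sB.
suff : d.-measurable B /\ (forall e : R, (0 < e)%R ->
  \forall w \near (1%g : G), mu (B `\` ltrans w B) < e%:E) by case.
move: B sB; apply: smallest_sub; first split.
- by split => // e e0; apply: nearW => w; rewrite set0D measure0.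
- move=> B [mB HB]; rewrite setTD; split; first exact: measurableC.
  move=> e /HB He.
  (* Translating by [w^-1] turns the difference set of the complement at [w] into that of [B] at
     [w^-1], which tends to [1] with [w]. *)
  have /(_ _ He) : (fun x : G => x^-1%g) @ (1%g : G) --> (1%g : G).
    by rewrite -[X in _ --> X](@invg1 G); exact: invg_continuous.
  move=> {}He.
  have {}He : \forall w \near (1%g : G), mu (B `\` ltrans w^-1%g B) < e%:E := He.
  apply: filterS He => w; apply: le_lt_trans.
  rewrite -(hmu w^-1%g); last by apply: measurableD; [exact: measurableC|
    apply: measurable_ltrans; exact: measurableC].
  rewrite le_measure ?inE//.
  + apply: measurable_ltrans; apply: measurableD; [exact: measurableC|
    apply: measurable_ltrans; exact: measurableC].
  + by apply: measurableD => //; exact: measurable_ltrans.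
  + by move=> x; rewrite /ltrans /= mulVKg => -[] H1 /contrapT H2; split.
- move=> F HF.
  have mF i : d.-measurable (F i) by case: (HF i).
  have mU : d.-measurable (\bigcup_k F k) by exact: bigcup_measurable.
  split=> // e e0.
  have e20 : (0 < e / 2)%R by rewrite divr_gt0.
  (* A finite union misses at most [e / 2] of the whole one, and the difference sets of finitely
     many pieces are small together. *)
  pose H n := \big[setU/set0]_(i < n) F i.
  have mH n : d.-measurable (H n) by apply: bigsetU_measurable.
  have [n Hn] : exists n, mu (\bigcup_k F k `\` H n) < (e / 2)%:E.
    apply: measure_nondecreasing_gap => //.
    + by move=> a b ab; apply/subsetPset; exact: subset_bigsetU.
    + move=> x [k _ Fkx]; exists k.+1 => //; rewrite /H big_ord_recr /=; by right.
  have HHn : \forall w \near (1%g : G), mu (H n `\` ltrans w (H n)) < (e / 2)%:E.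
    move: (e / 2)%R e20 => e2 e20 {Hn e0}.
    elim: n e2 e20 => [|n IHn] e2 e20.
      by apply: nearW => w; rewrite /H big_ord0 set0D measure0.
    have e220 : (0 < e2 / 2)%R by rewrite divr_gt0.
    near=> w.
    apply: (@le_lt_trans _ _
      (mu ((H n `\` ltrans w (H n)) `|` (F n `\` ltrans w (F n))))).
      rewrite le_measure ?inE//.
      + by apply: measurableD => //; apply: measurable_ltrans.
      + by apply: measurableU; apply: measurableD => //; apply: measurable_ltrans.
      + rewrite /H big_ord_recr /= => x [[Hx|Fx] nx]; [left|right];
          split => // h; apply: nx; by [left|right].
    rewrite (splitr e2) EFinD.
    apply: (@le_lt_trans _ _ (mu (H n `\` ltrans w (H n)) + mu (F n `\` ltrans w (F n)))).
      by apply: measureU2; apply: measurableD => //; apply: measurable_ltrans.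
    rewrite lteD//; near: w; first exact: IHn.
    by case: (HF n) => _; exact.
  near=> w.
  apply: (@le_lt_trans _ _
      (mu ((\bigcup_k F k `\` H n) `|` (H n `\` ltrans w (H n))))).
    rewrite le_measure ?inE//.
    + by apply: measurableD => //; apply: measurable_ltrans.
    + by apply: measurableU; apply: measurableD => //; apply: measurable_ltrans.
    + move=> x [Ux nUx]; have [Hx|nHx] := pselect (H n x); [right|left]; split => //.
      move=> h; apply: nUx; move: h; rewrite /H /ltrans /= -bigcup_mkord => -[k _ ?].
      by exists k.
  rewrite (splitr e) EFinD.
  apply: (@le_lt_trans _ _ (mu (\bigcup_k F k `\` H n) + mu (H n `\` ltrans w (H n)))).
    by apply: measureU2; apply: measurableD => //; apply: measurable_ltrans.
  by rewrite lteD//; near: w; exact: HHn.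
- move=> U oU; split; first exact: open_measurable_group.
  move=> e e0.
  have [dist [_ _ _ dn]] : metrizable R G := metrizableT.
  pose W n := [set y : G | (dist 1%g y < n.+1%:R^-1)%R].
  have nW n : nbhs (1%g : G) (W n) by rewrite dn; exists (n.+1%:R^-1)%R => /=; rewrite ?invr_gt0.
  pose F n := [set x : G | forall w, W n w -> U (w * x)%g]°.
  have [n Hn] : exists n, mu (U `\` F n) < e%:E.
    apply: measure_nondecreasing_gap => //.
    + by move=> n; apply: open_measurable_group; exact: open_interior.
    + exact: open_measurable_group.
    + move=> a b ab; apply/subsetPset; apply: interiorS => x /= Hx w Ww.
      by apply: Hx; move: Ww; rewrite /W /= => /lt_le_trans; apply; rewrite lef_pV2 ?posrE// ler_nat.
    + move=> x Ux.
      have : nbhs (1%g : G, x) ((fun p : G * G => (p.1 * p.2)%g) @^-1` U).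
        apply: (@mulg_continuous G (1%g, x)); rewrite /= mul1g.
        exact: open_nbhs_nbhs.
      move=> [[P Q] /= [nP nQ] PQ].
      move: nP; rewrite dn => -[r /= r0 rP].
      have [n nr] : exists n, (n.+1%:R^-1 < r)%R.
        by have [n] := ltr_add_invr r0; rewrite add0r; exists n.
      exists n => //; apply: filterS nQ => y Qy w Ww.
      apply: (PQ (w, y)); split => //=; apply: rP => /=.
      exact: lt_trans nr.
  near=> w; apply: le_lt_trans Hn.
  have ? := open_measurable_group oU.
  rewrite le_measure ?inE//.
  + by apply: measurableD => //; apply: measurable_ltrans.
  + by apply: measurableD => //; apply: open_measurable_group; exact: open_interior.
  + move=> x [Ux nUx]; split => // /interior_subset; apply: contra_not nUx; apply.
    by near: w; exact: nW.
Unshelve. all: by end_near. Qed.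

End translation_continuity.

Section doeblin.
Context d (R : realType) (G : compactMetrizableGroupType d R).
Local Open Scope ereal_scope.
Variable mu : probability G R.
Hypothesis hmu : haar_probability mu.
Implicit Types (nu : probability G R) (f : G -> \bar R).

Lemma integral_shift_indic (A : set G) (z : G) : measurable A ->
  \int[mu]_x (\1_A x * \1_A (x^-1 * z)%g : R)%:E =
  mu (A `&` [set x | A (x^-1 * z)%g]).
Proof.
move=> mA.
have mB : measurable [set x | A (x^-1 * z)%g].
  rewrite -[X in measurable X]setTI.
  exact: (measurableT_comp (measurable_mulr z) (@measurable_inv _ _ G)).
transitivity (\int[mu]_x (\1_(A `&` [set x | A (x^-1 * z)%g]) x)%:E); last first.
  by rewrite integral_indic ?setIT//; exact: measurableI.
apply: eq_integral => x _; congr EFin; rewrite !indicE in_setI -natrM mulnb.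
by congr (_ && _)%:R; apply/idP/idP => /set_mem ?; apply/mem_set.
Qed.

(** A Steinhaus argument: [phi] is the convolution of the indicator of [A] with itself. Its integral
    is the square of [mu A], so it is positive at some [z0]; moving [z0] to [z] translates one of
    the two sets, so continuity of translation keeps [phi] above half of [phi z0] nearby. *)
Lemma convolution_density_open (A : set G) : measurable A -> 0 < mu A ->
  exists V (c : R), [/\ open V, V !=set0, (0 < c)%R &
    forall z, V z -> c%:E <= mu (A `&` [set x | A (x^-1 * z)%g])].
Proof.
move=> mA A0.
pose phi z := mu (A `&` [set x | A (x^-1 * z)%g]).
have mB z : measurable [set x | A (x^-1 * z)%g].
  rewrite -[X in measurable X]setTI.
  exact: (measurableT_comp (measurable_mulr z) (@measurable_inv _ _ G)).
have [z0 phi0] : exists z, 0 < phi z.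
  apply: contrapT => /forallNP H.
  have phi0 z : phi z = 0.
    by apply/eqP; rewrite eq_le measure_ge0 andbT leNgt; apply/negP/H.
  have mk : measurable_fun setT (fun p : G * G => (\1_A p.1 * \1_A (p.1^-1 * p.2)%g : R)%:E).
    apply/measurable_EFinP; apply: measurable_funM.
      exact: (measurableT_comp (measurable_indic mA)).
    apply: (measurableT_comp (measurable_indic mA)).
    apply: measurable_funMg => //; exact: (measurableT_comp (@measurable_inv _ _ G)).
  have := @fubini_tonelli _ _ _ _ _ mu mu _ mk
    (fun p => _ : 0 <= (\1_A p.1 * \1_A (p.1^-1 * p.2)%g : R)%:E) => /=.
  have k0 (p : G * G) : 0 <= (\1_A p.1 * \1_A (p.1^-1 * p.2)%g : R)%:E.
    by rewrite lee_fin mulr_ge0.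
  move=> /(_ k0).
  under [X in _ = X -> _]eq_integral => z _.
    rewrite integral_shift_indic// -/(phi z) phi0.
    over.
  rewrite integral0.
  have E x : \int[mu]_z (\1_A x * \1_A (x^-1 * z)%g : R)%:E = (\1_A x)%:E * mu A.
    under eq_integral => z _ do rewrite EFinM.
    rewrite ge0_integralZl//; last first.
      apply/measurable_EFinP/(measurableT_comp (measurable_indic mA)).
      exact: measurable_mull.
    rewrite (haar_integral _ (f := fun z => (\1_A z)%:E))//; last exact/measurable_EFinP.
    by rewrite integral_indic// setIT.
  under eq_integral do rewrite E.
  rewrite ge0_integralZr//; last exact/measurable_EFinP.
  rewrite integral_indic// setIT => /eqP; rewrite mule_eq0 orbb.
  by apply/negP; rewrite gt_eqF.
have phifin z : phi z \is a fin_num by rewrite fin_num_measure//; exact: measurableI.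
pose c := (fine (phi z0) / 2)%R.
have c0 : (0 < c)%R by rewrite divr_gt0// fine_gt0// phi0 ltey_eq phifin.
exists [set z | c%:E < phi z]°, c; split => //; first exact: open_interior; last first.
  by move=> z /interior_subset /ltW.
exists z0; rewrite /interior /=.
have H : \forall w \near (1%g : G),
    mu ([set x | A (x^-1 * z0)%g] `\` ltrans w [set x | A (x^-1 * z0)%g]) < c%:E.
  exact: measure_ltrans_near.
have : (fun z : G => z0 * z^-1)%g z @[z --> z0] --> (1%g : G).
  rewrite -[X in _ --> X](@mulgV G z0).
  apply: (@continuous_comp _ _ _ (fun x : G => x^-1)%g (fun x : G => z0 * x)%g).
    exact: invg_continuous.
  exact: continuous_mull.
move=> /(_ _ H) {}H.
have {}H : \forall z \near z0, mu ([set x | A (x^-1 * z0)%g] `\`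
  ltrans (z0 * z^-1)%g [set x | A (x^-1 * z0)%g]) < c%:E := H.
apply: filterS H => z.
rewrite (_ : ltrans _ _ = [set x | A (x^-1 * z)%g]); last first.
  by apply/seteqP; split => x; rewrite /ltrans /= !invgM invgK mulgA mulgVK.
move=> H /=.
have : phi z0 < phi z + c%:E.
  apply: (@le_lt_trans _ _ (phi z +
    mu ([set x | A (x^-1 * z0)%g] `\` [set x | A (x^-1 * z)%g]))); last first.
    by rewrite lteD2lE.
  apply: le_trans (measureU2 _ _ _); last 2 first.
  - exact: measurableI.
  - exact: measurableD.
  rewrite le_measure ?inE//.
  - exact: measurableI.
  - by apply: measurableU; [exact: measurableI|exact: measurableD].
  move=> x [Ax Axz]; have [?|?] := pselect (A (x^-1 * z)%g); [left|right]; split => //.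
rewrite -(fineK (phifin z0)) -(fineK (phifin z)) -EFinD !lte_fin /c; lra.
Qed.

(** Restricting both factors to [A] costs [e] twice, and leaves the convolution of the indicator of
    [A] with itself as a density, at least [c] on [V]. *)
Lemma convolution_minorization nu (A : set G) (e : R) : measurable A ->
  0 < mu A -> (0 < e)%R ->
  (forall f, measurable_fun setT f -> (forall x, 0 <= f x) ->
    e%:E * \int[mu]_(x in A) f x <= \int[nu]_x f x) ->
  exists V (c : R), [/\ open V, V !=set0, (0 < c)%R &
    forall f, measurable_fun setT f -> (forall x, 0 <= f x) ->
    c%:E * \int[mu]_(x in V) f x <= \int[nu]_x \int[nu]_y f (x * y)%g].
Proof.
move=> mA A0 e0 H.
have [V [c [oV ntV c0 Vc]]] := convolution_density_open mA A0.
exists V, (e * (e * c))%R; split => //; first by rewrite !mulr_gt0.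
move=> f mf f0.
have mV := open_measurable_group oV.
pose F x := \int[nu]_y f (x * y)%g.
apply: le_trans (H F _ _); last 2 first.
- exact: measurable_integral_mul.
- by move=> x; exact: integral_ge0.
rewrite EFinM -muleA lee_pmul2l// ?lte_fin//.
have mk : measurable_fun setT
    (fun p : G * G => f p.2 * (\1_A p.1 * \1_A (p.1^-1 * p.2)%g : R)%:E).
  apply: emeasurable_funM; first exact: (measurableT_comp mf).
  apply/measurable_EFinP; apply: measurable_funM.
    exact: (measurableT_comp (measurable_indic mA)).
  apply: (measurableT_comp (measurable_indic mA)).
  apply: measurable_funMg => //; exact: (measurableT_comp (@measurable_inv _ _ G)).
have k0 (p : G * G) : 0 <= f p.2 * (\1_A p.1 * \1_A (p.1^-1 * p.2)%g : R)%:E.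
  by rewrite mule_ge0// lee_fin mulr_ge0.
(* The middle term is the inner integral after the change of variable [z = x * y], which left
   invariance allows for each fixed [x]. *)
apply: (@le_trans _ _ (e%:E * \int[mu]_x \int[mu]_z
    (f z * (\1_A x * \1_A (x^-1 * z)%g : R)%:E))); last first.
  rewrite -ge0_integralZl//; last 3 first.
  - exact: (measurable_fun_fubini_tonelli_F _ mk).
  - by move=> x _; apply: integral_ge0 => z _; exact: (k0 (x, z)).
  - by rewrite lee_fin ltW.
  rewrite [leRHS]integral_mkcond; apply: ge0_le_integral => //.
  - move=> x _; apply: mule_ge0; first by rewrite lee_fin ltW.
    by apply: integral_ge0 => z _; exact: (k0 (x, z)).
  - apply: measurable_funeM; exact: (measurable_fun_fubini_tonelli_F _ mk).
  - by apply/(measurable_restrictT _ mA); apply: measurable_funTS; exact: measurable_integral_mul.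
  move=> x _; rewrite patchE; case: ifPn => xA; last first.
    rewrite integral0_eq ?mule0// => z _.
    by rewrite indicE (negbTE xA) mul0r mule0.
  apply: le_trans (H (fun y => f (x * y)%g) _ _) => //; last exact: measurableT_comp mf (measurable_mull x).
  rewrite lee_pmul2l ?lte_fin// [leRHS]integral_mkcond.
  rewrite -(haar_integral x (f := fun z => f z * _))//; last exact: (measurable_fun_pair2 x mk).
  rewrite le_eqVlt; apply/orP; left; apply/eqP; apply: eq_integral => z _.
  rewrite mulKg patchE !indicE xA mul1r; case: ifPn => _; by rewrite ?mule1 ?mule0.
rewrite EFinM -muleA lee_pmul2l ?lte_fin//.
rewrite (@fubini_tonelli _ _ _ _ _ mu mu _ mk)//=.
rewrite -ge0_integralZl//; last 2 first.
- exact: measurable_funS mf.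
- by rewrite lee_fin ltW.
rewrite [leLHS]integral_mkcond; apply: ge0_le_integral => //.
- by move=> z _; rewrite patchE; case: ifPn => // _; rewrite mule_ge0// lee_fin ltW.
- by apply/(measurable_restrictT _ mV); apply: measurable_funTS; exact: measurable_funeM.
- exact: (measurable_fun_fubini_tonelli_G _ mk).
move=> z _; rewrite patchE; case: ifPn => [/set_mem Vz|_]; last first.
  by apply: integral_ge0 => x _; exact: (k0 (x, z)).
rewrite ge0_integralZl//; last first.
  apply/measurable_EFinP; apply: measurable_funM => //.
  apply: (measurableT_comp (measurable_indic mA)).
  exact: (measurableT_comp (measurable_mulr z) (@measurable_inv _ _ G)).
rewrite muleC lee_wpmul2l//.
apply: le_trans (Vc z Vz) _.
by rewrite integral_shift_indic.
Qed.

End doeblin.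

(** * Recurrence in compact groups *)

Section compact_group_recurrence.
Context d (R : realType) (G : compactMetrizableGroupType d R).
Implicit Types (x y t : G) (W : set G).

Lemma nbhs_mulg x y W : nbhs (x * y)%g W -> exists P Q,
  [/\ open P, open Q, P x, Q y & forall a b, P a -> Q b -> W (a * b)%g].
Proof.
move=> /(@mulg_continuous G (x, y)) [[P Q] /= [nP nQ] PQ].
exists P°, Q°; split => //; [exact: open_interior|exact: open_interior|].
by move=> a b /interior_subset ? /interior_subset ?; exact: (PQ (a, b)).
Qed.

Lemma continuous_funMg (f g : G -> G) :
  continuous f -> continuous g -> continuous (fun x => f x * g x)%g.
Proof.
move=> cf cg x; apply: (@cvg_comp _ _ _ (fun x => (f x, g x))
  (fun p : G * G => (p.1 * p.2)%g) _ (nbhs (f x, g x))).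
  by apply: cvg_pair; [exact: cf|exact: cg].
exact: (@mulg_continuous G (f x, g x)).
Qed.

Lemma continuous_conj a b : continuous (fun s : G => s^-1 * a * s * b)%g.
Proof.
do 2 (apply: continuous_funMg; last by [move=> ?; exact: cvg_id|move=> ?; exact: cvg_cst]).
by apply: continuous_funMg; [exact: invg_continuous|move=> ?; exact: cvg_cst].
Qed.

(** The powers of [t] cluster at some [z]. Two of them, [t^j] and [t^k] with [k >= j + m], are so
    close to [z] that [t^-j t^k] is close to [z^-1 z = 1]. *)
Lemma expg_recurrent t W m : nbhs (1%g : G) W -> exists2 n, (m <= n)%N & W (t ^+ n)%g.
Proof.
move=> nW.
pose F := (fun n => t ^+ n)%g @ \oo.
have [z [_ cz]] : [set: G] `&` cluster F !=set0.
  by apply: compact_setT; exact: filterT.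
have : nbhs (z^-1 * z)%g W by rewrite mulVg.
move=> /nbhs_mulg[P [Q [oP oQ Pz Qz PQ]]].
have nN : nbhs z ((fun x : G => x^-1)%g @^-1` P `&` Q).
  apply: filterI; last exact: open_nbhs_nbhs.
  by apply: (@invg_continuous G z); exact: open_nbhs_nbhs.
have FT : F (range (fun n => t ^+ n)%g) by exists 0%N => // k _; exists k.
have [_ [[j _ <-] [jP jQ]]] := cz _ _ FT nN.
have Fk : F [set t ^+ k | k in [set k | (j + m <= k)%N]]%g.
  by exists (j + m)%N => // k /= jmk; exists k.
have [_ [[k /= jmk <-] [kP kQ]]] := cz _ _ Fk nN.
exists (k - j)%N; first by rewrite leq_subRL ?(leq_trans _ jmk)// leq_addr.
have jk : (j <= k)%N by rewrite (leq_trans _ jmk)// leq_addr.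
by have := PQ _ _ jP kQ; rewrite -{1}(subnKC jk) expgnDr mulKg.
Qed.

(** Inverses are limits of positive powers: when [x^(n+1)] is near [1], [x^n] is near [x^-1]. *)
Lemma closed_semigroup_subgroup (S : set G) : closed S -> S !=set0 ->
  (forall x y, S x -> S y -> S (x * y)%g) -> subgroup S.
Proof.
move=> cS [s Ss] SM.
have SX x n : S x -> S (x ^+ n.+1)%g.
  by move=> Sx; elim: n => [|n IH]; rewrite ?expg1// expgS; exact: SM.
have S1 : S 1%g.
  apply: cS => W nW; have [[//|n] _ Wn] := expg_recurrent s 1 nW.
  by exists (s ^+ n.+1)%g; split => //; exact: SX.
split => // x Sx; apply: cS => W nW.
have : nbhs (1%g : G) ((fun y : G => x^-1 * y)%g @^-1` W).
  by apply: continuous_mull; rewrite mulg1.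
(* The threshold 2 leaves a positive exponent after one factor [x] is removed, so the power is still
   in [S]. *)
move=> /(expg_recurrent x 2)[[//|[//|n]] _ /= Wn].
exists (x ^+ n.+1)%g; split; first exact: SX.
by move: Wn; rewrite expgS mulKg.
Qed.

End compact_group_recurrence.

Section support_growth.
Context d (R : realType) (G : compactMetrizableGroupType d R).
Local Open Scope ereal_scope.
Implicit Types (m nu : probability G R) (x y t : G).

(** Membership in the support, expressed by neighbourhoods rather than by closed sets of full
    measure: this form passes to products. *)
Definition charged m x := forall U : set G, open U -> U x -> 0 < m U.

Lemma charged_convolution m1 m2 x y :
  charged m1 x -> charged m2 y -> charged (convolution m1 m2) (x * y)%g.
Proof.
move=> cx cy U oU Uxy.
have [P [Q [oP oQ Px Qy PQ]]] := nbhs_mulg (open_nbhs_nbhs (conj oU Uxy)).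
have mP := open_measurable_group oP; have mQ := open_measurable_group oQ.
apply: (@lt_le_trans _ _ ((m1 \x m2) (P `*` Q))).
  by rewrite product_measure1E// mule_gt0//; [exact: cx|exact: cy].
rewrite le_measure ?inE//; first exact: measurableX.
  rewrite -[X in measurable X]setTI; apply: (@measurable_mulg d R G) => //.
  exact: open_measurable_group.
by move=> [a b] [/= Pa Qb]; exact: PQ.
Qed.

Lemma measure_integral_indic m B : measurable B ->
  m B = \int[m]_x (\1_B x)%:E.
Proof. by move=> mB; rewrite integral_indic// setIT. Qed.

Lemma convolution_powD nu j k B : measurable B ->
  convolution_pow nu (j + k) B =
  convolution (convolution_pow nu j) (convolution_pow nu k) B.
Proof.
move=> mB.
have mI : measurable_fun setT (fun x : G => (\1_B x : R)%:E).
  exact/measurable_EFinP.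
rewrite !(measure_integral_indic _ mB).
by rewrite ge0_integral_convolution_powD// ge0_integral_convolution.
Qed.

Lemma charged_powD nu j k x y : charged (convolution_pow nu j) x ->
  charged (convolution_pow nu k) y -> charged (convolution_pow nu (j + k)) (x * y)%g.
Proof.
move=> cx cy U oU Uxy; rewrite convolution_powD; last exact: open_measurable_group.
exact: charged_convolution Uxy.
Qed.

Lemma charged_pow0 nu : charged (convolution_pow nu 0) 1%g.
Proof. by move=> U oU U1; rewrite /= diracE mem_set. Qed.

Lemma convolution_pow1 nu B : measurable B -> convolution_pow nu 1 B = nu B.
Proof.
move=> mB; have mI : measurable_fun setT (fun x : G => (\1_B x : R)%:E).
  exact/measurable_EFinP.
rewrite !(measure_integral_indic _ mB) ge0_integral_convolution//=.
rewrite integral_dirac//; last exact: (measurable_integral_mul nu mI).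
by rewrite diracT mul1e; apply: eq_integral => x _; rewrite mul1g.
Qed.

Lemma charged_pow1 nu x : charged nu x -> charged (convolution_pow nu 1) x.
Proof.
by move=> cx U oU Ux; rewrite convolution_pow1; [exact: cx|exact: open_measurable_group].
Qed.

Lemma support_charged nu : Defs.support nu `<=` charged nu.
Proof.
move=> x sx U oU Ux; rewrite lt0e measure_ge0 andbT; apply/eqP => nU0.
have mU := open_measurable_group oU.
apply: (sx (~` U)) => //; split; first exact: open_closedC.
by rewrite probability_setC// nU0 sube0.
Qed.

Lemma closed1 : closed [set (1%g : G)].
Proof.
have [dist [d0 ds dt dn]] : metrizable R G := metrizableT.
move=> x clx; apply/d0.
have dx0 : (0 <= dist x 1%g)%R.
  have := dt x 1%g x; rewrite (proj2 (d0 x x))// (ds 1%g x) => h.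
  by rewrite -(@pmulrn_lge0 _ _ 2)// mulr2n.
apply/eqP; rewrite eq_le dx0 andbT leNgt; apply/negP => dpos.
have nx : nbhs x [set y | (dist x y < dist x 1%g)%R] by rewrite dn; exists (dist x 1%g).
by have [_ [-> /=]] := clx _ nx; rewrite ltxx.
Qed.

(** Without charged points the support would be empty, hence inside the trivial subgroup, against
    adaptedness. When the trivial subgroup is all of [G], the point [1] is charged. *)
Lemma exists_charged nu : adapted nu -> exists t, charged nu t.
Proof.
move=> ad; apply: contrapT => /forallNP nc.
have snu H : Defs.support nu `<=` H by move=> x /support_charged /nc.
have [G1|G1] := eqVneq [set (1%g : G)] setT.
  apply: (nc 1%g) => U oU U1.
  rewrite (_ : U = setT) ?probability_setT ?lte01//.
  apply/seteqP; split => // x _; suff : [set (1%g : G)] x by move=> ->.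
  by rewrite G1.
apply: (ad _ closed1 _ G1); last exact: snu.
split => //= [x y -> ->|x ->]; by rewrite ?mul1g ?invg1.
Qed.

Section limit_subgroup.
Variables (nu : probability G R) (t : G).
Hypotheses (ad : adapted nu) (sa : strictly_aperiodic nu) (ct : charged nu t).

Local Notation T n := (charged (convolution_pow nu n)).

Let charged_expg n : T n (t ^+ n)%g.
Proof.
elim: n => [|n IH]; first exact: charged_pow0.
rewrite expgSr -addn1; apply: charged_powD => //; exact: charged_pow1.
Qed.

(** Multiplying by [t^-n] makes the sets of charged points increase with [n], since [t] itself is
    charged. This is where the drift along the coset of [t] is removed. *)
Let A0 : set G := [set a | exists n, T n (t ^+ n * a)%g].
Let A := closure A0.

(* For [a, b] with [t^n a], [t^m b] charged, [t^-k a t^k b] lies in [A0] for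
   [k >= m], and tends to [a b] along the times at which [t^k] returns to [1]. *)
Let A_mul x y : A x -> A y -> A (x * y)%g.
Proof.
move=> Ax Ay W /nbhs_interior/nbhs_mulg[P [Q [oP oQ Px Qy PQ]]].
have [a [[n Tna] Pa]] := Ax _ (open_nbhs_nbhs (conj oP Px)).
have [b [[m Tmb] Qb]] := Ay _ (open_nbhs_nbhs (conj oQ Qy)).
have : nbhs (1%g : G) ((fun s : G => s^-1 * a * s * b)%g @^-1` W).
  by apply: (@continuous_conj _ _ _ a b 1%g); rewrite invg1 mul1g mulg1; exact: PQ Pa Qb.
move=> /(expg_recurrent t m)[k mk Wk]; exists (t ^- k * a * t ^+ k * b)%g.
split => //; exists (n + k)%N.
rewrite (_ : _ * _ = (t ^+ n * a) * (t ^+ (k - m) * (t ^+ m * b)))%g; last first.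
  by rewrite expgnDr !mulgA mulgK -[in RHS](mulgA _ (t ^+ (k - m))%g) -expgnDr subnK.
have -> : (n + k = n + ((k - m) + m))%N by rewrite subnK.
by apply: charged_powD => //; exact: charged_powD.
Qed.

(** If [t^n a] is charged then so is [t^n a t^k], so [t^-k a t^k] lies in [A0]; it tends to
    [t a t^-1] along the times at which [t^(k+1)] returns to [1]. *)
Let A_conj x : A x -> A (t * x * t^-1)%g.
Proof.
move=> Ax W /nbhs_interior nW.
have ccj : continuous (fun z : G => t * z * t^-1)%g.
  apply: continuous_funMg; last by move=> ?; exact: cvg_cst.
  exact: continuous_mull.
have [a [[n Tna] Wa]] := Ax _ (ccj x _ nW).
have : nbhs (1%g : G) ((fun s : G => s^-1 * (t * a) * s * t^-1)%g @^-1` W).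
  by apply: (@continuous_conj _ _ _ (t * a)%g t^-1%g 1%g); rewrite invg1 mul1g mulg1.
move=> /(expg_recurrent t 1)[[//|k] _ Wk]; exists (t ^- k.+1 * (t * a) * t ^+ k.+1 * t^-1)%g.
split => //; exists (n + k)%N.
rewrite (_ : _ * _ = (t ^+ n * a) * t ^+ k)%g; last first.
  rewrite (_ : t ^- k.+1 = t ^- k * t^-1)%g ?expgS ?invgM// -expgS expgSr.
  by rewrite expgnDr !mulgA mulgK mulgVK mulgK.
exact: charged_powD.
Qed.

Let A_closed : closed A. Proof. exact: closed_closure. Qed.

Let A0_1 : A0 1%g.
Proof. by exists 0%N; rewrite mulg1; exact: charged_expg. Qed.

Let A_subgroup : subgroup A.
Proof.
apply: closed_semigroup_subgroup => //.
by exists 1%g; apply: subset_closure.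
Qed.

Let A_charged x : charged nu x -> A (t^-1 * x)%g.
Proof.
move=> cx; apply: subset_closure; exists 1%N; rewrite expg1 mulVKg.
exact: charged_pow1.
Qed.

(** The elements that conjugate [A] into itself form a closed semigroup, hence a subgroup. It
    contains [t] and [A], hence the support, and adaptedness makes it [G]. *)
Let A_normal : normal_subgroup A.
Proof.
have [A1 AM AV] := A_subgroup.
pose N := [set g | forall a, A a -> A (g * a * g^-1)%g].
have cN : closed N.
  rewrite (_ : N = \bigcap_(a in A) ((fun g => g * a * g^-1)%g @^-1` A)).
    apply: closed_bigI => a Aa; move: A A_closed; apply/continuous_closedP.
    apply: continuous_funMg; last exact: invg_continuous.
    exact: continuous_mulr.
  by apply/seteqP; split => g /= Hg a; exact: Hg.
have NM x y : N x -> N y -> N (x * y)%g.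
  by move=> Nx Ny a /Ny/Nx; rewrite invgM !mulgA.
have Nt : N t by move=> a; exact: A_conj.
have AN a : A a -> N a.
  by move=> Aa b Ab; exact: AM (AM _ _ Aa Ab) (AV _ Aa).
have sN : subgroup N by apply: closed_semigroup_subgroup => //; exists t.
have NT : N = setT.
  apply/eqP; apply: contrapT => /negP NT; apply: (ad cN sN NT) => x /support_charged cx.
  by rewrite -(mulVKg t x); apply: NM => //; exact/AN/A_charged.
split => // g h Ah; rewrite /conjg.
have : N g^-1%g by rewrite NT.
by move=> /(_ h Ah); rewrite invgK mulgA.
Qed.

(** By [A_charged] the support lies in the coset [t A], which strict aperiodicity permits only if
    [A] is the whole group. *)
Lemma limit_subgroupT : closure [set a | exists n, T n (t ^+ n * a)%g] = setT.
Proof.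
apply/eqP; apply: contrapT => /negP AT.
apply: (sa A_closed A_normal AT (g := t)) => x /support_charged cx.
by exists (t^-1 * x)%g; rewrite ?mulVKg//; exact: A_charged.
Qed.

(** Density of [A0] puts each [z] in some translate [a V], and a neighbourhood of [z] with it. As
    the sets [Z n] increase, compactness yields one [n] for all points. *)
Lemma charged_covering (V : set G) : open V -> V !=set0 ->
  exists n, forall z, exists2 y, T n y & V (y^-1 * z)%g.
Proof.
move=> oV [v Vv].
pose Z n := [set z | exists2 a, T n (t ^+ n * a)%g & V (a^-1 * z)%g].
have : \forall n \near \oo, [set: G] `<=` Z n.
  have /compact_near_coveringP/(_ nat \oo (fun n z => Z n z)) := @compact_setT _ R G.
  apply => z _.
  have nU : nbhs (z * v^-1)%g [set a | V (a^-1 * z)%g].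
    apply: (@continuous_funMg _ _ _ (fun a => a^-1)%g (fun=> z)).
    - exact: invg_continuous.
    - by move=> ?; exact: cvg_cst.
    - by rewrite invgM invgK mulgVK; exact: open_nbhs_nbhs.
  have Az : closure A0 (z * v^-1)%g by rewrite [closure _]limit_subgroupT.
  have [a [[n Tna] /= Vaz]] := Az _ nU.
  have nz : nbhs z [set z | V (a^-1 * z)%g].
    by apply: continuous_mull; exact: open_nbhs_nbhs.
  exists ([set z | V (a^-1 * z)%g], [set k | (n <= k)%N]) => /=.
    by split => //; exact: nbhs_infty_ge.
  move=> [z' k] /= [Vaz' nk]; exists a => //.
  rewrite -(subnK nk) expgnDr -mulgA; exact: charged_powD.
(* The translates in [Z n] are by [a], the charged points are [t^n a]: evaluating at [t^-n z] makes
   up for the factor. *)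
move=> [n _ /(_ n (leqnn n)) ZT]; exists n => z.
have [a Ta Va] := ZT (t ^- n * z)%g I.
by exists (t ^+ n * a)%g => //; rewrite invgM -mulgA.
Qed.

End limit_subgroup.

End support_growth.

Section mixing.
Context d (R : realType) (G : compactMetrizableGroupType d R).
Variables mu nu : probability G R.
Hypothesis hmu : haar_probability mu.
Local Open Scope ereal_scope.

(** The last [m] factors have density at least [c] on [V]; translated by the first [n] factors, this
    gives density at least [c * psi z] at [z]. By the covering, [psi] is locally bounded below by a
    positive constant, hence globally by compactness. *)
Lemma doeblin_of_open (V : set G) (c : R) m n : open V -> (0 < c)%R ->
  (forall f : G -> \bar R, measurable_fun setT f -> (forall x, 0 <= f x) ->
    c%:E * \int[mu]_(x in V) f x <= \int[convolution_pow nu m]_x f x) ->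
  (forall z, exists2 y, charged (convolution_pow nu n) y & V (y^-1 * z)%g) ->
  exists2 e : R, (0 < e)%R &
  forall f : G -> \bar R, measurable_fun setT f -> (forall x, 0 <= f x) ->
    e%:E * \int[mu]_x f x <= \int[convolution_pow nu (n + m)]_x f x.
Proof.
move=> oV c0 minV cov.
set nun := convolution_pow nu n.
pose psi z := \int[nun]_y (\1_V (y^-1 * z)%g : R)%:E.
have mV := open_measurable_group oV.
have [N psiN] : exists N : nat, forall z, (N.+1%:R^-1)%:E <= psi z.
  have /compact_near_coveringP/(_ nat \oo
      (fun N z => (N.+1%:R^-1)%:E <= psi z)) := @compact_setT _ R G.
  suff: forall x : G, [set: G] x -> \forall x' \near x & i \near \oo, (i.+1%:R^-1)%:E <= psi x'.
    by move=> h /(_ _ h) [N _ /(_ N (leqnn N)) hN]; exists N => z; exact: hN.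
  move=> z _; have [y cy Vyz] := cov z.
  have [P [Q [oP oQ Py Qz PQ]]] := nbhs_mulg (open_nbhs_nbhs (conj oV Vyz)).
  pose U := (fun x : G => x^-1)%g @^-1` P.
  have oU : open U by move: P oP {Py PQ} @U; apply/continuousP; exact: invg_continuous.
  have mU := open_measurable_group oU.
  have U0 : 0 < nun U by exact: cy.
  have Ufin : nun U \is a fin_num by rewrite fin_num_measure.
  have [N HN] : exists N : nat, (N.+1%:R^-1 < fine (nun U))%R.
    have [|N] := @ltr_add_invr R 0 (fine (nun U)); last by rewrite add0r; exists N.
    by rewrite fine_gt0// U0 ltey_eq Ufin.
  exists (Q, [set k | (N <= k)%N]) => /=.
    by split; [exact: open_nbhs_nbhs|exact: nbhs_infty_ge].
  move=> [z' k] /= [Qz' Nk].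
  apply: (@le_trans _ _ (nun U)).
    rewrite -(fineK Ufin) lee_fin (le_trans _ (ltW HN))// lef_pV2 ?posrE//.
    by rewrite ler_nat.
  rewrite measure_integral_indic//; apply: ge0_le_integral => //.
  - exact/measurable_EFinP.
  - apply/measurable_EFinP/(measurableT_comp (measurable_indic mV)).
    exact: (measurableT_comp (measurable_mulr z') (@measurable_inv _ _ G)).
  - move=> x _; rewrite lee_fin !indicE; case: (boolP (x \in U)) => // /set_mem Ux.
    by rewrite mem_set//; exact: PQ.
exists (c * N.+1%:R^-1)%R; first by rewrite mulr_gt0.
move=> f mf f0.
rewrite ge0_integral_convolution_powD// -/nun.
have mk : measurable_fun setT (fun p : G * G => (\1_V (p.1^-1 * p.2)%g : R)%:E * f p.2).
  apply: emeasurable_funM; last exact: (measurableT_comp mf).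
  apply/measurable_EFinP/(measurableT_comp (measurable_indic mV)).
  apply: measurable_funMg => //; exact: (measurableT_comp (@measurable_inv _ _ G)).
have k0 (p : G * G) : 0 <= (\1_V (p.1^-1 * p.2)%g : R)%:E * f p.2.
  by rewrite mule_ge0// lee_fin.
apply: (@le_trans _ _ (\int[nun]_y (c%:E * \int[mu]_z ((\1_V (y^-1 * z)%g : R)%:E * f z)))); last first.
  apply: ge0_le_integral => //.
  - move=> y _; apply: mule_ge0; first by rewrite lee_fin ltW.
    by apply: integral_ge0 => z _; exact: (k0 (y, z)).
  - apply: measurable_funeM; exact: (measurable_fun_fubini_tonelli_F _ mk).
  - exact: measurable_integral_mul.
  move=> y _.
  apply: le_trans (minV (fun x => f (y * x)%g) _ _) => //; last exact: measurableT_comp mf (measurable_mull y).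
  rewrite lee_pmul2l ?lte_fin// [leRHS]integral_mkcond.
  rewrite -(haar_integral y (f := fun z => _ * f z))//; last exact: (measurable_fun_pair2 y mk).
  rewrite le_eqVlt; apply/orP; left; apply/eqP; apply: eq_integral => z _.
  by rewrite mulKg patchE indicE; case: ifPn => _; rewrite ?mul1e ?mul0e.
rewrite ge0_integralZl//; last 3 first.
- exact: (measurable_fun_fubini_tonelli_F _ mk).
- by move=> y _; apply: integral_ge0 => z _; exact: (k0 (y, z)).
- by rewrite lee_fin ltW.
rewrite EFinM -muleA lee_pmul2l ?lte_fin//.
rewrite (@fubini_tonelli _ _ _ _ _ nun mu _ mk)//=.
rewrite -ge0_integralZl//; apply: ge0_le_integral => //.
- by move=> z _; apply: mule_ge0.
- exact: measurable_funeM.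
- exact: (measurable_fun_fubini_tonelli_G _ mk).
move=> z _; rewrite ge0_integralZr//; last first.
  apply/measurable_EFinP/(measurableT_comp (measurable_indic mV)).
  exact: (measurableT_comp (measurable_mulr z) (@measurable_inv _ _ G)).
by rewrite lee_wpmul2r//; exact: psiN.
Qed.

Definition nonsingular_power :=
  exists k : nat, (1 <= k)%N /\
      exists nu_abs nu_sing : {measure set G -> \bar R},
        lebesgue_decomposition mu (convolution_pow nu k) nu_abs nu_sing /\
        nu_abs [set: G] != 0%E.

Lemma doeblin : adapted nu -> strictly_aperiodic nu -> nonsingular_power ->
  exists m (e : R), [/\ (0 < m)%N, (0 < e)%R &
  forall f : G -> \bar R, measurable_fun setT f -> (forall x, 0 <= f x) ->
    e%:E * \int[mu]_x f x <= \int[convolution_pow nu m]_x f x].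
Proof.
move=> ad sa [k [k1 [na [ns [[dec namu _] na0]]]]].
have le_na B : measurable B -> na B <= convolution_pow nu k B.
  by move=> mB; rewrite dec// leeDl.
have naoo : na setT < +oo.
  by rewrite (le_lt_trans (le_na _ measurableT))// (le_lt_trans (probability_le1 _ _))// ltry.
have [A [e [mA A0 e0 eA]]] := abs_continuous_minorization namu naoo na0.
have [V [c [oV ntV c0 cV]]] : exists V (c : R), [/\ open V, V !=set0, (0 < c)%R &
    forall f, measurable_fun setT f -> (forall x, 0 <= f x) -> c%:E * \int[mu]_(x in V) f x <=
      \int[convolution_pow nu k]_x \int[convolution_pow nu k]_y f (x * y)%g].
  apply: (convolution_minorization hmu mA A0 e0) => f mf f0; apply: ge0_le_integral_scale => // B mB BA.
  exact: le_trans (eA _ mB BA) (le_na _ mB).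
have [t ct] := exists_charged ad.
have [n cov] := charged_covering ad sa ct oV ntV.
have [|e' e'0 He'] := @doeblin_of_open V c (k + k) n oV c0 _ cov.
  by move=> f mf f0; rewrite ge0_integral_convolution_powD//; exact: cV.
exists (n + (k + k))%N, e'; split => //.
by rewrite addn_gt0 addn_gt0 k1 /= orbT.
Qed.

End mixing.

(** * Mixing rates *)

Section convolution_integral.
Context d (R : realType) (G : compactMetrizableGroupType d R).
Implicit Types (nu : probability G R) (g : G -> R).

Lemma measurable_mul_Rint nu g : measurable_fun setT g ->
  measurable_fun setT (fun x => \int[nu]_y g (x * y)%g).
Proof.
move=> mg; apply: (measurable_Rint2 nu (F := fun p : G * G => g (p.1 * p.2)%g)).
by apply: (measurableT_comp mg); exact: measurable_funMg.
Qed.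

Lemma Rint_convolution_powD nu j k g B : measurable_fun setT g ->
  (forall x, `|g x| <= B) ->
  \int[convolution_pow nu (j + k)]_x g x =
  \int[convolution_pow nu j]_x \int[convolution_pow nu k]_y g (x * y)%g.
Proof.
move=> mg gB.
have mgx x : measurable_fun setT (fun y => g (x * y)%g).
  exact: measurableT_comp mg (measurable_mull x).
have mBg : measurable_fun setT (fun x => B + g x) by exact: measurable_funD.
have Bg0 x : 0 <= B + g x by rewrite -lerBlDl sub0r; case/ler_normlP: (gB x); rewrite lerNl.
have lg (P : probability G R) : L1 P g by exact: L1_bounded gB.
have lgx (P : probability G R) x : L1 P (fun y => g (x * y)%g).
  exact: L1_bounded _ (mgx x) _.
(* Adding the constant [B] makes the integrand nonnegative, where the extended identity applies. *)
suff : B + \int[convolution_pow nu (j + k)]_x g x =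
    B + \int[convolution_pow nu j]_x \int[convolution_pow nu k]_y g (x * y)%g.
  by move/addrI.
have lc (P : probability G R) : L1 P (fun=> B) by exact: L1_cst.
have lphi : L1 (convolution_pow nu j) (fun x => \int[convolution_pow nu k]_y g (x * y)%g).
  apply: (L1_bounded (B := B) _ (measurable_mul_Rint _ mg)) => x; exact: Rint_bounded.
have := RintD (lc (convolution_pow nu (j + k))) (lg _); rewrite Rint_cst => <-.
have := RintD (lc (convolution_pow nu j)) lphi; rewrite Rint_cst => <-.
rewrite /Rintegral ge0_integral_convolution_powD//; last exact/measurable_EFinP.
congr fine; apply: eq_integral => x _.
have := RintD (lc (convolution_pow nu k)) (lgx _ x); rewrite Rint_cst => <-.
by rewrite EFin_Rint//; exact: L1D.
Qed.

End convolution_integral.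

Section mixing_rate.
Context d (R : realType) (G : compactMetrizableGroupType d R).
Variables mu nu : probability G R.
Hypothesis hmu : haar_probability mu.

Lemma haar_Rint (x : G) (g : G -> R) : measurable_fun setT g ->
  \int[mu]_y g (x * y)%g = \int[mu]_y g y.
Proof.
move=> mg; rewrite /Rintegral (haar_integral x (f := fun y => (g y)%:E))//.
exact/measurable_EFinP.
Qed.

Lemma haar_Rintr (x : G) (g : G -> R) : measurable_fun setT g ->
  \int[mu]_y g (y * x)%g = \int[mu]_y g y.
Proof.
move=> mg; rewrite /Rintegral (haar_integralr x (f := fun y => (g y)%:E))//.
exact/measurable_EFinP.
Qed.

Lemma Rint_haar_convolution (m : probability G R) (g : G -> R) B :
  measurable_fun setT g -> (forall x, `|g x| <= B) ->
  \int[mu]_x \int[m]_y g (x * y)%g = \int[mu]_x g x.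
Proof.
move=> mg gB.
have mF : measurable_fun setT (fun p : G * G => g (p.1 * p.2)%g).
  by apply: (measurableT_comp mg); exact: measurable_funMg.
rewrite -(Rint_prod12 (P1 := mu) (P2 := m) (F := fun p : G * G => g (p.1 * p.2)%g)); last 2 first.
- by apply: (L1_bounded (B := B) _ mF) => p; exact: gB.
- move=> x; apply: (L1_bounded (B := B) _ (measurableT_comp mg (measurable_mull x))) => y.
  exact: gB.
rewrite Rint_prod21; last 2 first.
- by apply: (L1_bounded (B := B) _ mF) => p; exact: gB.
- move=> x; apply: (L1_bounded (B := B) _ (measurableT_comp mg (measurable_mulr x))) => y.
  exact: gB.
by under eq_Rintegral do rewrite haar_Rintr//; rewrite Rint_cst.
Qed.

(** The total variation norm of [m - mu] is at most [a], in the dual form that applies directly to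
    bounded functions. *)
Definition mixes (m : probability G R) (a : R) := forall (g : G -> R) B,
  measurable_fun setT g -> (forall x, `|g x| <= B) ->
  `|\int[m]_x g x - \int[mu]_x g x| <= B * a.

Lemma mixes_lower (m : probability G R) (a : R) :
  (forall (g : G -> R) B, measurable_fun setT g -> (forall x, `|g x| <= B) ->
    \int[mu]_x g x - \int[m]_x g x <= B * a) -> mixes m a.
Proof.
move=> H g B mg gB; rewrite distrC ler_norml H// andbT lerNl opprB.
have := H (fun x => - g x) B; rewrite !RintN; try exact: L1_bounded gB.
rewrite opprK addrC; apply; first exact: measurableT_comp.
by move=> x; rewrite normrN.
Qed.

(** Doeblin contraction. [phi] stays within [B * a] of its mean [I], so [psi = phi + (B * a - I)] is
    nonnegative with mean [B * a] under [mu]; the minorization gives it mean at least [e * (B * a)]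
    under the j-th power, which cuts the deviation below [I] by the factor [1 - e]. *)
Lemma mixes_step j k a e : 0 <= e -> mixes (convolution_pow nu k) a ->
  (forall f : G -> \bar R, measurable_fun setT f -> (forall x, 0 <= f x)%E ->
    e%:E * \int[mu]_x f x <= \int[convolution_pow nu j]_x f x)%E ->
  mixes (convolution_pow nu (j + k)) ((1 - e) * a).
Proof.
move=> e0 Hk minj; apply: mixes_lower => g B mg gB.
rewrite (Rint_convolution_powD _ _ _ mg gB).
set I := \int[mu]_x g x.
pose phi x := \int[convolution_pow nu k]_y g (x * y)%g.
have mgx x : measurable_fun setT (fun y => g (x * y)%g).
  exact: measurableT_comp mg (measurable_mull x).
have mphi : measurable_fun setT phi by exact: measurable_mul_Rint.
have phiB x : `|phi x| <= B by apply: Rint_bounded.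
have phiI x : `|phi x - I| <= B * a.
  by rewrite /I -(haar_Rint x mg); apply: Hk.
have lphi (P : probability G R) : L1 P phi by exact: L1_bounded phiB.
pose psi x := phi x + (B * a - I).
have lpsi (P : probability G R) : L1 P psi by apply: L1D => //; exact: L1_cst.
have psi0 x : 0 <= psi x.
  rewrite /psi addrCA -lerBlDl sub0r -opprB lerN2.
  by have := phiI x; rewrite distrC ler_norml => /andP[].
have := minj (EFin \o psi) _ _.
rewrite -(EFin_Rint (lpsi mu)) -(EFin_Rint (lpsi _)) -EFinM lee_fin.
rewrite !RintD//; try exact: L1_cst.
rewrite !Rint_cst (Rint_haar_convolution _ mg gB) -/I.
move=> H; have {}H := H _ _.
have : e * (I + (B * a - I)) <= \int[convolution_pow nu j]_x phi x + (B * a - I).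
  apply: H; first exact/measurable_EFinP/(L1_measurable (lpsi mu)).
  by move=> x; rewrite lee_fin.
rewrite -/phi; set J := \int[_]_x _; set Ba := B * a.
rewrite mulrCA -/Ba; lra.
Qed.

Lemma mixing_rate : adapted nu -> strictly_aperiodic nu -> nonsingular_power mu nu ->
  exists a : nat -> R, [/\ forall k, 0 <= a k,
    forall k, mixes (convolution_pow nu k) (a k) &
    exists S, forall n, \sum_(0 <= k < n) a k <= S].
Proof.
move=> ad sa ns; have [m [e [m0 e0 He]]] := doeblin hmu ad sa ns.
have e1 : e <= 1.
  have := He (cst 1%E) (measurable_cst _) (fun=> lee01).
  by rewrite !integral_probability_cst mule1 lee_fin.
have q0 : 0 <= 1 - e by rewrite subr_ge0.
have q1 : 1 - e <= 1 by rewrite gerBl ltW.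
(* One factor [1 - e] per block of [m] steps, starting from the trivial bound 2; the remainder
   modulo [m] is the initial power of the induction. *)
pose a k := 2 * (1 - e) ^+ (k %/ m).
have a0 k : 0 <= a k by rewrite mulr_ge0// exprn_ge0.
exists a; split => //.
- move=> k; rewrite {1}(divn_eq k m) /a.
  have H0 r : mixes (convolution_pow nu r) 2.
    move=> g B mg gB; rewrite mulr_natr mulr2n (le_trans (ler_normB _ _))// lerD//;
      exact: Rint_bounded.
  elim: (k %/ m)%N => [|n IH]; first by rewrite expr0 mulr1; exact: H0.
  rewrite mulSn -addnA exprS mulrCA; apply: mixes_step => //; exact: ltW.
- exists (e^-1 * (2 * m%:R)) => n.
  rewrite mulrC ler_pdivlMr//.
  (* The self-similarity [s (m + n) = 2 m + (1 - e) s n] and monotonicity of [s] give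
     [e * s n <= 2 m] at once. *)
  pose s n := \sum_(0 <= k < n) a k.
  have s_shift : s (m + n)%N = 2 * m%:R + (1 - e) * s n.
    rewrite /s (@big_cat_nat _ _ _ m)//= ?leq_addr//; congr (_ + _).
      rewrite (eq_big_nat _ _ (F2 := fun=> 2)); last first.
        by move=> i /andP[_ im]; rewrite /a divn_small// expr0 mulr1.
      by rewrite sumr_const_nat subn0 mulr_natr.
    rewrite -{1}[m]add0n big_addn addKn mulr_sumr; apply: eq_bigr => i _.
    by rewrite /a divnDr// divnn m0 addn1 exprS mulrCA.
  have s_le : s n <= s (m + n)%N.
    rewrite /s [leRHS](@big_cat_nat _ _ _ n)//= ?leq_addl// lerDl.
    by apply: sumr_ge0.
  rewrite -/(s n); move: s_le; rewrite s_shift; lra.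
Qed.

End mixing_rate.

(** * Gaussian distribution function and heat kernel *)

Section pointwise_derivatives.
Context (R : realType).
Implicit Types (f g : R -> R) (x a b : R).

Lemma hd_add x f g a b : is_derive x 1 f a -> is_derive x 1 g b ->
  is_derive x 1 (fun y => f y + g y) (a + b).
Proof. by move=> *; exact: is_deriveD. Qed.

Lemma hd_opp x f a : is_derive x 1 f a -> is_derive x 1 (fun y => - f y) (- a).
Proof. by move=> *; exact: is_deriveN. Qed.

Lemma hd_mul x f g a b : is_derive x 1 f a -> is_derive x 1 g b ->
  is_derive x 1 (fun y => f y * g y) (a * g x + f x * b).
Proof.
by move=> df dg; apply: is_derive_eq (is_deriveM df dg) _; rewrite addrC mulrC.
Qed.

Lemma hd_cst x a : is_derive x 1 (fun=> a) 0.
Proof. exact: is_derive_cst. Qed.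

Lemma hd_id x : is_derive x 1 (fun y : R => y) 1.
Proof. exact: is_derive_id. Qed.

Lemma hd_comp x f g a b : is_derive (g x) 1 f a -> is_derive x 1 g b ->
  is_derive x 1 (fun y => f (g y)) (a * b).
Proof. exact: is_derive1_comp. Qed.

Lemma mvt_bound f (df : R -> R) a b B : a <= b ->
  (forall x, a <= x <= b -> is_derive x 1 f (df x)) ->
  (forall x, a <= x <= b -> `|df x| <= B) -> `|f b - f a| <= B * (b - a).
Proof.
move=> ab hd hB.
have [||c cab ->] := @MVT_segment _ f df a b ab.
- by move=> x /[!in_itv]/= /andP[ax xb]; apply: hd; rewrite !ltW.
- apply: derivable_within_continuous => x /[!in_itv]/= axb.
  by have := hd x axb => hdx; exact: (@ex_derive _ _ _ _ _ _ _ hdx).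
rewrite normrM (ger0_norm (x := b - a)) ?subr_ge0//.
by rewrite ler_wpM2r ?subr_ge0//; apply: hB; move: cab; rewrite in_itv.
Qed.

(** Used repeatedly on Taylor remainders: each use integrates once and raises the exponent by one,
    the gain [1 / (n + 1)] being given up. *)
Lemma mvt_pow f (df : R -> R) B n t : 0 <= B -> f 0 = 0 ->
  (forall x, is_derive x 1 f (df x)) -> (forall x, `|df x| <= B * `|x| ^+ n) ->
  `|f t| <= B * `|t| ^+ n.+1.
Proof.
move=> B0 f0 hd hB; have [t0|t0] := leP 0 t.
  have := @mvt_bound f df 0 t (B * t ^+ n) t0 (fun x _ => hd x).
  rewrite f0 !subr0 (ger0_norm t0) exprSr mulrA; apply => x /andP[x0 xt].
  apply: le_trans (hB x) _; rewrite ler_wpM2l// lerXn2r ?nnegrE//.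
  by rewrite ger0_norm.
have := @mvt_bound f df t 0 (B * `|t| ^+ n) (ltW t0) (fun x _ => hd x).
rewrite f0 !sub0r normrN (ltr0_norm t0) exprSr mulrA; apply => x /andP[x0 xt].
apply: le_trans (hB x) _; rewrite ler_wpM2l// lerXn2r ?nnegrE ?oppr_ge0 ?(ltW t0)//.
by rewrite ler0_norm ?lerN2.
Qed.

End pointwise_derivatives.

Section gaussian.
Context (R : realType).
Implicit Types x z t : R.

Definition gd x : R := (Num.sqrt (2 * pi))^-1 * expR (- x ^+ 2 / 2).
Definition gd1 x : R := - x * gd x.
Definition gd2 x : R := (x ^+ 2 - 1) * gd x.

Lemma gd_normal_pdf : gd = normal_pdf 0 1.
Proof.
apply/funext => x; rewrite normal_pdfE ?oner_eq0// /normal_peak /normal_fun /gd.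
by rewrite expr1n mul1r subr0 (_ : pi *+ 2 = 2 * pi) ?mulr_natl.
Qed.

Lemma gd_ge0 x : 0 <= gd x.
Proof. by rewrite mulr_ge0// ?invr_ge0 ?expR_ge0. Qed.

(** The one decay estimate behind all bounds on derivatives of the density: write the exponential as
    the square of [expR (- x ^+ 2 / 4)] and use [1 + y <= expR y]. *)
Lemma gd_poly x : gd x * (1 + x ^+ 2 / 4) ^+ 2 <= 1.
Proof.
have s1 : (Num.sqrt (2 * pi) : R)^-1 <= 1.
  rewrite invf_le1; last by rewrite sqrtr_gt0 mulr_gt0// pi_gt0.
  rewrite -[leLHS]sqrtr1 ler_wsqrtr// (le_trans _ (_ : 2 * 1 <= _))//; first lra.
  by rewrite ler_pM2l//; have := @pi_ge2 R; lra.
have -> : gd x = (Num.sqrt (2 * pi))^-1 * (expR (- (x ^+ 2 / 4))) ^+ 2.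
  rewrite /gd -expRM_natl; congr (_ * expR _); lra.
rewrite -mulrA -exprMn mulr_ile1//.
- by rewrite exprn_ge0// mulr_ge0 ?expR_ge0// addr_ge0// divr_ge0// sqr_ge0.
- rewrite exprn_ile1//.
    by rewrite mulr_ge0 ?expR_ge0// addr_ge0// divr_ge0// sqr_ge0.
  by rewrite expRN mulrC ler_pdivrMr ?expR_gt0// mul1r expR_ge1Dx.
Qed.

Lemma gd_bound x y : `|y| <= (1 + x ^+ 2 / 4) ^+ 2 -> `|y * gd x| <= 1.
Proof.
move=> hy; rewrite normrM (ger0_norm (gd_ge0 x)) mulrC.
by apply: le_trans (gd_poly x); rewrite ler_wpM2l// gd_ge0.
Qed.

Lemma le_gd1 x : `|gd1 x| <= 1.
Proof.
apply: gd_bound; rewrite normrN; have := sqr_ge0 (`|x| - 2).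
have := normr_ge0 x; rewrite -[x ^+ 2]real_normK ?num_real//; nra.
Qed.

Lemma le_gd x : gd x <= 1.
Proof.
rewrite -(ger0_norm (gd_ge0 x)) -[gd x]mul1r; apply: gd_bound; rewrite normr1.
have := sqr_ge0 x; nra.
Qed.

Lemma le_gd2 x : `|gd2 x| <= 5.
Proof.
rewrite /gd2 (_ : _ * _ = 5 * ((x ^+ 2 - 1) / 5 * gd x)); last by lra.
rewrite normrM ger0_norm// ler_piMr//; apply: gd_bound.
rewrite ler_norml; have := sqr_ge0 x; nra.
Qed.

Lemma le_xgd2 x : `|x * gd2 x| <= 5.
Proof.
rewrite /gd2 (_ : _ * _ = 5 * (x * (x ^+ 2 - 1) / 5 * gd x)); last by lra.
rewrite normrM ger0_norm// ler_piMr//; apply: gd_bound.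
rewrite ler_norml; have := sqr_ge0 x; have := sqr_ge0 (x - 2); have := sqr_ge0 (x + 2); nra.
Qed.

Lemma derive_gd x : is_derive x 1 gd (gd1 x).
Proof.
have h : is_derive x 1 (fun y : R => - y ^+ 2 / 2) (- x).
  apply: is_derive_eq (hd_mul (hd_opp (hd_mul (hd_id x) (hd_id x))) (hd_cst x 2^-1)) _.
  by rewrite /=; lra.
apply: is_derive_eq (hd_mul (hd_cst x _) (hd_comp (is_derive_expR _) h)) _.
by rewrite /gd1 /gd; lra.
Qed.

Lemma derive_gd1 x : is_derive x 1 gd1 (gd2 x).
Proof.
apply: is_derive_eq (hd_mul (hd_opp (hd_id x)) (derive_gd x)) _.
by rewrite /gd1 /gd2; lra.
Qed.

Lemma integrable_gd : lebesgue_measure.-integrable [set: R] (EFin \o gd).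
Proof. by rewrite gd_normal_pdf; exact: integrable_normal_pdf. Qed.

Lemma measurable_gd : measurable_fun [set: R] gd.
Proof. by move/measurable_int/measurable_EFinP: integrable_gd. Qed.

Lemma derive_ncdf x : is_derive x 1 (@std_normal_cdf R) (gd x).
Proof.
have ig : lebesgue_measure.-integrable `]-oo, (x + 1)] (EFin \o gd).
  by apply: integrableS integrable_gd.
have cg : {for x, continuous gd}.
  by rewrite gd_normal_pdf; apply: continuous_normal_pdf; exact: oner_neq0.
have xx1 : x < x + 1 by rewrite ltrDl.
have -> : @std_normal_cdf R =
  fun y => \int[lebesgue_measure]_(t in `]-oo, y]) gd t by [].
have [h1 h2] := continuous_FTC1 xx1 ig (ltNyr x) cg.
by rewrite derive1E in h2; rewrite -h2; exact: derivableP.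
Qed.

Local Notation Phi := (@std_normal_cdf R).

Lemma ncdf_ge0 x : 0 <= Phi x.
Proof. by apply: Rintegral_ge0 => y _; exact: gd_ge0. Qed.

Lemma ncdf_le1 x : Phi x <= 1.
Proof.
rewrite -lee_fin fineK; last first.
  by apply: integrable_fin_num => //; apply: integrableS integrable_gd.
rewrite -(integral_normal_pdf (0 : R) 1) -gd_normal_pdf.
apply: ge0_subset_integral => //; last by apply/measurable_EFinP; exact: measurable_gd.
Qed.

Lemma ncdf_lip x y : `|Phi x - Phi y| <= `|x - y|.
Proof.
wlog xy : x y / y <= x.
  move=> H; have [yx|/ltW xy] := leP y x; first exact: H.
  by rewrite distrC [leRHS]distrC; exact: H.
rewrite (ger0_norm (x := x - y)) ?subr_ge0// -[leRHS]mul1r.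
apply: (@mvt_bound _ _ gd) => // [z _|z _]; first exact: derive_ncdf.
by rewrite ger0_norm ?gd_ge0// le_gd.
Qed.

Definition ncdf_taylor z t := Phi (z + t) - Phi z - gd z * t - gd1 z * t ^+ 2 / 2.

(** The second derivative of the remainder is a difference of two values of [gd1], at most 2; the
    third is a value of [gd2], at most 5. Both orders are kept because a moment between 2 and 3
    requires their minimum. *)
Lemma ncdf_taylor_bound z t :
  `|ncdf_taylor z t| <= 2 * t ^+ 2 /\ `|ncdf_taylor z t| <= 5 * `|t| ^+ 3.
Proof.
have dz (f : R -> R) (df : R -> R) : (forall x, is_derive x 1 f (df x)) ->
    forall s : R, is_derive s 1 (fun s => f (z + s)) (df (z + s)).
  move=> hf s; apply: is_derive_eq (hd_comp (hf _) (hd_add (hd_cst s z) (hd_id s))) _.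
  by rewrite add0r mulr1.
pose e1 (s : R) := gd (z + s) - gd z - gd1 z * s.
pose e2 (s : R) := gd1 (z + s) - gd1 z.
have de (s : R) : is_derive s 1 (ncdf_taylor z) (e1 s).
  apply: is_derive_eq (hd_add (hd_add (hd_add (dz _ _ derive_ncdf s) (hd_cst s _))
    (hd_opp (hd_mul (hd_cst s _) (hd_id s))))
    (hd_opp (hd_mul (hd_mul (hd_cst s _) (hd_mul (hd_id s) (hd_id s))) (hd_cst s _)))) _.
  by rewrite /e1 /=; lra.
have de1 (s : R) : is_derive s 1 e1 (e2 s).
  apply: is_derive_eq (hd_add (hd_add (dz _ _ derive_gd s) (hd_cst s _))
    (hd_opp (hd_mul (hd_cst s _) (hd_id s)))) _.
  by rewrite /e2 /=; lra.
have de2 (s : R) : is_derive s 1 e2 (gd2 (z + s)).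
  apply: is_derive_eq (hd_add (dz _ _ derive_gd1 s) (hd_cst s _)) _.
  by rewrite addr0.
have e0 : ncdf_taylor z 0 = 0 by rewrite /ncdf_taylor addr0; lra.
have e10 : e1 0 = 0 by rewrite /e1 addr0; lra.
have e20 : e2 0 = 0 by rewrite /e2 addr0; lra.
split.
  rewrite -[t ^+ 2]real_normK ?num_real//.
  apply: (mvt_pow (df := e1)) => // s.
  apply: (mvt_pow (df := e2)) => // r.
  rewrite expr0 mulr1 (le_trans (ler_normB _ _))//.
  by have := le_gd1 (z + r); have := le_gd1 z; lra.
apply: (mvt_pow (df := e1)) => // s.
apply: (mvt_pow (df := e2)) => // r.
apply: (mvt_pow (df := fun s => gd2 (z + s))) => // v.
by rewrite expr0 mulr1 le_gd2.
Qed.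

End gaussian.

Section heat_kernel.
Context (R : realType).
Implicit Types x m t s : R.
Local Notation Phi := (@std_normal_cdf R).

Definition iq s : R := (Num.sqrt s)^-1.

Lemma iq_ge0 s : 0 <= iq s. Proof. by rewrite invr_ge0 sqrtr_ge0. Qed.

Lemma iq_sqr s : 0 <= s -> iq s ^+ 2 = s^-1.
Proof. by move=> s0; rewrite exprVn sqr_sqrtr. Qed.

Lemma iq_le s t : 0 < s -> s <= t -> iq t <= iq s.
Proof.
move=> s0 st; rewrite lef_pV2 ?posrE ?sqrtr_gt0//; first exact: ler_wsqrtr.
exact: lt_le_trans st.
Qed.

Lemma derive_iq s : 0 < s -> is_derive s 1 iq (- (iq s ^+ 3) / 2).
Proof.
move=> s0.
have h : Num.sqrt s != 0 by rewrite gt_eqF// sqrtr_gt0.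
apply: is_derive_eq (is_deriveV h (is_derive1_sqrt s0)) _.
rewrite /iq -[_ *: _]/(_ * _); field.
by rewrite h.
Qed.

Definition heat x m t := Phi ((x - m) * iq t).
(** The second derivative of [heat] in [m]. That it is also twice the derivative in [t], as
    [derive_heat_time] shows, is the heat equation. *)
Definition heat2 x m t := gd1 ((x - m) * iq t) * iq t ^+ 2.

Lemma heat_bounded x m t : `|heat x m t| <= 1.
Proof. by rewrite ger0_norm ?ncdf_ge0// ncdf_le1. Qed.

Lemma heat2_bounded x m t : `|heat2 x m t| <= iq t ^+ 2.
Proof.
by rewrite normrM (ger0_norm (exprn_ge0 _ (iq_ge0 t))) ler_piMl ?le_gd1 ?exprn_ge0 ?iq_ge0.
Qed.

Lemma heat_taylor x m t y :
  heat x (m + y) t = heat x m t - gd ((x - m) * iq t) * iq t * y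
    + heat2 x m t * y ^+ 2 / 2 + ncdf_taylor ((x - m) * iq t) (- y * iq t).
Proof.
rewrite /ncdf_taylor /heat /heat2.
rewrite (_ : (x - (m + y)) * iq t = (x - m) * iq t + - y * iq t); first lra.
by lra.
Qed.

Lemma heat2_space x m t y :
  `|heat2 x (m + y) t - heat2 x m t| <= 5 * (`|y| * iq t ^+ 3).
Proof.
rewrite /heat2 -mulrBl normrM (ger0_norm (exprn_ge0 _ (iq_ge0 t))).
rewrite (_ : (x - (m + y)) * iq t = (x - m) * iq t + - y * iq t); last by lra.
set z := (x - m) * iq t.
have hd (v : R) : is_derive v 1 (fun v => gd1 (z + v) - gd1 z) (gd2 (z + v)).
  apply: is_derive_eq (hd_add (hd_comp (derive_gd1 _) (hd_add (hd_cst v z) (hd_id v))) (hd_cst v _)) _.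
  by rewrite add0r mulr1 addr0.
have h : `|gd1 (z + - y * iq t) - gd1 z| <= 5 * `|- y * iq t| ^+ 1.
  apply: (mvt_pow (f := fun v => gd1 (z + v) - gd1 z) (df := fun v => gd2 (z + v))) => //.
    by rewrite addr0 subrr.
  by move=> v; rewrite expr0 mulr1 le_gd2.
rewrite expr1 normrM normrN (ger0_norm (iq_ge0 t)) in h.
rewrite (_ : 5 * (`|y| * iq t ^+ 3) = 5 * (`|y| * iq t) * iq t ^+ 2); last by lra.
exact: ler_wpM2r (exprn_ge0 2 (iq_ge0 t)) _ _ h.
Qed.

Lemma derive_heat_time x m t s : 0 < t -> 0 <= s ->
  is_derive s 1 (fun s => heat x m (t + s)) (heat2 x m (t + s) / 2).
Proof.
move=> t0 s0; have ts0 : 0 < t + s by rewrite ltr_pwDl.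
apply: is_derive_eq (hd_comp (derive_ncdf _) (hd_mul (hd_cst s _)
  (hd_comp (derive_iq ts0) (hd_add (hd_cst s t) (hd_id s))))) _.
rewrite /heat2 /gd1; lra.
Qed.

Lemma derive_heat2_time x m t s : 0 < t -> 0 <= s ->
  is_derive s 1 (fun s => heat2 x m (t + s))
    (- (((x - m) * iq (t + s)) * gd2 ((x - m) * iq (t + s)) / 2
        + gd1 ((x - m) * iq (t + s))) * iq (t + s) ^+ 4).
Proof.
move=> t0 s0; have ts0 : 0 < t + s by rewrite ltr_pwDl.
have di : is_derive s 1 (fun s => iq (t + s)) (- (iq (t + s) ^+ 3) / 2).
  apply: is_derive_eq (hd_comp (derive_iq ts0) (hd_add (hd_cst s t) (hd_id s))) _.
  by rewrite add0r mulr1.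
apply: is_derive_eq (hd_mul (hd_comp (derive_gd1 _) (hd_mul (hd_cst s _) di))
  (hd_mul di di)) _.
by rewrite /=; lra.
Qed.

Lemma heat2_time x m t s : 0 < t -> 0 <= s ->
  `|heat2 x m (t + s) - heat2 x m t| <= 4 * iq t ^+ 4 * s.
Proof.
move=> t0 s0.
have := mvt_bound (f := fun s => heat2 x m (t + s)) (B := 4 * iq t ^+ 4) s0
  (fun r h => derive_heat2_time x m t0 (proj1 (andP h))).
rewrite addr0 subr0; apply => r /andP[r0 _].
rewrite normrM (ger0_norm (exprn_ge0 _ (iq_ge0 _))) ler_pM ?exprn_ge0 ?iq_ge0//.
  rewrite normrN (le_trans (ler_normD _ _))// normrM.
  have := le_xgd2 ((x - m) * iq (t + r)); have := le_gd1 ((x - m) * iq (t + r)).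
  by rewrite (ger0_norm (x := 2^-1))//; lra.
by rewrite lerXn2r ?nnegrE ?iq_ge0// iq_le// lerDl.
Qed.

Lemma heat_time x m t s : 0 < t -> 0 <= s ->
  `|heat x m (t + s) - heat x m t - heat2 x m t * s / 2| <= 2 * iq t ^+ 4 * s ^+ 2.
Proof.
move=> t0 s0.
pose g r := heat x m (t + r) - heat x m t - heat2 x m t * r / 2.
have hd (r : R) : 0 <= r <= s -> is_derive r 1 g ((heat2 x m (t + r) - heat2 x m t) / 2).
  move=> /andP[r0 _].
  apply: is_derive_eq (hd_add (hd_add (derive_heat_time x m t0 r0) (hd_cst r _))
    (hd_opp (hd_mul (hd_mul (hd_cst r _) (hd_id r)) (hd_cst r _)))) _.
  by rewrite /=; lra.
have := mvt_bound (B := 2 * iq t ^+ 4 * s) s0 hd.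
rewrite {2}/g addr0 !(subrr, mulr0, mul0r) !subr0 expr2 mulrA; apply => r /andP[r0 rs].
rewrite normrM (ger0_norm (x := 2^-1))//.
have := heat2_time x m t0 r0.
have : 4 * iq t ^+ 4 * r <= 4 * iq t ^+ 4 * s.
  by rewrite ler_wpM2l// mulr_ge0// exprn_ge0// iq_ge0.
lra.
Qed.

Lemma measurable_ncdf : measurable_fun [set: R] Phi.
Proof.
apply: continuous_measurable_fun => x; apply: differentiable_continuous.
by apply/derivable1_diffP; have := derive_ncdf x => -[].
Qed.

End heat_kernel.

(** * Integrals against the standard normal law *)

Section normal_integral.
Context (R : realType).
Local Notation gamma := (normal_prob (0 : R) 1).
Local Notation lam := (@lebesgue_measure R).

Lemma integral_gamma (f : R -> R) : L1 gamma f ->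
  (\int[gamma]_x (f x)%:E = \int[lam]_x ((f x)%:E * (gd x)%:E))%E.
Proof.
move=> lf; have mf := measurable_int _ lf.
have dom := @normal_prob_dominates R 0 1.
have mgd : measurable_fun setT (EFin \o @gd R).
  by apply/measurable_EFinP; exact: measurable_gd.
rewrite -(Radon_Nikodym_change_of_variables dom measurableT lf)//=.
apply: ae_eq_integral => //.
- by apply: emeasurable_funM.
- by apply: emeasurable_funM.
- apply: ae_eqe_mul2l => /=.
  rewrite Radon_NikodymE//=.
  case: cid => /= h [h1 h2 h3].
  apply: integral_ae_eq => //=.
  by move=> E E01 mE; rewrite -h3//= gd_normal_pdf.
Qed.

Lemma integrable_abs_gd : lam.-integrable [set: R] (EFin \o (fun x => `|x| * gd x)).
Proof.
(* The dominating function is 8 times the normal density of standard deviation 2; the comparison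
   reduces to [|x| <= 4 * expR (3 / 8 * x ^+ 2)]. *)
have i2 : lam.-integrable [set: R] (fun x => (8 * normal_pdf 0 2 x)%:E).
  under eq_fun do rewrite EFinM.
  by apply: integrableZl => //; exact: integrable_normal_pdf.
apply: le_integrable i2 => //.
  apply/measurable_EFinP/measurable_funM; last exact: measurable_gd.
  exact: normr_measurable.
move=> x _; rewrite lee_fin (ger0_norm (x := `|x| * _)) ?mulr_ge0 ?gd_ge0//.
apply: le_trans (ler_norm _).
rewrite normal_pdfE ?pnatr_eq0// /normal_fun subr0 /normal_peak.
rewrite (_ : 2 ^+ 2 * pi *+ 2 = 2 ^+ 2 * (2 * pi) :> R); last by rewrite -mulr_natr; lra.
rewrite sqrtrM ?sqr_ge0// sqrtr_sqr normr_nat invfM.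
set c := (Num.sqrt _)^-1; have c0 : 0 <= c by rewrite invr_ge0.
rewrite (_ : 8 * _ = c * (4 * expR (- x ^+ 2 / (2 ^+ 2 *+ 2)))); last by lra.
rewrite /gd -/c mulrCA ler_wpM2l//.
rewrite (_ : - x ^+ 2 / 2 = - x ^+ 2 / (2 ^+ 2 *+ 2) + - (3 / 8 * x ^+ 2)); last first.
  by rewrite -(mulr_natr (2 ^+ 2)); field.
rewrite expRD mulrCA [leRHS]mulrC ler_wpM2l ?expR_ge0//.
rewrite expRN ler_pdivrMr ?expR_gt0//.
have := expR_ge1Dx (3 / 8 * x ^+ 2); rewrite -[x ^+ 2]real_normK ?num_real//.
by have := sqr_ge0 (`|x| - 1); nra.
Qed.

Definition abs_gaussian : R := \int[lam]_x (`|x| * gd x).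

Lemma abs_gaussian_ge0 : 0 <= abs_gaussian.
Proof. by apply: Rintegral_ge0 => x _; rewrite mulr_ge0// gd_ge0. Qed.

Lemma gamma_min_abs b : 0 <= b -> \int[gamma]_x Num.min `|x| b <= abs_gaussian.
Proof.
move=> b0; have mn : measurable_fun setT (fun x : R => Num.min `|x| b).
  by apply: measurable_minr => //; exact: normr_measurable.
have n0 (x : R) : 0 <= Num.min `|x| b by rewrite le_min normr_ge0.
have lg : L1 gamma (fun x => Num.min `|x| b).
  apply: (L1_bounded (B := b) gamma); first exact: mn.
  by move=> x; rewrite ger0_norm// ge_min lexx orbT.
rewrite /Rintegral fine_le//.
- by rewrite integrable_fin_num.
- by apply: integrable_fin_num => //; exact: integrable_abs_gd.
rewrite integral_gamma//; apply: ge0_le_integral => //.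
- by move=> x _; rewrite -EFinM lee_fin mulr_ge0// gd_ge0.
- by apply: emeasurable_funM; apply/measurable_EFinP => //; exact: measurable_gd.
- by move/measurable_int: integrable_abs_gd.
- by move=> x _; rewrite -EFinM lee_fin ler_wpM2r ?gd_ge0// ge_min lexx.
Qed.

Lemma ncdf_gamma (y : R) : std_normal_cdf y = \int[gamma]_z \1_`]-oo, y[ z.
Proof.
have my : measurable `]-oo, y[ by [].
rewrite /Rintegral integral_indic// setIT.
transitivity (fine (\int[lam]_(x in `]-oo, y[) (gd x)%:E)%E); last first.
  by rewrite gd_normal_pdf.
congr fine; rewrite integral_itv_bndo_bndc//.
by apply/measurable_EFinP; apply: measurable_funTS; exact: measurable_gd.
Qed.

(* The library puts [normal_prob] on [measurableTypeR R]; [gauss] is the same law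
   on the canonical Borel structure of [R]. *)
Definition toR (x : measurableTypeR R) : R := x.

Lemma measurable_toR : measurable_fun [set: measurableTypeR R] toR.
Proof. exact: (@measurable_id _ (measurableTypeR R)). Qed.

HB.instance Definition _ := isMeasurableFun.Build _ _ _ _ toR measurable_toR.

Definition gauss : probability R R := distribution (normal_prob (0 : R) 1) toR.

Lemma gauss_min_abs b : 0 <= b -> \int[gauss]_x Num.min `|x| b <= abs_gaussian.
Proof.
move=> b0; have mn : measurable_fun setT (fun x : R => Num.min `|x| b).
  by apply: measurable_minr => //; exact: normr_measurable.
rewrite Rint_distribution//; first exact: gamma_min_abs.
apply: (L1_bounded (B := b) gamma); first exact: mn.
by move=> x; rewrite ger0_norm ?ge_min ?lexx ?orbT// le_min normr_ge0.
Qed.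

Lemma ncdf_gauss (y : R) : std_normal_cdf y = \int[gauss]_z \1_`]-oo, y[ z.
Proof.
have mi : measurable_fun setT (\1_`]-oo, y[ : R -> R) by exact: measurable_indic.
rewrite ncdf_gamma Rint_distribution//.
apply: (L1_bounded (B := 1) gamma); first exact: mi.
by move=> x; rewrite indicE; case: (_ \in _); rewrite ?normr1 ?normr0.
Qed.

End normal_integral.

Lemma indic_iff (T T' : Type) (R : pzRingType) (A : set T) (B : set T') x y :
  (A x <-> B y) -> \1_A x = \1_B y :> R.
Proof.
by move=> AB; rewrite !indicE (_ : (x \in A) = (y \in B))//; apply/idP/idP => /set_mem/AB/mem_set.
Qed.

(** * Smoothing inequality *)

Section smoothing.
Context d (T : measurableType d) (R : realType) (P : probability T R).
Variables (W : T -> R) (mW : measurable_fun setT W).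
Local Notation Phi := (@std_normal_cdf R).
Local Notation gamma := (gauss R).

Definition below (x : R) : R := fine (P [set w | W w < x]).

Let measurable_below x : measurable [set w | W w < x].
Proof.
rewrite -[X in measurable X]setTI; rewrite (_ : [set w | W w < x] = W @^-1` `]-oo, x[).
  by apply: mW.
by apply/seteqP; split => w; rewrite /= in_itv.
Qed.

Lemma below_ge0 x : 0 <= below x.
Proof. by rewrite fine_ge0. Qed.

Lemma below_le1 x : below x <= 1.
Proof.
by rewrite -lee_fin fineK ?fin_num_measure// probability_le1.
Qed.

Lemma below_le x y : x <= y -> below x <= below y.
Proof.
move=> xy; rewrite fine_le ?fin_num_measure//.
by rewrite le_measure ?inE// => w /= /lt_le_trans; exact.
Qed.

Lemma below_Rint x : below x = \int[P]_w \1_`]-oo, x[ (W w).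
Proof.
rewrite /below /Rintegral; congr fine.
by rewrite -[X in P X]setIT -integral_indic//; apply: eq_integral => w _.
Qed.

(** Both sides are the distribution function at [t] of [W + eta Z], with [Z] standard normal and
    independent of [W]: conditioning is on [W] on the left and on [Z] on the right. *)
Lemma Rint_ncdf (t eta : R) : 0 < eta ->
  \int[P]_w Phi ((t - W w) / eta) = \int[gamma]_z below (t - eta * z).
Proof.
move=> eta0.
pose F (p : T * R) : R := \1_`]-oo, t[ (W p.1 + eta * p.2).
have mF : measurable_fun setT F.
  apply: (measurableT_comp (measurable_indic _)) => //.
  apply: measurable_funD; first exact: measurableT_comp.
  exact: measurable_funM.
have F1 p : `|F p| <= 1 by rewrite ger0_norm /F indicE//; case: (_ \in _).
transitivity (\int[P]_w \int[gamma]_z F (w, z)).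
  apply: eq_Rintegral => w _; rewrite ncdf_gauss; apply: eq_Rintegral => z _.
  by apply: indic_iff; rewrite /= !in_itv /= ltr_pdivlMr//; split => ?; lra.
transitivity (\int[gamma]_z \int[P]_w F (w, z)).
  have lF : L1 (P \x gamma)%E F by exact: L1_bounded mF F1.
  rewrite -(Rint_prod12 lF) ?(Rint_prod21 lF)//.
    move=> z; apply: (L1_bounded (B := 1) P) => [|w]; last exact: F1.
    exact: (measurable_fun_pair1 z mF).
  move=> w; apply: (L1_bounded (B := 1) gamma) => [|z]; last exact: F1.
  exact: (measurable_fun_pair2 w mF).
apply: eq_Rintegral => z _; rewrite below_Rint; apply: eq_Rintegral => w _.
by apply: indic_iff; rewrite /= !in_itv /=; split => ?; lra.
Qed.

Let measurable_belowf t eta : measurable_fun setT (fun z : R => below (t - eta * z)).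
Proof.
apply: (measurableT_comp (f := below)).
  apply: nondecreasing_measurable => //= x y xy; exact: below_le.
by apply: measurable_funB => //; exact: measurable_funM.
Qed.

(* Convolving with a Gaussian of width [eta] moves a distribution function by at
   most [D / 2] plus the shift [a eta], where [D] is the supremum of the distance;
   the resulting inequality [D <= D / 2 + ...] is solved for [D]. *)
Lemma smoothing (eta E : R) : 0 < eta ->
  (forall x, `|\int[P]_w Phi ((x - W w) / eta) - Phi x| <= E) ->
  forall x, `|below x - Phi x| <= 2 * E + (10 + 10 * abs_gaussian R) * eta.
Proof.
move=> eta0 hE.
(* By Markov's inequality [|z| > a] has mass at most [e1 / a], so an error [2 * D] there costs at
   most [D / 2]; the [+ 1] keeps [a] positive. *)
pose e1 := abs_gaussian R; pose a := 4 * (e1 + 1).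
have e10 : 0 <= e1 by exact: abs_gaussian_ge0.
have a0 : 0 < a by rewrite mulr_gt0// ltr_wpDl.
pose dist (x : R) : R := `|below x - Phi x|.
have dist1 x : dist x <= 1.
  rewrite /dist ler_norml; have := below_ge0 x; have := below_le1 x.
  by have := ncdf_ge0 x; have := ncdf_le1 x; lra.
pose D := sup (range dist).
have supD : has_sup (range dist).
  by split; [exists (dist 0), 0|exists 1 => _ [x _ <-]].
have distD x : dist x <= D by apply: ub_le_sup; [case: supD|exists x].
have D0 : 0 <= D by apply: le_trans (distD 0); exact: normr_ge0.
(* [b] truncates [`|z|], which keeps all the integrands bounded *)
pose b := Num.max a eta^-1.
have ab : a <= b by rewrite le_max lexx.
have eb : 1 <= eta * b.
  by rewrite -ler_pdivrMl// mulr1 le_max lexx orbT.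
have b0 : 0 <= b by rewrite (le_trans _ ab)// ltW.
pose n (z : R) : R := Num.min `|z| b.
have mn : measurable_fun setT n.
  by apply: measurable_minr => //; exact: normr_measurable.
have n0 z : 0 <= n z by rewrite le_min normr_ge0.
have nb z : `|n z| <= b by rewrite ger0_norm// ge_min lexx orbT.
have ln : L1 gamma n by exact: (L1_bounded (B := b) gamma mn nb).
have In : \int[gamma]_z n z <= e1 by exact: gauss_min_abs.
have lbelow t : L1 gamma (fun z : R => below (t - eta * z)).
  apply: (L1_bounded (B := 1) gamma (measurable_belowf t eta)) => z.
  by rewrite ger0_norm ?below_ge0// below_le1.
have Phin t z : `|Phi (t - eta * z) - Phi t| <= eta * n z.
  rewrite /n; case: (leP `|z| b) => zb.
    rewrite (le_trans (ncdf_lip _ _))// (_ : t - _ - t = - (eta * z)); last by lra.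
    by rewrite normrN normrM gtr0_norm.
  apply: le_trans eb; rewrite ler_norml.
  have := ncdf_ge0 (t - eta * z); have := ncdf_le1 (t - eta * z).
  by have := ncdf_ge0 t; have := ncdf_le1 t; lra.
(* For [|z| > a], [below] is compared with [Phi] at both ends, at the price [2 * D + eta * n z]. The
   slope [c] is chosen so that [c * n z] covers this price. *)
pose c := 2 * D / a + eta.
have c0 : 0 <= c.
  by apply: addr_ge0; [apply: divr_ge0; [exact: mulr_ge0|exact: ltW]|exact: ltW].
have cI : c * \int[gamma]_z n z <= D / 2 + eta * e1.
  apply: (@le_trans _ _ (c * e1)); first by rewrite ler_wpM2l.
  rewrite /c [leLHS]mulrDl lerD2r mulrAC ler_pdivrMr// /a.
  have : 0 <= D * e1 by rewrite mulr_ge0.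
  nra.
have bad z : a < `|z| -> 2 * D + eta * n z <= c * n z.
  move=> az; rewrite /c [leRHS]mulrDl lerD2r mulrAC ler_pdivlMr// ler_wpM2l ?mulr_ge0//.
  by rewrite le_min ab ltW.
have Phi_le y z : y <= z -> Phi z <= Phi y + (z - y).
  by move=> yz; have := ncdf_lip z y; rewrite (ger0_norm (x := z - y)) ?subr_ge0// ler_norml; lra.
have Phi_mono y z : y <= z -> Phi y <= Phi z.
  move=> yz; rewrite -subr_ge0.
  have := @Rint_le _ _ _ gamma (\1_`]-oo, y[) (\1_`]-oo, z[).
  rewrite -!ncdf_gauss subr_ge0; apply.
  - by apply: (L1_bounded (B := 1) gamma) => // v; rewrite indicE; case: (_ \in _); rewrite ?normr1 ?normr0.
  - by apply: (L1_bounded (B := 1) gamma) => // v; rewrite indicE; case: (_ \in _); rewrite ?normr1 ?normr0.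
  - move=> v; rewrite !indicE; case: (boolP (v \in _)) => // /set_mem /=.
    rewrite in_itv /= => vy; rewrite mem_set//= in_itv /=; exact: lt_le_trans yz.
have aeta : 0 <= a * eta by rewrite ltW// mulr_gt0.
have lcn u : L1 gamma (fun z => below u + c * n z) by apply: L1D; [exact: L1_cst|exact: L1Z].
have lcn' u : L1 gamma (fun z => below u - c * n z) by apply: L1B; [exact: L1_cst|exact: L1Z].
have key x : dist x <= D / 2 + E + (a + e1) * eta.
  have distx := distD x; rewrite /dist ler_norml in distx.
  rewrite /dist ler_norml; apply/andP; split.
  (* The shift ensures [t - eta * z <= x] for every [z >= - a], where monotonicity of [below]
     settles the comparison. The other direction shifts to the right. *)
  - set t := x - a * eta.
    have tx : t <= x by rewrite /t; lra.
    have := hE t; rewrite Rint_ncdf// ler_norml => /andP[h1 _].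
    have h2 : \int[gamma]_z below (t - eta * z) <= below x + c * \int[gamma]_z n z.
      rewrite -RintZ// -[X in X + _](Rint_cst gamma) -RintD//; [|exact: L1_cst|exact: L1Z].
      apply: Rint_le => // z; have cn : 0 <= c * n z by rewrite mulr_ge0.
      have [za|za] := leP (- a) z.
        rewrite (le_trans (_ : _ <= below x)) ?lerDl//; apply: below_le.
        have := ler_wpM2l (ltW eta0) za; rewrite /t; lra.
      have az : a < `|z| by rewrite ltr0_norm; lra.
      have := bad z az; have := Phin t z; have := distD (t - eta * z).
      rewrite /dist !ler_norml; have := Phi_mono _ _ tx.
      by move: distx; lra.
    have := Phi_le _ _ tx; rewrite {2}/t; lra.
  - set t := x + a * eta.
    have tx : x <= t by rewrite /t; lra.
    have := hE t; rewrite Rint_ncdf// ler_norml => /andP[_ h1].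
    have h2 : below x - c * \int[gamma]_z n z <= \int[gamma]_z below (t - eta * z).
      rewrite -RintZ// -[X in X - _](Rint_cst gamma) -RintB//; [|exact: L1_cst|exact: L1Z].
      apply: Rint_le => // z; have cn : 0 <= c * n z by rewrite mulr_ge0.
      have [za|za] := leP z a.
        rewrite (le_trans (_ : _ <= below x)) ?gerBl//; apply: below_le.
        have := ler_wpM2l (ltW eta0) za; rewrite /t; lra.
      have az : a < `|z| by rewrite gtr0_norm; lra.
      have := bad z az; have := Phin t z; have := distD (t - eta * z).
      rewrite /dist !ler_norml; have := Phi_mono _ _ tx.
      by move: distx; lra.
    have := Phi_le _ _ tx; rewrite {2}/t; lra.
have DD : D <= D / 2 + E + (a + e1) * eta.
  apply: ge_sup; first by exists (dist 0), 0.
  by move=> _ [x _ <-]; exact: key.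
move=> x; apply: le_trans (distD x) _; rewrite -/e1.
have : 0 <= e1 * eta by rewrite mulr_ge0// ltW.
by move: DD; rewrite /a; nra.
Qed.

End smoothing.

(** * Poisson equation and martingale approximation *)

Section dominated_series.
Context (R : realType) (a : nat -> R).
Hypothesis a0 : forall k, 0 <= a k.
Hypothesis aS : exists S, forall n, \sum_(0 <= k < n) a k <= S.

Definition stail n := limn (series a) - series a n.

Lemma series_nd : {homo series a : n m / (n <= m)%N >-> n <= m}.
Proof. by apply/nondecreasing_seqP => n; rewrite -subr_ge0 seriesSB. Qed.

Lemma cvg_series_a : cvgn (series a).
Proof.
have [S HS] := aS; apply: nondecreasing_is_cvgn; first exact: series_nd.
by exists S => _ [n _ <-]; rewrite seriesEnat /=; exact: HS.
Qed.

Lemma stail_ge0 n : 0 <= stail n.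
Proof. by rewrite subr_ge0; apply: nondecreasing_cvgn_le; [exact: series_nd|exact: cvg_series_a]. Qed.

Lemma stail_cvg0 : stail n @[n --> \oo] --> 0.
Proof.
rewrite -(subrr (limn (series a))); apply: cvgB; first exact: cvg_cst.
exact: cvg_series_a.
Qed.

Lemma dominated_series (u : nat -> R) B : 0 <= B -> (forall k, `|u k| <= B * a k) ->
  cvgn (series u) /\ forall n, `|limn (series u) - series u n| <= B * stail n.
Proof.
move=> B0 uB.
have cu : cvgn (series u).
  apply: normed_cvg; apply: (@series_le_cvg _ _ (fun k => B * a k)) => //.
  - by move=> k /=.
  - by move=> k; rewrite mulr_ge0.
  - rewrite (_ : series _ = fun n => B * series a n); last first.
      by apply/funext => n; rewrite !seriesEnat /= mulr_sumr.
    by apply: is_cvgM; [exact: is_cvg_cst|exact: cvg_series_a].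
split => // n.
have h m : (n <= m)%N -> `|series u m - series u n| <= B * stail n.
  move=> nm; apply: (@le_trans _ _ (B * (series a m - series a n))).
    rewrite !sub_series_geq// mulr_sumr (le_trans (ler_norm_sum _ _ _))//.
    by apply: ler_sum => k _; exact: uB.
  rewrite ler_wpM2l// lerD2r; apply: nondecreasing_cvgn_le; [exact: series_nd|exact: cvg_series_a].
rewrite ler_norml; apply/andP; split.
- rewrite lerBrDr; apply: limr_ge => //; exists n => // m /= nm.
  by have := h m nm; rewrite ler_norml; lra.
- rewrite lerBlDr; apply: limr_le => //; exists n => // m /= nm.
  by have := h m nm; rewrite ler_norml; lra.
Qed.

Lemma stail_small e : 0 < e -> exists n, stail n < e.
Proof.
move=> e0; have /cvgrPdist_lt /(_ e e0)[n _ /(_ n (leqnn n))] := stail_cvg0.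
by rewrite sub0r normrN ger0_norm ?stail_ge0//; exists n.
Qed.

End dominated_series.

Section potential.
Context d (R : realType) (G : compactMetrizableGroupType d R).
Variables (mu nu : probability G R) (a : nat -> R).
Hypothesis hmu : haar_probability mu.
Hypothesis a0 : forall k, 0 <= a k.
Hypothesis aS : exists S, forall n, \sum_(0 <= k < n) a k <= S.
Hypothesis mixa : forall k, mixes mu (convolution_pow nu k) (a k).
Variables (g : G -> R) (B : R).
Hypothesis mg : measurable_fun setT g.
Hypothesis gB : forall x, `|g x| <= B.
Hypothesis g0 : \int[mu]_x g x = 0.

Definition transition k (c : G) := \int[convolution_pow nu k]_y g (c * y)%g.
(** The Green potential of [g]. The series starts at [k = 0], so that
    [g = potential - P potential]. *)
Definition potential (c : G) := limn (series (transition^~ c)).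

Let B0 : 0 <= B. Proof. exact: le_trans (gB 1%g). Qed.

Lemma measurable_transition k : measurable_fun setT (transition k).
Proof. exact: measurable_mul_Rint. Qed.

Lemma transition_le k c : `|transition k c| <= B * a k.
Proof.
rewrite -[X in `|X|]subr0 -g0 -(haar_Rint hmu c mg); apply: mixa => //.
exact: measurableT_comp mg (measurable_mull c).
Qed.

Let dom c := dominated_series a0 aS B0 (transition_le^~ c).

Lemma potential_tail c n : `|potential c - series (transition^~ c) n| <= B * stail a n.
Proof. by case: (dom c). Qed.

Lemma potential_bounded c : `|potential c| <= B * stail a 0.
Proof. by have := potential_tail c 0; rewrite seriesEnat /= big_geq// subr0. Qed.

Lemma measurable_series n : measurable_fun setT (fun c => series (transition^~ c) n).
Proof.
rewrite (_ : (fun c => _) = fun c => \sum_(0 <= k < n) transition k c); last first.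
  by apply/funext => c; rewrite seriesEnat.
by apply: measurable_sum => k; exact: measurable_transition.
Qed.

Lemma measurable_potential : measurable_fun setT potential.
Proof.
apply: (@measurable_fun_cvg _ _ _ _ (fun n c => series (transition^~ c) n)).
  exact: measurable_series.
by move=> c _; case: (dom c).
Qed.

Lemma Rint_pow1 (f : G -> R) : \int[convolution_pow nu 1]_x f x = \int[nu]_x f x.
Proof.
congr fine; apply: eq_measure_integral => A mA _; exact: convolution_pow1.
Qed.

Lemma transition0 c : transition 0 c = g c.
Proof.
rewrite /transition /Rintegral integral_dirac//; last first.
  by apply/measurable_EFinP; exact: measurableT_comp mg (measurable_mull c).
by rewrite diracT mul1e mulg1.
Qed.

Lemma transitionS k c : transition k.+1 c = \int[nu]_x transition k (c * x)%g.
Proof.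
rewrite /transition -add1n (Rint_convolution_powD _ _ _ (B := B)); last 2 first.
- exact: measurableT_comp mg (measurable_mull c).
- by move=> x; exact: gB.
rewrite Rint_pow1; apply: eq_Rintegral => x _; apply: eq_Rintegral => y _.
by rewrite mulgA.
Qed.

Lemma potential_mull_L1 c : L1 nu (fun x => potential (c * x)%g).
Proof.
apply: (L1_bounded nu); last by move=> x; exact: potential_bounded.
exact: measurableT_comp measurable_potential (measurable_mull c).
Qed.

(** Partial sums satisfy the equation up to a shift of the index by one, and their distance to the
    potential is bounded uniformly in the point, which passes the equation to the limit under the
    integral. *)
Lemma poisson c : potential c = g c + \int[nu]_x potential (c * x)%g.
Proof.
have ltr k : L1 nu (fun x => transition k (c * x)%g).
  apply: (L1_bounded nu); last by move=> x; exact: transition_le.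
  exact: measurableT_comp (measurable_transition k) (measurable_mull c).
have lser n : L1 nu (fun x => series (transition^~ (c * x)%g) n) /\
    series (transition^~ c) n.+1 =
    g c + \int[nu]_x series (transition^~ (c * x)%g) n.
  elim: n => [|n [IH1 IH2]].
    rewrite (_ : (fun x => _) = cst 0); last first.
      by apply/funext => x; rewrite seriesEnat /= big_geq//.
    split; first exact: L1_cst.
    by rewrite Rint_cst addr0 seriesEnat /= big_nat1 transition0.
  have E x : series (transition^~ (c * x)%g) n.+1 =
      series (transition^~ (c * x)%g) n + transition n (c * x)%g.
    by rewrite !seriesEnat /= big_nat_recr.
  rewrite (_ : (fun x => _) = fun x => series (transition^~ (c * x)%g) n + transition n (c * x)%g); last first.
    exact/funext.
  split; first exact: L1D.
  rewrite RintD// addrA -IH2 -transitionS.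
  by rewrite !seriesEnat /= big_nat_recr.
apply/eqP; rewrite -subr_eq0 -normr_eq0 eq_le normr_ge0 andbT.
apply/ler_addgt0Pr => e e0; rewrite add0r.
have [n Hn] : exists n, B * stail a n < e / 2.
  (* The tail is taken below [e / (2 * B + 1)] rather than [e / (2 * B)] to include [B = 0]. *)
  have [n Hn] := stail_small a0 aS (divr_gt0 e0 (ltr_pwDr ltr01 (mulr_ge0 (ler0n R 2) B0))).
  exists n; move: Hn; rewrite ltr_pdivlMr ?ltr_pwDr ?mulr_ge0//.
  have := stail_ge0 a0 aS n; nra.
have [ls Es] := lser n.
have h1 : `|potential c - series (transition^~ c) n.+1| <= B * stail a n.
  apply: le_trans (potential_tail c n.+1) _; rewrite ler_wpM2l// lerD2l lerN2.
  exact: series_nd.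
have h2 : `|\int[nu]_x potential (c * x)%g - \int[nu]_x series (transition^~ (c * x)%g) n|
    <= B * stail a n.
  rewrite -RintB//; last exact: potential_mull_L1.
  apply: Rint_bounded => [|x]; last exact: potential_tail.
  by apply: L1_measurable; apply: L1B ls; exact: potential_mull_L1.
move: h1 h2; rewrite Es; rewrite !ler_norml; lra.
Qed.

End potential.

Section haar_L1.
Context d (R : realType) (G : compactMetrizableGroupType d R).
Variables (mu : probability G R).
Hypothesis hmu : haar_probability mu.
Implicit Types (q : G -> R) (m : probability G R).

Lemma haar_L1r q x : L1 mu q -> L1 mu (fun c => q (c * x)%g).
Proof.
move=> lq; have mq := L1_measurable lq.
have /integrableP[_ qoo] := lq; apply/integrableP; split.
  by apply/measurable_EFinP; exact: measurableT_comp mq (measurable_mulr x).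
rewrite (haar_ge0_integralr x (f := fun y => (`|(q y)%:E|)%E))//.
by apply: measurableT_comp => //; exact/measurable_EFinP.
Qed.

Lemma measurable_mul2 q : measurable_fun setT q ->
  measurable_fun setT (fun p : G * G => q (p.1 * p.2)%g).
Proof. by move=> mq; apply: (measurableT_comp mq); exact: measurable_funMg. Qed.

Lemma L1_haar_mul m q : L1 mu q -> L1 (mu \x m)%E (fun p : G * G => q (p.1 * p.2)%g).
Proof.
move=> lq; have mq := L1_measurable lq.
have /integrableP[_ qoo] := lq; apply/integrable12ltyP.
  by apply/measurable_EFinP; exact: measurable_mul2.
have mqe : measurable_fun setT (fun y : G => (`|(q y)%:E|)%E).
  by apply: measurableT_comp => //; exact/measurable_EFinP.
rewrite (fubini_tonelli (fun p : G * G => (`|(q (p.1 * p.2)%g)%:E|)%E))//=; last first.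
  by apply: (measurableT_comp mqe); exact: measurable_funMg.
under eq_integral do rewrite (haar_ge0_integralr _ (f := fun y => (`|(q y)%:E|)%E))//.
by rewrite integral_probability_cst.
Qed.

Lemma L1_fst m q : L1 mu q -> L1 (mu \x m)%E (fun p : G * G => q p.1).
Proof.
move=> lq; have mq := L1_measurable lq.
have /integrableP[_ qoo] := lq; apply/integrable12ltyP.
  by apply/measurable_EFinP; exact: (measurableT_comp mq).
by under eq_integral do rewrite /= integral_probability_cst.
Qed.

Lemma Rint_stationary m q : L1 mu q -> (forall c, L1 m (fun x => q (c * x)%g)) ->
  \int[mu]_c \int[m]_x q (c * x)%g = \int[mu]_x q x.
Proof.
move=> lq lqc; have mq := L1_measurable lq.
rewrite -(Rint_prod12 (L1_haar_mul m lq) lqc) (Rint_prod21 (L1_haar_mul m lq)).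
  by under eq_Rintegral do rewrite haar_Rintr//; rewrite Rint_cst.
by move=> x; exact: haar_L1r.
Qed.

End haar_L1.

Section square_integrable.
Context d (R : realType) (G : compactMetrizableGroupType d R).
Variables (mu nu : probability G R) (f : G -> R) (V0 : R).
Hypothesis mf : measurable_fun setT f.
Hypothesis f2 : L1 mu (fun x => f x ^+ 2).
Hypothesis fV : forall c, (\int[nu]_x (f (c * x)%g ^+ 2)%:E <= V0%:E)%E.

Lemma sqr_bound_ge0 : 0 <= V0.
Proof.
by rewrite -lee_fin; apply: le_trans (fV 1%g); apply: integral_ge0 => x _; rewrite lee_fin sqr_ge0.
Qed.

Let norm_le_sqr (y : R) : `|y| <= 1 + y ^+ 2.
Proof. by rewrite -[y ^+ 2]real_normK ?num_real//; have := sqr_ge0 (`|y| - 1); nra. Qed.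

Let mfc c : measurable_fun setT (fun x => f (c * x)%g).
Proof. exact: measurableT_comp mf (measurable_mull c). Qed.

Let mf2 : measurable_fun setT (fun x => f x ^+ 2).
Proof. exact: measurable_funX. Qed.

(** Given the first [k] factors, a single step from an arbitrary point remains; hence the index
    [k.+1]. *)
Lemma pow_sqr_bound k c :
  (\int[convolution_pow nu k.+1]_x (f (c * x)%g ^+ 2)%:E <= V0%:E)%E.
Proof.
rewrite /= ge0_integral_convolution; last 2 first.
- by apply/measurable_EFinP; exact: measurableT_comp mf2 (measurable_mull c).
- by move=> x; rewrite lee_fin sqr_ge0.
rewrite -[leRHS](integral_probability_cst (convolution_pow nu k)).
apply: ge0_le_integral => //.
- by move=> x _; apply: integral_ge0 => y _; rewrite lee_fin sqr_ge0.
- apply: (measurable_integral_mul nu (f := fun z => (f (c * z)%g ^+ 2)%:E)).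
    by apply/measurable_EFinP; exact: measurableT_comp mf2 (measurable_mull c).
  by move=> x; rewrite lee_fin sqr_ge0.
- move=> x _; under eq_integral do rewrite mulgA; exact: fV.
Qed.

Lemma L1_of_sqr_bound (m : probability G R) c :
  (\int[m]_x (f (c * x)%g ^+ 2)%:E <= V0%:E)%E ->
  [/\ L1 m (fun x => f (c * x)%g ^+ 2), L1 m (fun x => f (c * x)%g),
      \int[m]_x (f (c * x)%g ^+ 2) <= V0 & \int[m]_x `|f (c * x)%g| <= 1 + V0].
Proof.
move=> H; have l2 : L1 m (fun x => f (c * x)%g ^+ 2).
  apply: L1_ge0P => [|x|]; first exact: measurableT_comp mf2 (measurable_mull c).
    exact: sqr_ge0.
  by rewrite (le_lt_trans H)// ltry.
have l1 : L1 m (fun x => 1 + f (c * x)%g ^+ 2) by apply: L1D => //; exact: L1_cst.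
have i2 : \int[m]_x (f (c * x)%g ^+ 2) <= V0 by rewrite -lee_fin EFin_Rint.
have lf : L1 m (fun x => f (c * x)%g) by exact: L1_le l1.
split => //; apply: (@le_trans _ _ (\int[m]_x (1 + f (c * x)%g ^+ 2))).
  by apply: Rint_le => //; exact: L1_norm.
by rewrite RintD//; [rewrite Rint_cst lerD2l|exact: L1_cst].
Qed.

Definition fnu c := L1_of_sqr_bound (fV c).
Definition fpow k c := L1_of_sqr_bound (pow_sqr_bound k c).

Lemma L1_of_sqr : L1 mu f.
Proof.
have l1 : L1 mu (fun x => 1 + f x ^+ 2) by apply: L1D => //; exact: L1_cst.
exact: L1_le l1.
Qed.

End square_integrable.

Section martingale_approximation.
Context d (R : realType) (G : compactMetrizableGroupType d R).
Variables (mu nu : probability G R) (a : nat -> R).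
Hypothesis hmu : haar_probability mu.
Hypothesis a0 : forall k, 0 <= a k.
Hypothesis aS : exists S, forall n, \sum_(0 <= k < n) a k <= S.
Hypothesis mixa : forall k, mixes mu (convolution_pow nu k) (a k).
Variables (f : G -> R) (V0 : R).
Hypothesis mf : measurable_fun setT f.
Hypothesis f0 : \int[mu]_x f x = 0.
Hypothesis f2 : L1 mu (fun x => f x ^+ 2).
Hypothesis fV : forall c, (\int[nu]_x (f (c * x)%g ^+ 2)%:E <= V0%:E)%E.

Let V00 := sqr_bound_ge0 fV.
Let fnu c := fnu mf fV c.
Let fpow k c := fpow mf fV k c.
Let lf := L1_of_sqr mf f2.
Let mfc c : measurable_fun setT (fun x => f (c * x)%g).
Proof. exact: measurableT_comp mf (measurable_mull c). Qed.

Definition drift (c : G) := \int[nu]_x f (c * x)%g.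

Lemma measurable_drift : measurable_fun setT drift.
Proof. exact: measurable_mul_Rint. Qed.

Lemma drift_bounded c : `|drift c| <= 1 + V0.
Proof. by case: (fnu c) => _ l _ b; apply: le_trans b; exact: le_normr_Rintegral. Qed.

Lemma Rint_drift : \int[mu]_c drift c = 0.
Proof. by rewrite /drift Rint_stationary// => c; case: (fnu c). Qed.

Lemma transition_drift k c :
  transition nu drift k c = \int[convolution_pow nu k.+1]_z f (c * z)%g.
Proof.
have lp : L1 (convolution_pow nu k \x nu)%E (fun p : G * G => f (c * (p.1 * p.2))%g).
  apply: L1_prod12; first exact: (measurable_mul2 (mfc c)).
    move=> x; rewrite (_ : (fun y => _) = fun y => f ((c * x) * y)%g); last first.
      by apply/funext => y; rewrite mulgA.
    by case: (fnu (c * x)%g).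
  apply: (L1_bounded (B := 1 + V0) _).
    apply: (measurable_Rint2 nu (F := fun p : G * G => `|f (c * (p.1 * p.2))%g|)).
    by apply: measurableT_comp => //; exact: (measurable_mul2 (mfc c)).
  move=> x; rewrite ger0_norm; last by apply: Rintegral_ge0.
  under eq_Rintegral do rewrite mulgA.
  by case: (fnu (c * x)%g).
rewrite [in RHS]/= /convolution Rint_distribution; [|exact: mfc|exact: lp].
rewrite (Rint_prod12 lp); last first.
  move=> x; rewrite (_ : (fun y => _) = fun y => f ((c * x) * y)%g); last first.
    by apply/funext => y; rewrite mulgA.
  by case: (fnu (c * x)%g).
apply: eq_Rintegral => x _; apply: eq_Rintegral => y _.
by rewrite /= mulgA.
Qed.

(** This is the sum over [k >= 1] of [P^k f], taken as the potential of [P f]: mixing applies to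
    bounded functions, and [f] itself may be unbounded. *)
Definition corrector := potential nu drift.
Definition corrector_bound := (1 + V0) * stail a 0.
Local Notation h := corrector.
Local Notation H := corrector_bound.

Lemma measurable_corrector : measurable_fun setT h.
Proof. exact: (measurable_potential hmu a0 aS mixa measurable_drift drift_bounded Rint_drift). Qed.

Lemma corrector_le c : `|h c| <= H.
Proof. exact: (potential_bounded hmu a0 aS mixa measurable_drift drift_bounded Rint_drift). Qed.

Let L1_corrector_mull c : L1 nu (fun x => h (c * x)%g).
Proof. exact: (potential_mull_L1 hmu a0 aS mixa measurable_drift drift_bounded Rint_drift). Qed.

Lemma corrector_poisson c : h c = \int[nu]_x (f (c * x)%g + h (c * x)%g).
Proof.
case: (fnu c) => _ l _ _.
rewrite RintD//.
exact: (poisson hmu a0 aS mixa measurable_drift drift_bounded Rint_drift).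
Qed.

Let lfh : L1 mu (fun x => f x * h x).
Proof.
have lHf : L1 mu (fun x => H * `|f x|) by apply: L1Z; exact: L1_norm.
apply: L1_le lHf; first by apply: measurable_funM => //; exact: measurable_corrector.
by move=> x; rewrite normrM mulrC ler_wpM2r// corrector_le.
Qed.

Lemma autocovariance_drift k :
  autocovariance mu nu f k.+1 = \int[mu]_u (f u * transition nu drift k u).
Proof.
have lp : L1 (mu \x convolution_pow nu k.+1)%E (fun p : G * G => f p.1 * f (p.1 * p.2)%g).
  have l : L1 (mu \x convolution_pow nu k.+1)%E
      (fun p : G * G => f p.1 ^+ 2 + f (p.1 * p.2)%g ^+ 2).
    by apply: L1D; [exact: (L1_fst _ f2)|exact: (L1_haar_mul hmu _ f2)].
  apply: L1_le l.
    by apply: measurable_funM; [exact: (measurableT_comp mf)|exact: measurable_mul2].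
  move=> p; move: (f _) (f _) => y z; rewrite ler_norml.
  have := sqr_ge0 (y - z); have := sqr_ge0 (y + z); have := sqr_ge0 y; have := sqr_ge0 z.
  by move=> *; apply/andP; split; nra.
rewrite /autocovariance unlock -[LHS]/(Rintegral _ _ _) (Rint_prod12 lp) /=; last first.
  by move=> u; apply: L1Z; case: (fpow k u).
apply: eq_Rintegral => u _; rewrite transition_drift RintZ//.
by case: (fpow k u).
Qed.

(** Green-Kubo formula: the covariance at lag [k + 1] is the mean of [f * P^(k+1) f], and the tail
    of the potential, uniform in the point and integrated against [|f|], lets the sum pass under the
    integral. *)
Lemma asymptotic_varianceE : asymptotic_variance mu nu f = \int[mu]_x f x ^+ 2 + 2 * \int[mu]_x (f x * h x).
Proof.
rewrite /asymptotic_variance; congr (_ + 2 * _).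
  by rewrite unlock.
apply/cvg_lim => //.
have msT n : measurable_fun setT (fun u => series (transition nu drift^~ u) n).
  exact: (measurable_series nu measurable_drift).
have tl u n : `|h u - series (transition nu drift^~ u) n| <= (1 + V0) * stail a n.
  exact: (potential_tail hmu a0 aS mixa measurable_drift drift_bounded Rint_drift).
have lt k : L1 mu (fun u => f u * transition nu drift k u).
  have l : L1 mu (fun u => ((1 + V0) * a k) * `|f u|) by apply: L1Z; exact: L1_norm.
  apply: L1_le l; first by apply: measurable_funM => //; exact: (measurable_transition nu measurable_drift).
  move=> u; rewrite normrM mulrC ler_wpM2r//.
  exact: (transition_le hmu mixa measurable_drift drift_bounded Rint_drift).
have E n : L1 mu (fun u => f u * series (transition nu drift^~ u) n) /\
    series (fun k => autocovariance mu nu f k.+1) n =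
    \int[mu]_u (f u * series (transition nu drift^~ u) n).
  elim: n => [|n [IH1 IH2]].
    rewrite (_ : (fun u => _) = cst 0); last first.
      by apply/funext => u; rewrite seriesEnat /= big_geq// mulr0.
    by split; [exact: L1_cst|rewrite Rint_cst seriesEnat /= big_geq].
  rewrite (_ : (fun u => _) = fun u => f u * series (transition nu drift^~ u) n
      + f u * transition nu drift n u); last first.
    by apply/funext => u; rewrite !seriesEnat /= big_nat_recr//= mulrDr.
  split; first exact: L1D.
  by rewrite RintD// -IH2 -autocovariance_drift !seriesEnat /= big_nat_recr.
rewrite (_ : series _ = fun n => \int[mu]_u (f u * series (transition nu drift^~ u) n)); last first.
  by apply/funext => n; case: (E n).
pose K := \int[mu]_u `|f u|.
have bnd n : `|\int[mu]_x (f x * h x) - \int[mu]_u (f u * series (transition nu drift^~ u) n)|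
    <= ((1 + V0) * K) * stail a n.
  case: (E n) => l _; rewrite -RintB//.
  rewrite (_ : _ * _ * _ = \int[mu]_u (((1 + V0) * stail a n) * `|f u|)); last first.
    rewrite RintZ; last exact: L1_norm.
    by rewrite -/K; move: K (stail a n) => y z; ring.
  apply: Rint_abs_le; first exact: (L1_measurable (L1B lfh l)).
    by apply: L1Z; exact: L1_norm.
  by move=> u; rewrite -mulrBr normrM mulrC ler_wpM2r.
apply/cvgrPdist_le => e e0.
have : ((1 + V0) * K) * stail a n @[n --> \oo] --> ((1 + V0) * K) * 0.
  by apply: cvgM; [exact: cvg_cst|exact: stail_cvg0].
rewrite mulr0 => /cvgrPdist_le /(_ e e0); apply: filterS => n.
rewrite sub0r normrN => hn; apply: le_trans (bnd n) (le_trans (ler_norm _) hn).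
Qed.

End martingale_approximation.

Section martingale_differences.
Context d (R : realType) (G : compactMetrizableGroupType d R).
Variables (mu nu : probability G R).
Hypothesis hmu : haar_probability mu.
Variables (f : G -> R) (V0 : R).
Hypothesis mf : measurable_fun setT f.
Hypothesis f2 : L1 mu (fun x => f x ^+ 2).
Hypothesis fV : forall c, (\int[nu]_x (f (c * x)%g ^+ 2)%:E <= V0%:E)%E.
Variables (h : G -> R) (H : R).
Hypothesis mh : measurable_fun setT h.
Hypothesis hH : forall x, `|h x| <= H.
Hypothesis hP : forall c, h c = \int[nu]_x (f (c * x)%g + h (c * x)%g).

Let fnu c := fnu mf fV c.
Let lf := L1_of_sqr mf f2.
Let H_ge0 : 0 <= H.
Proof. exact: le_trans (hH 1%g). Qed.

Lemma L1_corrector_mull c : L1 nu (fun x => h (c * x)%g).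
Proof.
apply: (L1_bounded nu _ (fun x => hH _)).
exact: measurableT_comp mh (measurable_mull c).
Qed.

Definition mdiff (c x : G) : R := f (c * x)%g + h (c * x)%g - h c.
Definition mvar (c : G) : R := \int[nu]_x mdiff c x ^+ 2.
(** From [(y + z)^2 <= 2 y^2 + 2 z^2], where [z] is a difference of two values of [h], hence at most
    [2 * H] in absolute value. *)
Definition mvar_bound := 2 * V0 + 8 * H ^+ 2.

Lemma measurable_mdiff : measurable_fun setT (fun p : G * G => mdiff p.1 p.2).
Proof.
apply: measurable_funB; first apply: measurable_funD.
- exact: measurable_mul2.
- exact: measurable_mul2 mh.
- exact: measurableT_comp mh _.
Qed.

Let mD c : measurable_fun setT (mdiff c).
Proof. exact: (measurable_fun_pair2 c measurable_mdiff). Qed.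

Lemma L1_mdiff c : L1 nu (mdiff c).
Proof.
case: (fnu c) => _ l _ _; apply: L1B; last exact: L1_cst.
by apply: L1D => //; exact: L1_corrector_mull.
Qed.

Lemma Rint_mdiff c : \int[nu]_x mdiff c x = 0.
Proof.
case: (fnu c) => _ l _ _.
rewrite RintB; [|apply: L1D => //; exact: L1_corrector_mull|exact: L1_cst].
by rewrite Rint_cst -hP subrr.
Qed.

Lemma mdiff_sqr_le c x : mdiff c x ^+ 2 <= 2 * f (c * x)%g ^+ 2 + 8 * H ^+ 2.
Proof.
have /andP[h1 h2] : - H <= h (c * x)%g <= H by rewrite -ler_norml hH.
have /andP[h3 h4] : - H <= h c <= H by rewrite -ler_norml hH.
rewrite /mdiff; move: (f _) (h (c * x)%g) (h c) h1 h2 h3 h4 => y z w h1 h2 h3 h4.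
have : (z - w) ^+ 2 <= (2 * H) ^+ 2.
  by rewrite -(real_normK (num_real (z - w))) lerXn2r ?nnegrE ?mulr_ge0 ?H_ge0// ler_norml; lra.
by have := sqr_ge0 (y - (z - w)); nra.
Qed.

Lemma L1_mdiff_sqr c : L1 nu (fun x => mdiff c x ^+ 2).
Proof.
case: (fnu c) => l _ _ _.
have l2 : L1 nu (fun x => 2 * f (c * x)%g ^+ 2 + 8 * H ^+ 2).
  by apply: L1D; [exact: L1Z|exact: L1_cst].
apply: L1_le l2; first exact: measurable_funX.
by move=> x; rewrite ger0_norm ?sqr_ge0// mdiff_sqr_le.
Qed.

Lemma measurable_mvar : measurable_fun setT mvar.
Proof.
apply: (measurable_Rint2 nu (F := fun p : G * G => mdiff p.1 p.2 ^+ 2)).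
by apply: measurable_funX; exact: measurable_mdiff.
Qed.

Lemma mvar_ge0 c : 0 <= mvar c.
Proof. by apply: Rintegral_ge0 => x _; exact: sqr_ge0. Qed.

Lemma mvar_le c : mvar c <= mvar_bound.
Proof.
case: (fnu c) => l _ i _.
have l2 : L1 nu (fun x => 2 * f (c * x)%g ^+ 2 + 8 * H ^+ 2).
  by apply: L1D; [exact: L1Z|exact: L1_cst].
apply: le_trans (Rint_le (L1_mdiff_sqr c) l2 (mdiff_sqr_le c)) _.
rewrite RintD; [|exact: L1Z|exact: L1_cst].
by rewrite RintZ// Rint_cst lerD2r ler_wpM2l.
Qed.

Let lfh : L1 mu (fun x => f x * h x).
Proof.
have lHf : L1 mu (fun x => H * `|f x|) by apply: L1Z; exact: L1_norm.
apply: L1_le lHf; first by apply: measurable_funM => //; exact: mh.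
by move=> x; rewrite normrM mulrC ler_wpM2r// hH.
Qed.

(** With [F = f + h] and [h = P F], the conditional variance is [P (F^2) - h^2]. By invariance of
    [mu] its mean is that of [F^2 - h^2 = f^2 + 2 f h]. *)
Lemma Rint_mvar : \int[mu]_c mvar c = \int[mu]_x f x ^+ 2 + 2 * \int[mu]_x (f x * h x).
Proof.
pose F x := f x + h x.
have mF : measurable_fun setT F by apply: measurable_funD => //; exact: mh.
have lh2 (m : probability G R) : L1 m (fun x => h x ^+ 2).
  apply: (L1_bounded (B := H ^+ 2) _); first by apply: measurable_funX; exact: mh.
  by move=> x; rewrite normrX lerXn2r ?nnegrE ?H_ge0// hH.
have lF2 : L1 mu (fun x => F x ^+ 2).
  rewrite (_ : (fun x => F x ^+ 2) = fun x => f x ^+ 2 + 2 * (f x * h x) + h x ^+ 2); last first.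
    by apply/funext => x; rewrite /F; move: (f x) (h x) => y z; ring.
  by apply: L1D => //; apply: L1D => //; exact: L1Z.
have lF c : L1 nu (fun x => F (c * x)%g).
  by case: (fnu c) => _ l _ _; apply: L1D => //; exact: L1_corrector_mull.
have lF2c c : L1 nu (fun x => F (c * x)%g ^+ 2).
  rewrite (_ : (fun x => _) = fun x => mdiff c x ^+ 2 + (2 * h c) * F (c * x)%g - h c ^+ 2); last first.
    by apply/funext => x; rewrite /F /mdiff; move: (f (c * x)%g) (h (c * x)%g) (h c) => y z w; ring.
  apply: L1B; last exact: L1_cst.
  by apply: L1D; [exact: L1_mdiff_sqr|exact: L1Z].
have E c : mvar c = \int[nu]_x (F (c * x)%g ^+ 2) - h c ^+ 2.
  rewrite /mvar (_ : (fun x => mdiff c x ^+ 2) =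
    fun x => (F (c * x)%g ^+ 2 - (2 * h c) * F (c * x)%g) + h c ^+ 2); last first.
    by apply/funext => x; rewrite /F /mdiff; move: (f (c * x)%g) (h (c * x)%g) (h c) => y z w; ring.
  rewrite RintD; [|by apply: L1B => //; exact: L1Z|exact: L1_cst].
  rewrite RintB//; last exact: L1Z.
  rewrite RintZ// Rint_cst -hP.
  by move: (\int[nu]_x _) (h c) => y z; ring.
rewrite (_ : mvar = fun c => \int[nu]_x (F (c * x)%g ^+ 2) - h c ^+ 2); last exact/funext.
rewrite RintB//; last first.
  rewrite (_ : (fun c => _) = fun c => mvar c + h c ^+ 2); last first.
    by apply/funext => c; rewrite E subrK.
  apply: L1D => //; apply: (L1_bounded (B := mvar_bound) _); first exact: measurable_mvar.
  by move=> c; rewrite ger0_norm ?mvar_ge0// mvar_le.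
rewrite (Rint_stationary hmu lF2 lF2c).
rewrite (_ : (fun x => F x ^+ 2) = fun x => f x ^+ 2 + 2 * (f x * h x) + h x ^+ 2); last first.
  by apply/funext => x; rewrite /F; move: (f x) (h x) => y z; ring.
rewrite RintD//; last by apply: L1D => //; exact: L1Z.
rewrite RintD//; last exact: L1Z.
by rewrite RintZ// addrK.
Qed.

End martingale_differences.


(** * Markov recursions driven by i.i.d. variables *)

Section recursion_independence.
Context d d1 d2 (Omega : measurableType d) (T : measurableType d1)
  (Z : measurableType d2) (R : realType).
Local Open Scope ereal_scope.

Lemma eq_measure_rectangles (m1 m2 : {measure set (Z * T) -> \bar R}) :
  m1 setT < +oo ->
  (forall A B, measurable A -> measurable B -> m1 (A `*` B) = m2 (A `*` B)) ->
  forall E, measurable E -> m1 E = m2 E.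
Proof.
move=> moo m12 E mE.
pose C : set (set (Z * T)) :=
  [set C | exists A, measurable A /\ exists B, measurable B /\ C = A `*` B].
apply: (measure_unique C (fun=> setT)) => //.
- rewrite measurable_prod_measurableType //; congr (<<s _ >>).
  rewrite predeqE; split => [[A mA [B mB <-]]|[A [mA [B [mB ->]]]]].
    by exists A; split => //; exists B.
  by exists A => //; exists B.
- move=> /= _ _ [X1 [mX1 [X2 [mX2 ->]]]] [Y1 [mY1 [Y2 [mY2 ->]]]].
  rewrite -setXI; exists (X1 `&` Y1); split; first exact: measurableI.
  by exists (X2 `&` Y2); split => //; exact: measurableI.
- by move=> n; exists setT; split => //; exists setT; split => //; rewrite setXTT.
- by rewrite bigcup_const//; exists 0%N.
- by move=> A [A1 [mA1 [A2 [mA2 ->]]]]; exact: m12.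
Qed.

Variables (P : probability Omega R) (nu : probability T R) (X : nat -> {RV P >-> T}).
Hypothesis iidX : iid nu X.
Variables (Y : nat -> Omega -> Z) (z0 : Z) (Psi : Z * T -> Z).
Hypothesis mPsi : measurable_fun setT Psi.
Hypothesis Y0 : forall w, Y 0 w = z0.
Hypothesis YS : forall k w, Y k.+1 w = Psi (Y k w, X k w).

Lemma measurable_recursion k : measurable_fun setT (Y k).
Proof.
elim: k => [|k IH].
  by rewrite (_ : Y 0 = cst z0)//; apply/funext => w; rewrite Y0.
rewrite (_ : Y k.+1 = fun w => Psi (Y k w, X k w)); last exact/funext.
by apply: (measurableT_comp mPsi); exact: measurable_fun_pair.
Qed.

Let cyl (J : {fset nat}) (B : nat -> set T) := \bigcap_(j in [set` J]) X j @^-1` B j.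

Let mX j (B : set T) : measurable B -> measurable (X j @^-1` B).
Proof. by move=> mB; rewrite -[X in measurable X]setTI; exact: measurable_funPT. Qed.

Let mY k (A : set Z) : measurable A -> measurable (Y k @^-1` A).
Proof. by move=> mA; rewrite -[X in measurable X]setTI; exact: measurable_recursion. Qed.

Let mcyl (J : {fset nat}) B : (forall j, measurable (B j)) -> measurable (cyl J B).
Proof. by move=> mB; apply: fin_bigcap_measurable => // j _; exact: mX. Qed.

Let cylU1 (k : nat) (J : {fset nat}) B (B' : set T) : k \notin J ->
  cyl (k |` J)%fset (fun j => if j == k then B' else B j) =
  X k @^-1` B' `&` cyl J B.
Proof.
move=> kJ; apply/seteqP; split => w.
  move=> H; split.
    by have := H k; rewrite /= eqxx; apply; rewrite fset1U1.
  move=> j jJ; have := H j; rewrite /= ifF; last by apply/eqP => jk; move: jJ; rewrite /= jk (negbTE kJ).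
  by apply; rewrite inE; apply/orP; right.
move=> [H1 H2] j /=; rewrite !inE => /orP[/eqP->|jJ]; first by rewrite eqxx.
rewrite ifF; first exact: H2.
by apply/eqP => jk; move: kJ; rewrite -jk jJ.
Qed.

Let cyl_indep (k : nat) (J : {fset nat}) B (B' : set T) : k \notin J -> measurable B' ->
  (forall j, measurable (B j)) ->
  P (X k @^-1` B' `&` cyl J B) = P (X k @^-1` B') * P (cyl J B).
Proof.
move=> kJ mB' mB; rewrite -cylU1//.
have mBB j : measurable (if j == k then B' else B j) by case: ifP.
rewrite /cyl (iidX.1 _ _ mBB) (iidX.1 _ _ mB) big_fsetU1//= eqxx; congr (_ * _).
apply: eq_big_seq => j jJ; rewrite ifF//; apply/eqP => jk.
by move: jJ; rewrite /= jk (negbTE kJ).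
Qed.

(** The present state is independent of all later increments. The finite family [J] is arbitrary so
    that the induction can hand [X k] over from the future to the state. *)
Let indep k : forall A (J : {fset nat}) (B : nat -> set T), measurable A -> (forall j, j \in J -> (k <= j)%N) ->
  (forall j, measurable (B j)) ->
  P (Y k @^-1` A `&` cyl J B) = P (Y k @^-1` A) * P (cyl J B).
Proof.
elim: k => [|k IH] A J B mA kJ mB.
  have [Az|Az] := pselect (A z0).
    rewrite (_ : Y 0 @^-1` A = setT); last first.
      by apply/seteqP; split => // w _; rewrite /= Y0.
    rewrite setTI -[LHS]mul1e; congr (_ * _); exact/esym/probability_setT.
  rewrite (_ : Y 0 @^-1` A = set0); last first.
    by apply/seteqP; split => // w; rewrite /= Y0.
  by rewrite set0I measure0 mul0e.
have kJ' : k \notin J by apply/negP => /kJ; rewrite ltnn.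
have mC := mcyl J mB.
pose YX w := (Y k w, X k w).
have mYX : measurable_fun setT YX.
  by apply: measurable_fun_pair => //; exact: measurable_recursion.
(* The law of the pair on the event [cyl J B] is compared with its full law scaled by the
   probability of that event: rectangles determine both, and there the induction hypothesis
   applies. *)
pose m1 := pushforward (mrestr P mC) YX.
have PC0 : (0 <= fine (P (cyl J B)))%R by exact: fine_ge0.
pose YXm := mfun_Sub (mem_set mYX : YX \in mfun).
pose m2 := mscale (NngNum PC0) (distribution P YXm).
have E : forall F, measurable F -> m1 F = m2 F.
  apply: eq_measure_rectangles => //.
    rewrite /m1 /= /pushforward /mrestr preimage_setT setTI.
    by rewrite (le_lt_trans (probability_le1 _ _)) ?ltry.
  move=> A' B' mA' mB'.
  rewrite /m1 /m2 /= /mscale /distribution /pushforward /mrestr /= fineK ?fin_num_measure//.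
  rewrite (_ : YX @^-1` (A' `*` B') = Y k @^-1` A' `&` X k @^-1` B')//.
  have kk j : j \in [fset k]%fset -> (k <= j)%N by rewrite inE => /eqP->.
  have kJJ j : j \in (k |` J)%fset -> (k <= j)%N.
    by rewrite !inE => /orP[/eqP->//|/kJ /ltnW].
  have mBB j : measurable (if j == k then B' else B j) by case: ifP.
  rewrite -setIA -cylU1// IH// cylU1// cyl_indep//.
  have -> : X k @^-1` B' = cyl [fset k]%fset (fun=> B').
    apply/seteqP; split => w; rewrite /cyl /=.
      by move=> H j /=; rewrite inE => /eqP->.
    by apply; rewrite /= inE.
  have -> : distribution P YXm (A' `*` B') =
      P (Y k @^-1` A' `&` cyl [fset k]%fset (fun=> B')).
    congr (P _); apply/seteqP; split => w; rewrite /cyl /=.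
      by move=> [/= H1 H2]; split => // j /=; rewrite inE => /eqP->.
    by move=> [H1 H2]; split => //; apply: H2; rewrite /= inE.
  by rewrite IH// muleA [RHS]muleC.
rewrite (_ : Y k.+1 @^-1` A = YX @^-1` (Psi @^-1` A)); last first.
  by apply/seteqP; split => w; rewrite /= YS.
have mPA : measurable (Psi @^-1` A) by rewrite -[X in measurable X]setTI; exact: mPsi.
have := E _ mPA; rewrite /m1 /m2 /= /mscale /distribution /pushforward /mrestr /= fineK ?fin_num_measure//.
by rewrite muleC.
Qed.

Definition rec_fun k : Omega -> Z := Y k.

HB.instance Definition _ k :=
  isMeasurableFun.Build _ _ _ _ (rec_fun k) (measurable_recursion k).

Lemma recursion_ge0_integral k (psi : Z -> \bar R) :
  measurable_fun setT psi -> (forall z, 0 <= psi z) ->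
  \int[P]_w psi (Y k.+1 w) = \int[P]_w \int[nu]_x psi (Psi (Y k w, x)).
Proof.
move=> mpsi psi0.
pose YX w := (Y k w, X k w).
have mYX : measurable_fun setT YX.
  by apply: measurable_fun_pair => //; exact: measurable_recursion.
have mphi : measurable_fun setT (fun p : Z * T => psi (Psi p)).
  exact: measurableT_comp mpsi mPsi.
pose law : probability Z R := distribution P (rec_fun k).
transitivity (\int[pushforward P YX]_p psi (Psi p)).
  by rewrite ge0_integral_pushforward//; apply: eq_integral => w _; rewrite YS.
transitivity (\int[(law \x nu)]_p psi (Psi p)).
  apply: eq_measure_integral => // E mE _; apply: eq_measure_rectangles => //.
    rewrite /= /pushforward preimage_setT.
    by rewrite (le_lt_trans (probability_le1 _ _)) ?ltry.
  move=> A B mA mB; rewrite -[RHS]/((law \x nu) (A `*` B)) product_measure1E//.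
  rewrite -[LHS]/(P (YX @^-1` (A `*` B))).
  rewrite (_ : YX @^-1` (A `*` B) = Y k @^-1` A `&` X k @^-1` B)//.
  have -> : X k @^-1` B = cyl [fset k]%fset (fun=> B).
    apply/seteqP; split => w; rewrite /cyl /=.
      by move=> H j /=; rewrite inE => /eqP->.
    by apply; rewrite /= inE.
  rewrite indep//; last by move=> j; rewrite inE => /eqP->.
  congr (_ * _); transitivity (P (X k @^-1` B)); last exact: (iidX.2 k B mB).
  congr (P _); apply/seteqP; split => w; rewrite /cyl /=.
    by apply; rewrite /= inE.
  by move=> H j /=; rewrite inE => /eqP->.
rewrite fubini_tonelli1// ge0_integral_distribution//.
  by apply: (measurable_fun_fubini_tonelli_F (fun p => psi (Psi p))).
by move=> z; exact: integral_ge0.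
Qed.

End recursion_independence.

Section recursion_Rint.
Context d d1 d2 (Omega : measurableType d) (T : measurableType d1)
  (Z : measurableType d2) (R : realType).
Variables (P : probability Omega R) (nu : probability T R) (X : nat -> {RV P >-> T}).
Hypothesis iidX : iid nu X.
Variables (Y : nat -> Omega -> Z) (z0 : Z) (Psi : Z * T -> Z).
Hypothesis mPsi : measurable_fun setT Psi.
Hypothesis Y0 : forall w, Y 0 w = z0.
Hypothesis YS : forall k w, Y k.+1 w = Psi (Y k w, X k w).

Lemma recursion_Rint k (psi : Z -> R) (B : R) : measurable_fun setT psi ->
  (forall z, `|psi z| <= B) ->
  \int[P]_w psi (Y k.+1 w) = \int[P]_w \int[nu]_x psi (Psi (Y k w, x)).
Proof.
move=> mpsi psiB.
have mY j : measurable_fun setT (Y j) := measurable_recursion mPsi Y0 YS j.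
have mPz z : measurable_fun setT (fun x => Psi (z, x)).
  exact: (measurable_fun_pair2 z mPsi).
have mP j : measurable_fun setT (fun w => psi (Y j w)) by exact: measurableT_comp mpsi (mY j).
have mF : measurable_fun setT (fun p : Omega * T => psi (Psi (Y k p.1, p.2))).
  apply: (measurableT_comp mpsi); apply: (measurableT_comp mPsi).
  by apply: measurable_fun_pair => //; exact: measurableT_comp (mY k) measurable_fst.
have mI : measurable_fun setT (fun w => \int[nu]_x psi (Psi (Y k w, x))).
  exact: (measurable_Rint2 nu mF).
have mx z : measurable_fun setT (fun x => psi (Psi (z, x))).
  exact: measurableT_comp mpsi (mPz z).
have lx z : L1 nu (fun x => psi (Psi (z, x))).
  by apply: (L1_bounded (B := B) _ (mx z)) => x.
have lP : L1 P (fun w => psi (Y k.+1 w)).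
  by apply: (L1_bounded (B := B) _ (mP k.+1)) => x.
have lI : L1 P (fun w => \int[nu]_x psi (Psi (Y k w, x))).
  by apply: (L1_bounded (B := B) _ mI) => w; exact: Rint_bounded.
have psiB0 z : 0 <= psi z + B by have := psiB z; rewrite ler_norml => /andP[]; lra.
have shift d3 (T3 : measurableType d3) (Q : probability T3 R) (g : T3 -> R) :
    L1 Q g -> \int[Q]_x g x + B = \int[Q]_x (g x + B).
  by move=> lg; rewrite RintD ?Rint_cst//; exact: L1_cst.
(* As for convolutions, adding [B] reduces a bounded integrand to a nonnegative one. *)
apply: (addIr B); rewrite !shift//.
under [RHS]eq_Rintegral do rewrite shift//.
congr fine.
rewrite (recursion_ge0_integral iidX mPsi Y0 YS k (psi := fun z => (psi z + B)%:E)).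
- apply: eq_integral => w _; rewrite EFin_Rint//; apply: L1D => //; exact: L1_cst.
- by apply/measurable_EFinP; exact: measurable_funD.
- by move=> z; rewrite lee_fin.
Qed.

End recursion_Rint.

(** * Sums of negative powers *)

Section power_sums.
Context (R : realType).
Implicit Types (s c p t : R).

(* [(1 + c / s) `^ p >= 1 + p (1 - s / (s + c))], from [expR x >= 1 + x] twice. *)
Lemma powR_decrement s c p : 0 < s -> 0 <= c -> 0 < p ->
  p * c * (s + c) `^ (- (1 + p)) <= s `^ (- p) - (s + c) `^ (- p).
Proof.
move=> s0 c0 p0; have sc : 0 < s + c by rewrite ltr_pwDl.
have e : (s + c) `^ (- (1 + p)) = (s + c) `^ (- p) / (s + c).
  by rewrite opprD [- 1 - p]addrC powRD ?(gt_eqF sc) ?implybT// powR_inv1// ltW.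
have l : 1 - s / (s + c) <= ln (s + c) - ln s.
  have := expR_ge1Dx (- (ln (s + c) - ln s)).
  rewrite opprB expRD expRN !lnK ?posrE//; lra.
have -> : s `^ (- p) = (s + c) `^ (- p) * expR (p * (ln (s + c) - ln s)).
  rewrite /powR !gt_eqF// -expRD; congr expR; ring.
have h := expR_ge1Dx (p * (ln (s + c) - ln s)).
have q0 : 0 <= (s + c) `^ (- p) by exact: powR_ge0.
rewrite e (_ : p * c * _ = (s + c) `^ (- p) * (p * (1 - s / (s + c)))); last first.
  by field; rewrite gt_eqF.
rewrite -{3}[(s + c) `^ (- p)]mulr1 -mulrBr ler_wpM2l//.
have : p * (1 - s / (s + c)) <= p * (ln (s + c) - ln s) by rewrite ler_pM2l.
lra.
Qed.

Lemma sum_powR_le s c p n : 1 <= s -> 0 < c -> 0 < p ->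
  \sum_(0 <= k < n) (s + c * k%:R) `^ (- (1 + p)) <= (1 + (p * c)^-1) * s `^ (- p).
Proof.
move=> s1 c0 p0; have s0 : 0 < s by exact: lt_le_trans s1.
have pc : 0 < p * c by exact: mulr_gt0.
(* The terms with [k >= 1] telescope through [powR_decrement], and the induction carries the
   difference that is left. The term [k = 0] is bounded apart, using [1 <= s]. *)
suff h : \sum_(0 <= k < n.+1) (s + c * k%:R) `^ (- (1 + p)) <=
    s `^ (- p) + (p * c)^-1 * (s `^ (- p) - (s + c * n%:R) `^ (- p)).
  have : \sum_(0 <= k < n) (s + c * k%:R) `^ (- (1 + p)) <=
      \sum_(0 <= k < n.+1) (s + c * k%:R) `^ (- (1 + p)).
    by rewrite big_nat_recr//= lerDl powR_ge0.
  move=> /le_trans; apply; apply: (le_trans h).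
  rewrite mulrDl mul1r lerD2l ler_wpM2l ?invr_ge0 ?(ltW pc)//.
  by rewrite gerBl powR_ge0.
elim: n => [|n IH].
  rewrite big_nat1 mulr0 addr0 subrr mulr0 addr0.
  by apply: ler_powR => //; lra.
rewrite big_nat_recr//=.
have sn : 0 < s + c * n%:R by rewrite ltr_pwDl// mulr_ge0// ltW.
have := powR_decrement sn (ltW c0) p0.
have -> : s + c * n%:R + c = s + c * n.+1%:R by rewrite -natr1; ring.
rewrite -(ler_pM2l (x := (p * c)^-1)) ?invr_gt0// mulrA mulVf ?gt_eqF// mul1r.
move: IH; rewrite !mulrBr.
move: (\sum_(_ <= _ < _) _) ((p * c)^-1 * _ `^ _) ((p * c)^-1 * _ `^ _) ((p * c)^-1 * _ `^ _).
by move=> *; lra.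
Qed.

Lemma iq_powR t r : 0 < t -> iq t `^ r = t `^ (- (r / 2)).
Proof.
move=> t0; rewrite /iq -powR12_sqrt ?(ltW t0)// -powRN -powRrM; congr (_ `^ _); by field.
Qed.

End power_sums.

Section walk_law.
Context d (R : realType) (G : compactMetrizableGroupType d R).
Variables (nu : probability G R).
Context d' (Omega : measurableType d') (P : probability Omega R).
Variable X : nat -> {RV P >-> G}.
Hypothesis iidX : iid nu X.

Let mPsi : measurable_fun setT (fun p : G * G => (p.1 * p.2)%g).
Proof. exact: measurable_funMg. Qed.

Let S0 w : random_walk X 0 w = 1%g. Proof. exact: big_ord0. Qed.

Let SS k w : random_walk X k.+1 w = (random_walk X k w * X k w)%g.
Proof. exact: big_ord_recr. Qed.

Lemma measurable_random_walk k : measurable_fun setT (random_walk X k).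
Proof. exact: (measurable_recursion mPsi S0 SS). Qed.

Lemma ge0_integral_random_walk k (psi : G -> \bar R) :
  measurable_fun setT psi -> (forall z, 0 <= psi z)%E ->
  (\int[P]_w psi (random_walk X k w) = \int[convolution_pow nu k]_x psi x)%E.
Proof.
elim: k psi => [|k IH] psi mpsi psi0.
  under eq_integral do rewrite S0.
  by rewrite integral_probability_cst /= integral_dirac ?diracT ?mul1e.
rewrite (recursion_ge0_integral iidX mPsi S0 SS)//=.
rewrite (IH (fun c => \int[nu]_x psi (c * x)%g)%E).
- by rewrite ge0_integral_convolution.
- exact: measurable_integral_mul.
- by move=> z; exact: integral_ge0.
Qed.

Lemma Rint_random_walk k (g : G -> R) B : measurable_fun setT g ->
  (forall x, 0 <= g x <= B) ->
  \int[P]_w g (random_walk X k w) = \int[convolution_pow nu k]_x g x.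
Proof.
move=> mg gB; congr fine.
rewrite (ge0_integral_random_walk k (psi := EFin \o g))//; first exact/measurable_EFinP.
by move=> x; rewrite lee_fin; case/andP: (gB x).
Qed.

End walk_law.

Lemma norm_le1D_sqr (R : realDomainType) (b : R) : `|b| <= 1 + b ^+ 2.
Proof. by rewrite -(real_normK (num_real b)); have := sqr_ge0 (`|b| - 1); nra. Qed.

(** The algebra of [lyap_step]: [A1], [A2] stand for [heat], [heat2] at time [t], [A3], [A4] for the
    same at [t + C], [wc] and [IW] for [w] and [P w], [IT] and [IL] for the integrated
    remainders. *)
Lemma lyap_step_arith (R : realFieldType)
  (IT IL IW A1 A2 A3 A4 wc cc C q W V : R) :
  `|A3 - A1 - A2 * C / 2| <= 2 * q ^+ 4 * C ^+ 2 ->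
  `|(A4 - A2) * wc| <= 4 * q ^+ 4 * C * W ->
  `|IT| <= cc -> `|IL| <= 5 * W * q ^+ 3 * (1 + V) ->
  `|A1 + A2 * (wc - IW + C) / 2 + IT + A2 * IW / 2 + IL / 2 - (A3 + A4 * wc / 2)|
  <= cc + 5 * W * (1 + V) * q ^+ 3 + (2 * C ^+ 2 + 2 * W * C) * q ^+ 4.
Proof.
rewrite !ler_norml => /andP[h1 h2] /andP[h3 h4] /andP[h5 h6] /andP[h7 h8].
rewrite (_ : (A1 + _ + _ + _ + _ - _) = IT + IL / 2 - (A3 - A1 - A2 * C / 2) - (A4 - A2) * wc / 2); last by field.
move: (A3 - A1 - A2 * C / 2) ((A4 - A2) * wc) h1 h2 h3 h4 => B1 B2 h1 h2 h3 h4.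
have -> : (2 * C ^+ 2 + 2 * W * C) * q ^+ 4 = 2 * q ^+ 4 * C ^+ 2 + (4 * q ^+ 4 * C * W) / 2 by field.
move: (2 * q ^+ 4 * C ^+ 2) (4 * q ^+ 4 * C * W) h1 h2 h3 h4 => B3 B4 h1 h2 h3 h4.
have -> : 5 * W * (1 + V) * q ^+ 3 = 5 * W * q ^+ 3 * (1 + V) by ring.
move: (5 * W * q ^+ 3 * (1 + V)) h7 h8 => B5 h7 h8.
have : 0 <= B5 by lra.
by move=> ?; apply/andP; split; lra.
Qed.

Lemma telescope_norm_le (R : numDomainType) (g e : nat -> R) n :
  (forall k, (k < n)%N -> `|g k.+1 - g k| <= e k) ->
  `|g n - g 0| <= \sum_(0 <= k < n) e k.
Proof.
move=> ge; rewrite -telescope_sumr//; apply: (le_trans (ler_norm_sum _ _ _)).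
by apply: ler_sum_nat => k /andP[_]; exact: ge.
Qed.

Lemma mart_heat_arith (R : realDomainType) (c w q i h gN g0 s : R) :
  `|gN - g0| <= s -> s <= c * q -> `|g0 - h| <= w * q -> `|i - gN| <= w * q ->
  `|i - h| <= (c + 2 * w) * q.
Proof.
rewrite !ler_norml => /andP[h1 h2] h3 /andP[h4 h5] /andP[h6 h7].
by apply/andP; split; lra.
Qed.

(** * Lindeberg's method *)

Section lindeberg.
Context d (R : realType) (G : compactMetrizableGroupType d R).
Variables (mu nu : probability G R) (a : nat -> R) (S : R).
Hypothesis hmu : haar_probability mu.
Hypothesis a0 : forall k, 0 <= a k.
Hypothesis aS : forall n, \sum_(0 <= k < n) a k <= S.
Hypothesis mixa : forall k, mixes mu (convolution_pow nu k) (a k).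
Variables (f : G -> R) (V0 : R).
Hypothesis mf : measurable_fun setT f.
Hypothesis f2 : L1 mu (fun x => f x ^+ 2).
Hypothesis fV : forall c, (\int[nu]_x (f (c * x)%g ^+ 2)%:E <= V0%:E)%E.
Variables (h : G -> R) (H : R).
Hypothesis mh : measurable_fun setT h.
Hypothesis hH : forall x, `|h x| <= H.
Hypothesis hP : forall c, h c = \int[nu]_x (f (c * x)%g + h (c * x)%g).

Local Notation D := (mdiff f h).
Local Notation v := (mvar nu f h).
Local Notation V := (mvar_bound V0 H).

Let lD c : L1 nu (D c) := L1_mdiff mf fV mh hH c.
Let iD c : \int[nu]_x D c x = 0 := Rint_mdiff mf fV mh hH hP c.
Let lD2 c : L1 nu (fun x => D c x ^+ 2) := L1_mdiff_sqr mf fV mh hH c.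
Let mD : measurable_fun setT (fun p : G * G => D p.1 p.2) := measurable_mdiff mf mh.
Let mDc c : measurable_fun setT (D c). Proof. exact: L1_measurable (lD c). Qed.
Let mv : measurable_fun setT v := measurable_mvar nu mf mh.
Let vV c : v c <= V := mvar_le mf fV mh hH c.
Let v0 c : 0 <= v c := mvar_ge0 nu f h c.

Let aS' : exists S, forall n, \sum_(0 <= k < n) a k <= S. Proof. by exists S. Qed.

Let C := \int[mu]_c v c.

Let lv (m : probability G R) : L1 m v.
Proof.
by apply: (L1_bounded (B := V) _ mv) => c; rewrite ger0_norm.
Qed.

Let C0 : 0 <= C. Proof. by apply: Rintegral_ge0 => c _; exact: v0. Qed.
Let CV : C <= V.
Proof. by rewrite -[leRHS](Rint_cst mu); apply: Rint_le => //; exact: L1_cst. Qed.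

Lemma mvar_bound_ge0 : 0 <= V. Proof. exact: le_trans CV. Qed.

Definition cvar (c : G) := v c - C.

Lemma measurable_cvar : measurable_fun setT cvar.
Proof. exact: measurable_funB. Qed.

Lemma cvar_bounded c : `|cvar c| <= V.
Proof. by rewrite /cvar ler_norml; have := vV c; have := v0 c; have := C0; have := CV; lra. Qed.

Lemma Rint_cvar : \int[mu]_c cvar c = 0.
Proof. by rewrite RintB ?Rint_cst ?subrr//; exact: L1_cst. Qed.

Definition vcorr := potential nu cvar.
Definition vcorr_bound := V * stail a 0.
Local Notation w := vcorr.
Local Notation W := vcorr_bound.

Let mw : measurable_fun setT w :=
  measurable_potential hmu a0 aS' mixa measurable_cvar cvar_bounded Rint_cvar.
Let wW c : `|w c| <= W :=
  potential_bounded hmu a0 aS' mixa measurable_cvar cvar_bounded Rint_cvar c.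
Let wP c : w c = cvar c + \int[nu]_x w (c * x)%g :=
  poisson hmu a0 aS' mixa measurable_cvar cvar_bounded Rint_cvar c.
Let lwc c : L1 nu (fun x => w (c * x)%g) :=
  potential_mull_L1 hmu a0 aS' mixa measurable_cvar cvar_bounded Rint_cvar c.
Let W0 : 0 <= W. Proof. exact: le_trans (wW 1%g). Qed.

(* The first-order effect of the conditional variance [v c] differing from its
   mean [C] is a coboundary, [v - C = w - P w], which the second term absorbs. *)
Definition lyap x t (p : R * G) := heat x p.1 t + heat2 x p.1 t * w p.2 / 2.

(* Bounds the second-order Taylor remainder of [Phi]; interpolating between the
   two exponents gives [|q y| `^ (2 + delta)]. *)
Definition cut (q y : R) := Num.min (2 * (q * y) ^+ 2) (5 * `|q * y| ^+ 3).

Lemma cut_ge0 q y : 0 <= cut q y.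
Proof.
by rewrite /cut le_min; apply/andP; split; rewrite mulr_ge0 ?sqr_ge0 ?exprn_ge0.
Qed.

Let measurable_cut q : measurable_fun setT (cut q).
Proof.
apply: measurable_minr.
  by apply: measurable_funM => //; apply: measurable_funX; exact: measurable_funM.
apply: measurable_funM => //; apply: measurable_funX.
by apply: measurableT_comp => //; exact: measurable_funM.
Qed.

Definition cutm q (c : G) := \int[nu]_x cut q (D c x).

Let lcut q c : L1 nu (fun x => cut q (D c x)).
Proof.
have l : L1 nu (fun x => (2 * q ^+ 2) * D c x ^+ 2) by exact: L1Z.
apply: L1_le l; first exact: measurableT_comp (measurable_cut q) (mDc c).
move=> x; rewrite (ger0_norm (cut_ge0 _ _)) /cut ge_min.
by apply/orP; left; rewrite exprMn mulrA.
Qed.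

Lemma cutm_bound q c : 0 <= cutm q c <= 2 * q ^+ 2 * V.
Proof.
apply/andP; split; first by apply: Rintegral_ge0 => x _; exact: cut_ge0.
apply: (@le_trans _ _ (2 * q ^+ 2 * v c)); last first.
  by rewrite ler_wpM2l// mulr_ge0// sqr_ge0.
rewrite /mvar -RintZ//; apply: Rint_le => //; first exact: L1Z.
by move=> x; rewrite /cut ge_min; apply/orP; left; rewrite exprMn mulrA.
Qed.

Lemma measurable_cutm q : measurable_fun setT (cutm q).
Proof.
apply: (measurable_Rint2 nu (F := fun p : G * G => cut q (D p.1 p.2))).
exact: measurableT_comp (measurable_cut q) mD.
Qed.

Let measurable_heat (x t : R) : measurable_fun setT (fun m => heat x m t).
Proof.
apply: (measurableT_comp (@measurable_ncdf R)).
by apply: measurable_funM => //; exact: measurable_funB.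
Qed.

Let measurable_heat2 (x t : R) : measurable_fun setT (fun m => heat2 x m t).
Proof.
apply: measurable_funM => //.
have mg1 : measurable_fun setT (@gd1 R).
  by apply: measurable_funM; [exact: oppr_measurable|exact: measurable_gd].
apply: (measurableT_comp mg1).
by apply: measurable_funM => //; exact: measurable_funB.
Qed.

Lemma measurable_lyap x t : measurable_fun setT (lyap x t).
Proof.
apply: measurable_funD.
  exact: (measurableT_comp (measurable_heat x t)).
apply: measurable_funM => //; apply: measurable_funM.
  exact: (measurableT_comp (measurable_heat2 x t)).
exact: (measurableT_comp mw).
Qed.

(** Once [v c] is written as [w c - P w c + C], the terms in [P w] cancel and [C] is matched by the
    heat equation over a time [C]. What remains is the Taylor remainder and the variation of
    [heat2], of order [q^3] in space and [q^4] in time. *)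
Lemma lyap_step x t m c : 0 < t ->
  `|\int[nu]_y lyap x t (m + D c y, (c * y)%g) - lyap x (t + C) (m, c)| <=
  cutm (iq t) c + (5 * W * (1 + V)) * iq t ^+ 3 + (2 * C ^+ 2 + 2 * W * C) * iq t ^+ 4.
Proof.
move=> t0; set q := iq t; have q0 : 0 <= q by exact: iq_ge0.
pose z := (x - m) * q.
pose T y := ncdf_taylor z (- D c y * q).
pose L y := (heat2 x (m + D c y) t - heat2 x m t) * w (c * y)%g.
have mT : measurable_fun setT T.
  rewrite (_ : T = fun y => heat x (m + D c y) t - heat x m t
     + gd z * q * D c y - heat2 x m t * D c y ^+ 2 / 2); last first.
    by apply/funext => y; rewrite heat_taylor -/q -/z -/(T y); ring.
  apply: measurable_funB; last first.
    by apply: measurable_funM => //; apply: measurable_funM => //; exact: measurable_funX.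
  apply: measurable_funD; last exact: measurable_funM.
  apply: measurable_funB => //; apply: (measurableT_comp (measurable_heat x t)).
  exact: measurable_funD.
have Tcut y : `|T y| <= cut q (D c y).
  have [h1 h2] := ncdf_taylor_bound z (- D c y * q).
  rewrite le_min; move: h1 h2; rewrite -/(T y) mulNr sqrrN normrN (mulrC (D c y)) => -> ->.
  by [].
have lT : L1 nu T by exact: L1_le (lcut q c).
have mL : measurable_fun setT L.
  apply: measurable_funM; last exact: measurableT_comp mw (measurable_mull c).
  apply: measurable_funB => //; apply: (measurableT_comp (measurable_heat2 x t)).
  exact: measurable_funD.
have LD y : `|L y| <= (5 * W * q ^+ 3) * (1 + D c y ^+ 2).
  rewrite /L normrM; apply: (@le_trans _ _ (5 * (`|D c y| * q ^+ 3) * W)).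
    by rewrite ler_pM// heat2_space.
  rewrite (_ : 5 * _ * W = (5 * W * q ^+ 3) * `|D c y|); last by ring.
  rewrite ler_wpM2l ?(mulr_ge0 (mulr_ge0 _ W0), exprn_ge0)//.
  exact: norm_le1D_sqr.
have lD1 : L1 nu (fun y => (5 * W * q ^+ 3) * (1 + D c y ^+ 2)).
  by apply: L1Z; apply: L1D => //; exact: L1_cst.
have lL : L1 nu L by exact: L1_le lD1.
have IT : `|\int[nu]_y T y| <= cutm q c by exact: Rint_abs_le.
have IL : `|\int[nu]_y L y| <= 5 * W * q ^+ 3 * (1 + V).
  apply: le_trans (Rint_abs_le mL lD1 LD) _.
  rewrite RintZ; last by apply: L1D => //; exact: L1_cst.
  rewrite RintD ?Rint_cst//; last exact: L1_cst.
  by rewrite ler_wpM2l ?(mulr_ge0 (mulr_ge0 _ W0), exprn_ge0)// lerD2l; exact: vV.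
have E : \int[nu]_y lyap x t (m + D c y, (c * y)%g) =
    heat x m t + heat2 x m t * v c / 2 + \int[nu]_y T y
    + heat2 x m t * \int[nu]_y w (c * y)%g / 2 + (\int[nu]_y L y) / 2.
  rewrite (_ : (fun y => lyap _ _ _) = fun y =>
    ((heat x m t + (- (gd z * q)) * D c y) + (heat2 x m t / 2) * D c y ^+ 2) + T y
     + ((heat2 x m t / 2) * w (c * y)%g + 2^-1 * L y)); last first.
    apply/funext => y; rewrite /lyap /= heat_taylor -/q -/z -/(T y) /L.
    move: (heat x m t) (heat2 x m t) (heat2 _ _ t) (w _) (D c y) (gd z) (T y) => *.
    by field.
  have l1 : L1 nu (fun y => heat x m t + (- (gd z * q)) * D c y).
    by apply: L1D; [exact: L1_cst|exact: L1Z].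
  have l2 : L1 nu (fun y => (heat2 x m t / 2) * D c y ^+ 2) by exact: L1Z.
  have l3 : L1 nu (fun y => (heat2 x m t / 2) * w (c * y)%g) by exact: L1Z.
  have l4 : L1 nu (fun y => 2^-1 * L y) by exact: L1Z.
  rewrite RintD; [|by apply: L1D => //; exact: L1D|exact: L1D].
  rewrite RintD//; last exact: L1D.
  rewrite RintD// [X in _ + X]RintD// RintD//; [|exact: L1_cst|exact: L1Z].
  rewrite !RintZ// Rint_cst iD -/(mvar nu f h c).
  move: (\int[nu]_y T y) (\int[nu]_y L y) (\int[nu]_y w _) (v c) (heat x m t) (heat2 x m t) (gd z) => *.
  by field.
have E2 : v c = w c - \int[nu]_y w (c * y)%g + C.
  by rewrite wP /cvar; move: (\int[nu]_y _) (v c) => *; ring.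
have h1 := heat_time x m t0 C0.
have h2 := heat2_time x m t0 C0.
have h3 : `|(heat2 x m (t + C) - heat2 x m t) * w c| <= 4 * q ^+ 4 * C * W.
  by rewrite normrM ler_pM.
rewrite E E2 /lyap /=; rewrite -/q in h1 h2.
by move: h1 h3 IT IL; exact: lyap_step_arith.
Qed.


Variable delta : R.
Hypothesis d01 : 0 < delta <= 1.
Hypothesis lDp : L1 (mu \x nu)%E (fun p : G * G => `|D p.1 p.2| `^ (2 + delta)).

Definition moment := \int[(mu \x nu)%E]_p `|D p.1 p.2| `^ (2 + delta).

Lemma moment_ge0 : 0 <= moment.
Proof. by apply: Rintegral_ge0 => p _; exact: powR_ge0. Qed.

Lemma cut_powR q y : 0 <= q ->
  cut q y <= 5 * q `^ (2 + delta) * `|y| `^ (2 + delta).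
Proof.
move=> q0; rewrite -mulrA -powRM//.
have [dp d1] := andP d01.
rewrite /cut ge_min -(real_normK (num_real (q * y))) normrM (ger0_norm q0).
have : 0 <= q * `|y| by exact: mulr_ge0.
move: (q * `|y|) => b b0.
have [b1|/ltW b1] := leP b 1; apply/orP; [right|left].
  rewrite ler_wpM2l//; move: b0; rewrite le_eqVlt => /predU1P[<-|b0].
    by rewrite expr0n powR_ge0.
  by rewrite -(powR_mulrn 3 (ltW b0)) ger_powR ?b0// ; lra.
apply: (@le_trans _ _ (2 * b `^ (2 + delta))); last by rewrite ler_wpM2r ?powR_ge0// ; lra.
by rewrite ler_wpM2l// -(powR_mulrn 2 b0) ler_powR//; lra.
Qed.

Let lcut2 q : 0 <= q -> L1 (mu \x nu)%E (fun p : G * G => cut q (D p.1 p.2)).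
Proof.
move=> q0; have l := L1Z (5 * q `^ (2 + delta)) lDp.
apply: L1_le l; first exact: measurableT_comp (measurable_cut q) mD.
by move=> p; rewrite ger0_norm ?cut_ge0//; exact: cut_powR.
Qed.

Lemma cutm_haar q : 0 <= q -> \int[mu]_c cutm q c <= 5 * q `^ (2 + delta) * moment.
Proof.
move=> q0.
have lp := lcut2 q0.
rewrite -(Rint_prod12 (F := fun p : G * G => cut q (D p.1 p.2)) lp); last by move=> c; exact: lcut.
rewrite -RintZ//; apply: Rint_le => //; first exact: L1Z.
by move=> p; exact: cut_powR.
Qed.

(** The moment is assumed under [mu \x nu], not under the law of the walk; the passage from one to
    the other is mixing applied to the bounded function [cutm q]. *)
Lemma cutm_pow q k : 0 <= q -> \int[convolution_pow nu k]_c cutm q c <=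
  5 * q `^ (2 + delta) * moment + 2 * q ^+ 2 * V * a k.
Proof.
move=> q0; have cB c : `|cutm q c| <= 2 * q ^+ 2 * V.
  by have /andP[c0 cV] := cutm_bound q c; rewrite ger0_norm.
have := mixa k (measurable_cutm q) cB; have := cutm_haar q0.
rewrite ler_norml => ? /andP[_]; lra.
Qed.

(** The coefficients of [q^(2 + delta)], [q^3] and [q^4] added together: for [t >= 1], [q <= 1] and
    the first power dominates. *)
Definition rate_cst := 5 * moment + 5 * W * (1 + V) + (2 * C ^+ 2 + 2 * W * C).

Let Vge0 : 0 <= V := mvar_bound_ge0.

Lemma rate_cst_ge0 : 0 <= rate_cst.
Proof.
have m1 := moment_ge0; have wv := mulr_ge0 W0 Vge0; have wc := mulr_ge0 W0 C0.
have c2 := sqr_ge0 C; have w1 := W0; rewrite /rate_cst.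
have -> : 5 * moment + 5 * W * (1 + V) + (2 * C ^+ 2 + 2 * W * C) =
  5 * moment + 5 * W + 5 * (W * V) + (2 * C ^+ 2 + 2 * (W * C)) by ring.
by rewrite !addr_ge0// mulr_ge0.
Qed.

Context d' (Omega : measurableType d') (P : probability Omega R).
Variable X : nat -> {RV P >-> G}.
Hypothesis iidX : iid nu X.

Definition mart k (z : Omega) := \sum_(0 <= j < k) D (random_walk X j z) (X j z).

(** The martingale has increments depending on the walk, so only the pair follows a recursion driven
    by the [X k]. *)
Let Y k z := (mart k z, random_walk X k z).
Let Psi (p : (R * G) * G) := (p.1.1 + D p.1.2 p.2, (p.1.2 * p.2)%g).

Let mPsi : measurable_fun setT Psi.
Proof.
have m12 : measurable_fun setT (fun p : (R * G) * G => p.1.2).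
  exact: measurableT_comp measurable_snd measurable_fst.
apply: measurable_fun_pair; last exact: measurable_funMg.
apply: measurable_funD; first exact: measurableT_comp measurable_fst measurable_fst.
apply: (measurableT_comp (f := fun p : G * G => D p.1 p.2) (g := fun p : (R * G) * G => (p.1.2, p.2)) mD).
exact: measurable_fun_pair.
Qed.

Let Y0 z : Y 0 z = (0, 1%g).
Proof. by rewrite /Y /mart big_nil /random_walk big_ord0. Qed.

Let YS k z : Y k.+1 z = Psi (Y k z, X k z).
Proof. by rewrite /Y /mart big_nat_recr//= /random_walk big_ord_recr. Qed.

Let mY k : measurable_fun setT (Y k) := measurable_recursion mPsi Y0 YS k.

Lemma measurable_mart k : measurable_fun setT (mart k).
Proof. exact: (measurableT_comp measurable_fst (mY k)). Qed.

Lemma lyap_heat x t p : `|lyap x t p - heat x p.1 t| <= iq t ^+ 2 * W.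
Proof.
rewrite /lyap addrC addKr -mulrA normrM ler_pM// ?heat2_bounded//.
rewrite normrM; have := wW p.2; have := normr_ge0 (w p.2).
rewrite (@ger0_norm _ 2^-1) ?invr_ge0//; lra.
Qed.

Lemma lyap_bounded x t p : `|lyap x t p| <= 1 + iq t ^+ 2 * W.
Proof.
rewrite -[lyap x t p](subrK (heat x p.1 t)) addrC.
by apply: (le_trans (ler_normD _ _)); rewrite lerD ?heat_bounded ?lyap_heat.
Qed.

Let mlyapY x t k : measurable_fun setT (fun z => lyap x t (Y k z)).
Proof. exact: measurableT_comp (measurable_lyap x t) (mY k). Qed.

Let llyapY x t k : L1 P (fun z => lyap x t (Y k z)).
Proof. by apply: (L1_bounded P (mlyapY x t k)) => z; exact: lyap_bounded. Qed.

Lemma lyap_walk_step x t k : 1 <= t ->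
  `|\int[P]_z lyap x t (Y k.+1 z) - \int[P]_z lyap x (t + C) (Y k z)| <=
  rate_cst * t `^ (- (1 + delta / 2)) + 2 * V * a k * t^-1.
Proof.
move=> t1; have t0 : 0 < t by exact: lt_le_trans t1.
set q := iq t; have q0 : 0 <= q by exact: iq_ge0.
set b := (5 * W * (1 + V)) * q ^+ 3 + (2 * C ^+ 2 + 2 * W * C) * q ^+ 4.
pose F z := \int[nu]_y lyap x t (Psi (Y k z, y)).
pose A := \int[P]_z lyap x t (Y k.+1 z).
have EA : A = \int[P]_z F z :=
  recursion_Rint iidX mPsi Y0 YS k (measurable_lyap x t) (lyap_bounded x t).
change (`|A - \int[P]_z lyap x (t + C) (Y k z)| <=
  rate_cst * t `^ (- (1 + delta / 2)) + 2 * V * a k * t^-1); rewrite EA; clear A EA.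
have mF : measurable_fun setT F.
  apply: (measurable_Rint2 nu (F := fun p : Omega * G => lyap x t (Psi (Y k p.1, p.2)))).
  apply: (measurableT_comp (measurable_lyap x t)); apply: (measurableT_comp mPsi).
  by apply: measurable_fun_pair => //; exact: measurableT_comp (mY k) measurable_fst.
have lF : L1 P F.
  apply: (L1_bounded P mF (B := 1 + iq t ^+ 2 * W)) => z; apply: Rint_bounded => //.
    apply: (measurableT_comp (measurable_lyap x t)).
    exact: (measurable_fun_pair2 (Y k z) mPsi).
  by move=> y; exact: lyap_bounded.
have mc : measurable_fun setT (fun z => cutm q (random_walk X k z)).
  exact: measurableT_comp (measurable_cutm q) (measurable_random_walk X k).
have lc : L1 P (fun z => cutm q (random_walk X k z)).
  apply: (L1_bounded P mc (B := 2 * q ^+ 2 * V)) => z.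
  by have /andP[c0 cV] := cutm_bound q (random_walk X k z); rewrite ger0_norm.
rewrite -RintB//.
apply: (@le_trans _ _ (\int[P]_z (cutm q (random_walk X k z) + b))).
  apply: Rint_abs_le.
  - exact: measurable_funB.
  - by apply: L1D => //; exact: L1_cst.
  - by move=> z; rewrite /b addrA; exact: lyap_step.
rewrite RintD//; last exact: L1_cst.
rewrite Rint_cst (Rint_random_walk iidX k (measurable_cutm q) (cutm_bound q)).
have hq := cutm_pow k q0.
have eq : q `^ (2 + delta) = t `^ (- (1 + delta / 2)).
  by rewrite iq_powR//; congr (_ `^ _); field.
have [dp d1] := andP d01.
have q1 : q <= 1 by rewrite -[leRHS]invr1 -sqrtr1; exact: iq_le.
have qq : 0 < q by rewrite invr_gt0 sqrtr_gt0.
have q3 : q ^+ 3 <= q `^ (2 + delta).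
  by rewrite -(powR_mulrn 3 q0) ger_powR ?qq//; lra.
have q4 : q ^+ 4 <= q `^ (2 + delta).
  by rewrite -(powR_mulrn 4 q0) ger_powR ?qq//; lra.
have e2 : q ^+ 2 = t^-1 by rewrite iq_sqr// ltW.
apply: (@le_trans _ _ (5 * q `^ (2 + delta) * moment + 2 * t^-1 * V * a k +
   (5 * W * (1 + V) * q `^ (2 + delta) + (2 * C ^+ 2 + 2 * W * C) * q `^ (2 + delta)))).
  rewrite lerD//; first by rewrite -e2.
  apply: lerD; rewrite ler_wpM2l//.
    by apply: mulr_ge0; [apply: mulr_ge0 W0|apply: addr_ge0 Vge0].
  rewrite -mulrA; apply: addr_ge0; apply: mulr_ge0 => //; first exact: sqr_ge0.
  exact: mulr_ge0 W0 C0.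
rewrite -eq /rate_cst; move: (q `^ _) => Q.
rewrite le_eqVlt; apply/orP; left; apply/eqP; ring.
Qed.

(** Time runs down from [t + C * N] to [t], by [C] per step. One-step errors add up by [sum_powR_le]
    and by summability of [a]; the two terms in [W] remove the correction by [w] at the first and
    last times. *)
Lemma mart_heat x t N : 1 <= t -> 0 < C ->
  `|\int[P]_z heat x (mart N z) t - heat x 0 (t + C * N%:R)| <=
  (rate_cst * (1 + (delta / 2 * C)^-1) + 2 * V * S + 2 * W) * t `^ (- (delta / 2)).
Proof.
move=> t1 Cp; have t0 : 0 < t by exact: lt_le_trans t1.
have [dp dl1] := andP d01.
have CN n : 0 <= C * n%:R by exact: mulr_ge0.
pose g k := \int[P]_z lyap x (t + C * (N - k)%:R) (Y k z).
pose e k := rate_cst * (t + C * (N - k.+1)%:R) `^ (- (1 + delta / 2)) + 2 * V * a k * t^-1.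
have step k : (k < N)%N -> `|g k.+1 - g k| <= e k.
  move=> kN; have tk : t <= t + C * (N - k.+1)%:R by rewrite lerDl.
  have st := lyap_walk_step x k (le_trans t1 tk).
  have tC : t + C * (N - k.+1)%:R + C = t + C * (N - k)%:R.
    by rewrite -(subnSK kN) -natr1; ring.
  rewrite tC in st; apply: (le_trans st); rewrite lerD2l.
  apply: ler_wpM2l; first by apply: mulr_ge0 (a0 k); exact: mulr_ge0.
  by rewrite lef_pV2 ?posrE// (lt_le_trans t0).
have gN : `|g N - g 0| <= \sum_(0 <= k < N) e k by exact: telescope_norm_le.
have tinv : t^-1 <= t `^ (- (delta / 2)).
  by rewrite -(powR_inv1 (ltW t0)); apply: ler_powR => //; lra.
have esum : \sum_(0 <= k < N) e k <=
    (rate_cst * (1 + (delta / 2 * C)^-1) + 2 * V * S) * t `^ (- (delta / 2)).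
  rewrite big_split /= -mulr_sumr -mulr_suml -mulr_sumr [leRHS]mulrDl.
  rewrite -(mulrA rate_cst); apply: lerD; [apply: ler_wpM2l|apply: ler_pM].
  - exact: rate_cst_ge0.
  - rewrite big_nat_rev/= add0n.
    rewrite (eq_big_nat _ _ (F2 := fun k => (t + C * k%:R) `^ (- (1 + delta / 2)))).
      by apply: sum_powR_le => //; lra.
    by move=> k /andP[_ kN]; rewrite subnSK ?subKn// ltnW.
  - by apply: mulr_ge0; [exact: mulr_ge0|exact: sumr_ge0].
  - by rewrite invr_ge0 ltW.
  - by apply: ler_wpM2l => //; exact: mulr_ge0.
  - exact: tinv.
have g0 : `|g 0 - heat x 0 (t + C * N%:R)| <= W * t `^ (- (delta / 2)).
  have -> : g 0 = lyap x (t + C * N%:R) (0, 1%g).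
    apply: etrans (Rint_cst P _); rewrite /g subn0.
    by apply: eq_Rintegral => z _; rewrite Y0.
  apply: (le_trans (lyap_heat x _ _)); rewrite mulrC; apply: ler_wpM2l => //.
  apply: le_trans tinv; rewrite iq_sqr ?addr_ge0 ?(ltW t0)//.
  by rewrite lef_pV2 ?posrE// ?ltr_wpDr// lerDl.
have gM : `|\int[P]_z heat x (mart N z) t - g N| <= W * t `^ (- (delta / 2)).
  have lh : L1 P (fun z => heat x (mart N z) t).
    apply: (L1_bounded P (B := 1)); last by move=> z; exact: heat_bounded.
    exact: measurableT_comp (measurable_heat x t) (measurable_mart N).
  rewrite /g subnn mulr0 addr0 distrC -RintB//.
  apply: (Rint_bounded P); first by apply: measurable_funB => //; exact: L1_measurable lh.
  move=> z; apply: (le_trans (lyap_heat x t (Y N z))); rewrite mulrC; apply: ler_wpM2l => //.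
  by rewrite iq_sqr ?(ltW t0).
exact: mart_heat_arith gN esum g0 gM.
Qed.

(** Increments are orthogonal, so the k-th one adds the mean of [v] at [S_k], which mixing bounds by
    [C + V * a k]. *)
Lemma mart_sqr N : (\int[P]_z (mart N z ^+ 2)%:E <= (C * N%:R + V * S)%:E)%E.
Proof.
suff h1 : (\int[P]_z (mart N z ^+ 2)%:E <=
    (C * N%:R + V * \sum_(0 <= k < N) a k)%:E)%E.
  apply: (le_trans h1); rewrite lee_fin lerD2l; apply: ler_wpM2l => //.
have mm k : measurable_fun setT (fun z => (mart k z ^+ 2)%:E).
  by apply/measurable_EFinP; apply: measurable_funX; exact: measurable_mart.
elim: N => [|k IH].
  rewrite (_ : (fun z => (mart 0 z ^+ 2)%:E) = cst 0%E).
    by rewrite integral_probability_cst big_nil !mulr0 addr0.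
  by apply/funext => z; rewrite /mart big_nil expr0n.
pose psi (p : R * G) := (p.1 ^+ 2)%:E.
have mpsi : measurable_fun setT psi.
  by apply/measurable_EFinP; apply: measurable_funX; exact: measurable_fst.
have E : (\int[P]_z (mart k.+1 z ^+ 2)%:E =
    \int[P]_z \int[nu]_y psi (Psi (Y k z, y)))%E.
  apply: (recursion_ge0_integral iidX mPsi Y0 YS k mpsi).
  by move=> p; rewrite lee_fin sqr_ge0.
have E2 z : (\int[nu]_y psi (Psi (Y k z, y)) =
    (mart k z ^+ 2)%:E + (v (random_walk X k z))%:E)%E.
  rewrite /psi /Psi /=; move: (mart k z) (random_walk X k z) => m c.
  have l1 : L1 nu (fun y => m ^+ 2 + (2 * m) * D c y).
    by apply: L1D; [exact: L1_cst|exact: L1Z].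
  rewrite -EFinD -[v c]add0r -(mulr0 (2 * m)) -(iD c) -RintZ// addrA.
  rewrite -{1}(Rint_cst nu (m ^+ 2)) -RintD//; [|exact: L1_cst|exact: L1Z].
  rewrite -RintD// EFin_Rint; last exact: L1D.
  by apply: eq_integral => y _; congr EFin; ring.
rewrite E; under eq_integral do rewrite E2.
rewrite ge0_integralD//=; last 3 first.
- by move=> z _; rewrite lee_fin sqr_ge0.
- by move=> z _; rewrite lee_fin v0.
- apply/measurable_EFinP.
  exact: measurableT_comp mv (measurable_random_walk X k).
rewrite (ge0_integral_random_walk iidX k (psi := EFin \o v)); last 2 first.
- exact/measurable_EFinP.
- by move=> c; rewrite lee_fin v0.
rewrite -(EFin_Rint (lv (convolution_pow nu k))).
have vb c : `|v c| <= V by rewrite ger0_norm.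
have := mixa k mv vb; rewrite -/C ler_norml => /andP[_ hk].
have -> : C * k.+1%:R + V * \sum_(0 <= j < k.+1) a j =
    (C * k%:R + V * \sum_(0 <= j < k) a j) + (C + V * a k).
  by rewrite big_nat_recr//= -natr1; ring.
rewrite EFinD; apply: leeD => //; rewrite lee_fin; move: hk.
by move: (\int[_]_x _) => *; lra.
Qed.

End lindeberg.

(** * Smoothing of normalized sums *)

Section scaling.
Context d (T : measurableType d) (R : realType) (P : probability T R).
Variables (Z M : T -> R) (s t B E : R).
Hypothesis mZ : measurable_fun setT Z.
Hypothesis mM : measurable_fun setT M.
Hypothesis t0 : 0 < t.
Hypothesis ts : t <= s.
Hypothesis ZM : forall z, `|Z z - M z| <= B.
Hypothesis hE : forall x, `|\int[P]_z heat x (M z) t - heat x 0 (t + s)| <= E.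
Local Notation eta := (Num.sqrt (t / s)).

Let s0 : 0 < s := lt_le_trans t0 ts.
Let eta1 : eta <= 1.
Proof. by rewrite -[leRHS]sqrtr1 ler_wsqrtr// ler_pdivrMr// mul1r. Qed.
Let eta0 : 0 < eta. Proof. by rewrite sqrtr_gt0 divr_gt0. Qed.

(** Raising the variance from [s] to [s + t] changes the distribution function by [O(t / s)], that
    is [O(eta^2)], by the heat equation from time [s]; as [eta <= 1] this is at most [3 * eta]. *)
Let Phi_spread x : `|heat (x * Num.sqrt s) 0 (t + s) - std_normal_cdf x| <= 3 * eta.
Proof.
have e2 : eta ^+ 2 = t / s by rewrite sqr_sqrtr// divr_ge0// ltW.
have ss : Num.sqrt s != 0 by rewrite gt_eqF// sqrtr_gt0.
have -> : std_normal_cdf x = heat (x * Num.sqrt s) 0 s.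
  by rewrite /heat subr0 /iq mulfK.
set X := x * _.
have h1 := heat_time X 0 s0 (ltW t0); have h2 := heat2_bounded X 0 s.
rewrite iq_sqr ?(ltW s0)// in h2.
have e4 : 2 * iq s ^+ 4 * t ^+ 2 = 2 * eta ^+ 4.
  have -> : iq s ^+ 4 = s^-1 ^+ 2 by rewrite -(iq_sqr (ltW s0)) -exprM.
  have -> : eta ^+ 4 = (t / s) ^+ 2 by rewrite (exprM eta 2 2) e2.
  by move: s^-1 => r; ring.
have h3 : `|heat2 X 0 s * t| <= eta ^+ 2.
  by rewrite normrM (gtr0_norm t0) e2 mulrC; apply: ler_wpM2l => //; exact: ltW.
rewrite e4 in h1; rewrite (addrC t s); move: h1 h3 (ltW eta0) eta1.
move: (heat X 0 (s + t)) (heat X 0 s) (heat2 X 0 s * t) => A1 A2 A3.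
move: eta => e; rewrite !ler_norml => /andP[h3 h4] /andP[h5 h6] e0 e1.
have e22 : e ^+ 2 <= e by rewrite expr2 ler_piMl.
have e44 : e ^+ 4 <= e.
  by rewrite (exprM e 2 2); apply: le_trans (e22); rewrite expr2 ler_piMl ?sqr_ge0// (le_trans e22).
by apply/andP; split; lra.
Qed.

Lemma scaled_smoothing x :
  `|below P (fun z => Z z / Num.sqrt s) x - std_normal_cdf x| <=
  2 * (E + B * iq t + 3 * eta) + (10 + 10 * abs_gaussian R) * eta.
Proof.
apply: smoothing eta0 _ x => [|x]; first exact: measurable_funM.
have ss : 0 < Num.sqrt s by rewrite sqrtr_gt0.
have tt : 0 < Num.sqrt t by rewrite sqrtr_gt0.
(* The width [eta] for the normalized sum is the width [sqrt t] for the sum itself, which is the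
   time at which the heat estimate stops. *)
have e z : (x - Z z / Num.sqrt s) / eta = (x * Num.sqrt s - Z z) * iq t.
  rewrite sqrtrM ?(ltW t0)// sqrtrV ?(ltW s0)// /iq; field.
  by rewrite !gt_eqF.
under eq_Rintegral do rewrite e.
set X := x * _.
have mh (F : T -> R) : measurable_fun setT F -> measurable_fun setT (fun z => heat X (F z) t).
  move=> mF; apply: (measurableT_comp (@measurable_ncdf R)).
  by apply: measurable_funM => //; exact: measurable_funB.
have lh (F : T -> R) : measurable_fun setT F -> L1 P (fun z => heat X (F z) t).
  move=> mF; apply: (L1_bounded P (mh _ mF) (B := 1)) => z; exact: heat_bounded.
have h1 : `|\int[P]_z heat X (Z z) t - \int[P]_z heat X (M z) t| <= B * iq t.
  rewrite -RintB; [|exact: lh|exact: lh].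
  apply: Rint_bounded; first by apply: measurable_funB; exact: mh.
  move=> z; apply: (le_trans (ncdf_lip _ _)).
  rewrite -mulrBl normrM (ger0_norm (iq_ge0 t)) ler_wpM2r ?iq_ge0//.
  by rewrite distrC (_ : _ - _ = Z z - M z)//; ring.
have h2 := hE X; have := Phi_spread x; rewrite -/X.
move: h1 h2; move: (\int[P]_z heat X (Z z) t) (\int[P]_z heat X (M z) t) => A1 A2.
change (`|A1 - A2| <= B * iq t -> `|A2 - heat X 0 (t + s)| <= E ->
  `|heat X 0 (t + s) - std_normal_cdf x| <= 3 * eta ->
  `|A1 - std_normal_cdf x| <= E + B * iq t + 3 * eta).
move: (B * iq t) (heat X 0 (t + s)) (3 * eta) => B1 A3 B2.
rewrite !ler_norml => /andP[? ?] /andP[? ?] /andP[? ?].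
by apply/andP; split; lra.
Qed.

End scaling.

(** Each martingale increment carries the increment of [h] along the walk, and these telescope. *)
Lemma sum_random_walk d (R : realType) (G : compactMetrizableGroupType d R)
    d' (Omega : measurableType d') (P : probability Omega R)
    (X : nat -> {RV P >-> G}) (f h : G -> R) N z :
  \sum_(1 <= k < N.+1) f (random_walk X k z) =
  mart f h X N z + h 1%g - h (random_walk X N z).
Proof.
elim: N => [|N IH].
  by rewrite /mart !big_nil /random_walk big_ord0; ring.
rewrite big_nat_recr//= IH /mart [in RHS]big_nat_recr//= /mdiff.
have -> : random_walk X N.+1 z = (random_walk X N z * X N z)%g by exact: big_ord_recr.
move: (\sum_(_ <= _ < _) _) (f _) (h _) (h _) (h 1%g) => *; ring.
Qed.

(** * Limit theorem *)

Section moments.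
Context d (R : realType) (G : compactMetrizableGroupType d R).
Variables (mu nu : probability G R).
Hypothesis hmu : haar_probability mu.
Variables (f h : G -> R) (H r : R).
Hypothesis mf : measurable_fun setT f.
Hypothesis mh : measurable_fun setT h.
Hypothesis hH : forall x, `|h x| <= H.
Hypothesis r0 : 0 < r.
Hypothesis lfr : L1 mu (fun x => `|f x| `^ r).

Lemma powR_addr_le (x y : R) : 0 <= x -> 0 <= y ->
  (x + y) `^ r <= 2 `^ r * (x `^ r + y `^ r).
Proof.
move=> x0 y0; wlog xy : x y x0 y0 / x <= y.
  move=> W; have [xy|/ltW yx] := leP x y; first exact: W.
  by rewrite addrC [X in _ * X]addrC; exact: W.
apply: (@le_trans _ _ ((2 * y) `^ r)).
  by apply: ge0_ler_powR; rewrite ?nnegrE ?mulr_ge0 ?addr_ge0 ?(ltW r0)//; lra.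
by rewrite powRM// ler_wpM2l ?powR_ge0// lerDr powR_ge0.
Qed.

Lemma L1_mdiff_powR :
  L1 (mu \x nu)%E (fun p : G * G => `|mdiff f h p.1 p.2| `^ r).
Proof.
have H0 : 0 <= H by exact: le_trans (hH 1%g).
have l1 := L1_haar_mul hmu nu lfr.
have l2 : L1 (mu \x nu)%E (fun p : G * G =>
    2 `^ r * (`|f (p.1 * p.2)%g| `^ r + (2 * H) `^ r)).
  by apply: L1Z; apply: L1D; [exact: l1|exact: L1_cst].
apply: L1_le l2.
  apply: (measurableT_comp (measurable_powR r)); apply: measurableT_comp => //.
  exact: measurable_mdiff.
move=> [c x] /=; rewrite ger0_norm ?powR_ge0//.
apply: le_trans (powR_addr_le _ _); [|exact: normr_ge0|exact: mulr_ge0].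
apply: ge0_ler_powR; rewrite ?nnegrE ?(ltW r0)//; first by rewrite addr_ge0// mulr_ge0.
rewrite /mdiff -addrA; apply: (le_trans (ler_normD _ _)); rewrite lerD2l.
apply: (le_trans (ler_normB _ _)); have := hH (c * x)%g; have := hH c; lra.
Qed.

End moments.

Lemma sqr_near (R : realDomainType) (x m b : R) :
  `|x - m| <= 2 * b -> x ^+ 2 <= 2 * m ^+ 2 + 8 * b ^+ 2.
Proof.
move=> h; have h2 : (x - m) ^+ 2 <= (2 * b) ^+ 2.
  rewrite -(real_normK (num_real (x - m))) ler_sqr ?nnegrE//.
  exact: le_trans h.
by have := sqr_ge0 (x - 2 * m); move: h2; nra.
Qed.

Section limit_theorem.
Context d (R : realType) (G : compactMetrizableGroupType d R).
Variables (mu nu : probability G R) (a : nat -> R) (S : R).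
Hypothesis hmu : haar_probability mu.
Hypothesis a0 : forall k, 0 <= a k.
Hypothesis aS : forall n, \sum_(0 <= k < n) a k <= S.
Hypothesis mixa : forall k, mixes mu (convolution_pow nu k) (a k).
Variables (f : G -> R) (V0 delta : R).
Hypothesis mf : measurable_fun setT f.
Hypothesis f0 : \int[mu]_x f x = 0.
Hypothesis f2 : L1 mu (fun x => f x ^+ 2).
Hypothesis fV : forall c, (\int[nu]_x (f (c * x)%g ^+ 2)%:E <= V0%:E)%E.

Let aS' : exists S, forall n, \sum_(0 <= k < n) a k <= S. Proof. by exists S. Qed.

Local Notation h := (corrector nu f).
Local Notation H := (corrector_bound a V0).
Local Notation C := (asymptotic_variance mu nu f).

Let mh : measurable_fun setT h := measurable_corrector hmu a0 aS' mixa mf f0 f2 fV.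
Let hH c : `|h c| <= H := corrector_le hmu a0 aS' mixa mf f0 f2 fV c.
Let hP c : h c = \int[nu]_x (f (c * x)%g + h (c * x)%g) :=
  corrector_poisson hmu a0 aS' mixa mf f0 f2 fV c.
Let H0 : 0 <= H. Proof. exact: le_trans (hH 1%g). Qed.

Lemma asymptotic_variance_mvar : C = \int[mu]_c mvar nu f h c.
Proof.
rewrite (asymptotic_varianceE hmu a0 aS' mixa mf f0 f2 fV).
by rewrite (Rint_mvar hmu mf f2 fV mh hH hP).
Qed.

(** Contrapositively, [C > 0] forces the norm of [f] to be positive, which makes [K] positive. *)
Lemma asymptotic_variance_ae0 : ae_eq mu setT f (cst 0) -> C = 0.
Proof.
move=> fae; rewrite (asymptotic_varianceE hmu a0 aS' mixa mf f0 f2 fV).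
have z (g : G -> R) : measurable_fun setT g -> (forall x, f x = 0 -> g x = 0) ->
    \int[mu]_x g x = 0.
  move=> mg fg; rewrite -[RHS](Rint_cst mu); congr fine.
  apply: ae_eq_integral => //; first exact/measurable_EFinP.
  by apply: filterS fae => x /= fx _; rewrite fg// fx.
have mff : measurable_fun setT (fun x => f x ^+ 2) by exact: measurable_funX.
have mfh : measurable_fun setT (fun x => f x * h x) by exact: measurable_funM.
rewrite (z _ mff) ?(z _ mfh) ?mulr0 ?addr0//; first by move=> x ->; rewrite mul0r.
by move=> x ->; rewrite expr0n.
Qed.

Section walk.
Context d' (Omega : measurableType d') (P : probability Omega R).
Variable X : nat -> {RV P >-> G}.
Hypothesis iidX : iid nu X.
Local Notation Z N z := (\sum_(1 <= k < N.+1) f (random_walk X k z)).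

Let mZ N : measurable_fun setT (fun z => Z N z).
Proof.
apply: measurable_sum => k; apply: (measurableT_comp mf).
exact: measurable_random_walk.
Qed.

Let ZM N z : `|Z N z - mart f h X N z| <= 2 * H.
Proof.
rewrite (sum_random_walk X f h).
rewrite (_ : _ - mart f h X N z = h 1%g - h (random_walk X N z)); last first.
  by move: (mart _ _ _ _ _) (h _) (h _) => *; ring.
by apply: (le_trans (ler_normB _ _)); rewrite mulr_natl mulr2n lerD.
Qed.

Lemma walk_sum_L2 N :
  (\int[P]_z (Z N z ^+ 2)%:E <=
   (2 * (C * N%:R + mvar_bound V0 H * S) + 8 * H ^+ 2)%:E)%E.
Proof.
have mM : measurable_fun setT (mart f h X N) := measurable_mart mf mh X N.
have M2 := mart_sqr aS mixa mf fV mh hH hP iidX N.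
rewrite -asymptotic_variance_mvar in M2.
apply: (@le_trans _ _ (\int[P]_z ((2%:E * (mart f h X N z ^+ 2)%:E) + (8 * H ^+ 2)%:E))%E).
  apply: ge0_le_integral => //.
  - by move=> z _; rewrite lee_fin sqr_ge0.
  - by apply/measurable_EFinP; apply: measurable_funX; exact: mZ.
  - apply/measurable_EFinP; apply: measurable_funD => //.
    by apply: measurable_funM => //; exact: measurable_funX.
  - move=> z _; rewrite -EFinM -EFinD lee_fin.
    exact: sqr_near (ZM N z).
rewrite ge0_integralD//; last 3 first.
- by move=> z _; rewrite -EFinM lee_fin mulr_ge0// sqr_ge0.
- apply/measurable_EFinP; apply: measurable_funM => //; exact: measurable_funX.
- by move=> z _; rewrite lee_fin mulr_ge0// sqr_ge0.
rewrite ge0_integralZl//; last 2 first.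
- by apply/measurable_EFinP; exact: measurable_funX.
- by move=> z _; rewrite lee_fin sqr_ge0.
rewrite integral_probability_cst [leRHS]EFinD; apply: leeD => //.
by rewrite EFinM; apply: lee_wpmul2l.
Qed.

Lemma walk_clt N x : 0 < delta <= 1 -> L1 mu (fun x => `|f x| `^ (2 + delta)) ->
  0 < C -> (0 < N)%N -> 1 <= C * N%:R `^ (1 / (1 + delta)) ->
  `|below P (fun z => Z N z / Num.sqrt (C * N%:R)) x - std_normal_cdf x| <=
  (2 * ((rate_cst mu nu a f V0 h H delta * (1 + (delta / 2 * C)^-1)
     + 2 * mvar_bound V0 H * S + 2 * vcorr_bound a V0 H + 2 * H) * C `^ (- (delta / 2)) + 3)
   + (10 + 10 * abs_gaussian R)) * (N%:R `^ (delta / (2 + 2 * delta)))^-1.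
Proof.
move=> d01 lf C0 N0 t1; have [dp d1] := andP d01.
(* This choice balances the Lindeberg error, of order [t^(- delta / 2)], against the smoothing width
   [sqrt (t / s)]: both become constant multiples of [b]. *)
set t := C * _ in t1; have t0 : 0 < t by exact: lt_le_trans t1.
have n1 : 1 <= N%:R :> R by rewrite ler1n.
have n0 : 0 < N%:R :> R by rewrite ltr0n.
have d2 : 1 + delta != 0 by rewrite gt_eqF// addr_gt0.
set s := C * N%:R; set b := (N%:R `^ (delta / (2 + 2 * delta)))^-1.
have ts : t <= s.
  rewrite /t /s ler_pM2l// -[leRHS]powRr1 ?(ltW n0)//; apply: ler_powR => //.
  by rewrite ler_pdivrMr ?addr_gt0//; lra.
have eta : Num.sqrt (t / s) = b.
  have -> : t / s = N%:R `^ (1 / (1 + delta) - 1).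
    rewrite powRB ?(gt_eqF n0) ?implybT// powRr1 ?(ltW n0)// /t /s.
    by rewrite -mulf_div divff ?gt_eqF// mul1r.
  rewrite -powR12_sqrt ?powR_ge0// -powRrM.
  rewrite /b -powRN; congr (_ `^ _); field.
  by rewrite (_ : 2 + 2 * delta = 2 * (1 + delta)) ?mulf_neq0//; ring.
have tb : t `^ (- (delta / 2)) = C `^ (- (delta / 2)) * b.
  rewrite /t powRM ?(ltW C0) ?powR_ge0//; congr (_ * _).
  rewrite -powRrM /b -powRN; congr (_ `^ _); field.
  by rewrite (_ : 2 + 2 * delta = 2 * (1 + delta)) ?mulf_neq0//; ring.
have r0 : 0 < 2 + delta by exact: addr_gt0.
have lDp := L1_mdiff_powR nu hmu mf mh hH r0 lf.
have C0' : 0 < \int[mu]_c mvar nu f h c by rewrite -asymptotic_variance_mvar.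
have hE y := mart_heat hmu a0 aS mixa mf fV mh hH hP d01 lDp iidX y N t1 C0'.
rewrite -asymptotic_variance_mvar -/s in hE.
have := scaled_smoothing (mZ N) (measurable_mart mf mh X N) t0 ts (ZM N) hE x.
move=> /le_trans; apply; rewrite eta tb.
have iqt : iq t <= C `^ (- (delta / 2)) * b.
  rewrite -tb /iq -powR12_sqrt ?(ltW t0)// -powRN; apply: ler_powR => //; lra.
have : 2 * H * iq t <= 2 * H * (C `^ (- (delta / 2)) * b).
  by apply: ler_wpM2l => //; exact: mulr_ge0.
move: (rate_cst _ _ _ _ _ _ _ _ * _ + _ + _) (2 * H * iq t) (2 * H).
move: (C `^ _) (abs_gaussian R) (b) => Cd ag bb K u H2 hu; lra.
Qed.

End walk.
End limit_theorem.

Lemma powR_large (R : realType) (e b : R) : 0 < e ->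
  exists x0 : R, forall x, x0 <= x -> b <= x `^ e.
Proof.
move=> e0; exists (`|b| `^ e^-1) => x bx.
apply: (le_trans (ler_norm b)).
rewrite -[leLHS]powRr1// -(@mulVf _ e) ?gt_eqF// powRrM.
by apply: ge0_ler_powR; rewrite ?nnegrE ?powR_ge0 ?(ltW e0)// (le_trans _ bx)// powR_ge0.
Qed.

Lemma rate_threshold (R : realType) (C K B e1 e2 : R) :
  0 < C -> 0 < K -> 0 < e1 -> 0 < e2 ->
  exists N0 : nat, forall N, (N0 <= N)%N ->
    [/\ (0 < N)%N, 1 <= C * N%:R `^ e1 & B <= K * ln N%:R `^ e2].
Proof.
move=> C0 K0 e10 e20.
have [x1 h1] := powR_large C^-1 e10; have [x2 h2] := powR_large (B / K) e20.
pose y := Num.max x1 (expR x2).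
have yN N : ((Num.trunc y).+1 <= N)%N -> y < N%:R.
  by move=> h; apply: lt_le_trans (truncnS_gt y) _; rewrite ler_nat.
exists (Num.trunc y).+1 => N hN; have := yN N hN; rewrite gt_max => /andP[/ltW n1 n2].
have Np : (0 < N)%N by exact: leq_trans hN.
split => //.
  by rewrite -ler_pdivrMl// mulr1; exact: h1.
rewrite -ler_pdivrMl// mulrC; apply: h2.
rewrite -(expRK x2) ler_ln ?posrE ?expR_gt0 ?ltr0n//; exact: ltW.
Qed.

Section mixing_constant.
Context d (R : realType) (G : compactMetrizableGroupType d R).
Variables (mu nu : probability G R) (a : nat -> R).
Hypothesis a0 : forall k, 0 <= a k.
Hypothesis aS : exists S, forall n, \sum_(0 <= k < n) a k <= S.
Hypothesis mixa : forall k, mixes mu (convolution_pow nu k) (a k).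

Lemma tv_distance_mixes (m : probability G R) b : mixes mu m b ->
  0 <= tv_distance m mu <= 2 * b.
Proof.
move=> mb; rewrite /tv_distance; set A := [set _ | _ in _].
have A0 : A 0 by exists set0; rewrite ?measure0 ?subrr ?normr0.
have Ab x : A x -> x <= b.
  move=> [B mB <-]; rewrite -[leRHS]mul1r.
  have e (Q : probability G R) : fine (Q B) = \int[Q]_x (\1_B x : R).
    by rewrite /Rintegral integral_indic// setIT.
  rewrite !e; apply: mb => // y; rewrite indicE; case: (_ \in _); rewrite ?normr1 ?normr0//.
have nA : A !=set0 by exists 0.
apply/andP; split.
  by rewrite mulr_ge0//; apply: ub_le_sup => //; exists b.
by rewrite ler_wpM2l//; apply: ge_sup.
Qed.

(** Serves the positivity of [K]. Convergence of the series has to be established first, since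
    [limn] of a divergent sequence is only a default value. *)
Lemma mixing_constant_ge1 : 1 <= mixing_constant mu nu.
Proof.
rewrite /mixing_constant lerDl mulr_ge0//.
have [S hS] := aS.
pose t k := tv_distance (convolution_pow nu k.+1) mu.
have tb k : 0 <= t k <= 2 * a k.+1 by exact: tv_distance_mixes.
have t0 k : 0 <= t k by case/andP: (tb k).
apply: limr_ge; last by apply: nearW => n; rewrite seriesEnat; apply: sumr_ge0 => k _; exact: t0.
apply: cvg_series_a => //; exists (2 * S) => n.
apply: (@le_trans _ _ (\sum_(0 <= k < n) 2 * a k.+1)).
  by apply: ler_sum => k _; case/andP: (tb k).
rewrite -mulr_sumr ler_wpM2l//; apply: le_trans (hS n.+1).
by rewrite big_nat_recl//= lerDr.
Qed.

End mixing_constant.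

Lemma Lnorm2_cvg0 d (T : measurableType d) (R : realType) (P : probability T R)
    (Z : nat -> T -> R) (Q : R) :
  (forall N, \int[P]_z (Z N z ^+ 2)%:E <= Q%:E)%E ->
  (forall N, measurable_fun setT (Z N)) ->
  (fun N : nat => 'N[P]_2%:E [EFin \o (fun w => ((Num.sqrt N%:R)^-1 * Z N w)%R)])%E
    @ \oo --> 0%E.
Proof.
move=> ZQ mZ.
have Q0 : 0 <= Q.
  by rewrite -lee_fin; apply: le_trans (ZQ 0); apply: integral_ge0 => z _; rewrite lee_fin sqr_ge0.
(* At [N = 0] the convention that the inverse of 0 is 0 makes both sides vanish. *)
have bound N : ('N[P]_2%:E [EFin \o (fun w => ((Num.sqrt N%:R)^-1 * Z N w)%R)] <=
    (Num.sqrt (Q * N%:R^-1))%:E)%E.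
  have -> : (Num.sqrt (Q * N%:R^-1))%:E = ((Q * N%:R^-1)%:E `^ 2^-1)%E.
    by rewrite poweR_EFin powR12_sqrt// divr_ge0.
  rewrite unlock.
  apply: gt0_ler_poweR; rewrite ?invr_ge0 ?in_itv/= ?leey ?andbT//.
  - by apply: integral_ge0 => z _; rewrite lee_fin powR_ge0.
  - by rewrite lee_fin divr_ge0.
  under eq_integral => z _.
    rewrite powR_mulrn// real_normK ?num_real// exprMn exprVn sqr_sqrtr//.
    rewrite EFinM; over.
  rewrite ge0_integralZl//; last 2 first.
  - by apply/measurable_EFinP; apply: measurable_funX.
  - by move=> z _; rewrite lee_fin sqr_ge0.
  by rewrite mulrC EFinM; apply: lee_wpmul2l => //; rewrite lee_fin invr_ge0.
apply: (@squeeze_cvge _ _ _ _ (cst 0%E) _ (fun N => (Num.sqrt (Q * N%:R^-1))%:E)).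
- by apply: nearW => N; rewrite Lnorm_ge0 bound.
- exact: cvg_cst.
apply: cvg_EFin; first by apply: nearW.
rewrite -[X in _ --> X]sqrtr0.
have lim0 : (Q * N%:R^-1) @[N --> \oo] --> (0 : R).
  rewrite -[X in _ --> X](mulr0 Q); apply: cvgMr.
  apply/gtr0_cvgV0; last exact: cvgr_idn.
  by exists 1%N => // n /= n1; rewrite ltr0n.
exact: (continuous_cvg (h := fun x : R => Num.sqrt x) _ (@sqrt_continuous R 0) lim0).
Qed.


Theorem theorem5 (R : realType) :
  exists A : R, 0 < A /\
  forall (d : measure_display) (G : compactMetrizableGroupType d R)
    (mu nu : probability G R),
    haar_probability mu ->
    adapted nu ->
    strictly_aperiodic nu ->
    (exists k : nat, (1 <= k)%N /\
      exists nu_abs nu_sing : {measure set G -> \bar R},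
        lebesgue_decomposition mu (convolution_pow nu k) nu_abs nu_sing /\
        nu_abs [set: G] != 0%E) ->
  forall (f : G -> R) (delta : R),
    measurable_fun [set: G] f ->
    \int[mu]_x f x = 0 ->
    0 < delta <= 1 ->
    f \in Lfun mu (2 + delta)%:E ->
    (ereal_sup [set 'E_nu[fun x => (f (c * x)%g ^+ 2)%R] | c in [set: G]]
      < +oo)%E ->
  let C := asymptotic_variance mu nu f in
  let K := mixing_constant mu nu *
    (fine 'N[mu]_(2 + delta)%:E [EFin \o f] / Num.sqrt C)
      `^ ((2 + delta) / (1 + delta)) in
  (0 < C ->
    exists N0 : nat,
    forall (d' : measure_display) (Omega : measurableType d')
      (P : probability Omega R) (X : nat -> {RV P >-> G}),
      iid nu X ->
    forall N : nat, (N0 <= N)%N ->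
      sup [set `|fine (P [set w |
                   (\sum_(1 <= k < N.+1) f (random_walk X k w))
                     / Num.sqrt (C * N%:R) < x])
                 - std_normal_cdf x| | x in [set: R]]
      <= A * K * (ln N%:R `^ (delta / (1 + delta))
                  / N%:R `^ (delta / (2 + 2 * delta)))) /\
  (C = 0 ->
    forall (d' : measure_display) (Omega : measurableType d')
      (P : probability Omega R) (X : nat -> {RV P >-> G}),
      iid nu X ->
    (fun N : nat => 'N[P]_2%:E [EFin \o (fun w => (
        (Num.sqrt N%:R)^-1
          * \sum_(1 <= k < N.+1) f (random_walk X k w))%R)])%E
      @ \oo --> 0%E).
Proof.
exists 1; split => // d G mu nu hmu ad sa ns f delta mf f0 d01 lf supf C K.
have [a [a0 mixa [S aS]]] := mixing_rate hmu ad sa ns.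
have [dp d1] := andP d01.
have r1 : 1 <= 2 + delta by lra.
have lfr : L1 mu (fun x => `|f x| `^ (2 + delta)) := Lfun_integrable r1 lf.
have f2 : L1 mu (fun x => f x ^+ 2).
  apply: Lfun2_integrable_sqr; apply: (Lfun_subset _ _ _ _ lf).
  - by rewrite lee_fin; lra.
  - by rewrite lee_fin.
  - exact: fin_num_measure.
  - by rewrite lee_fin; lra.
have [V0 fV] : exists V0, forall c, (\int[nu]_x (f (c * x)%g ^+ 2)%:E <= V0%:E)%E.
  move: supf; set A := (X in ereal_sup X) => supf.
  (* The supremum is finite by assumption and bounded below by a nonnegative integral, so [fine]
     keeps its value. *)
  exists (fine (ereal_sup A)) => c.
  have Ac : A (\int[nu]_x (f (c * x)%g ^+ 2)%:E)%E by exists c => //; rewrite unlock.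
  have le : (\int[nu]_x (f (c * x)%g ^+ 2)%:E <= ereal_sup A)%E by exact: ereal_sup_ubound.
  rewrite fineK// fin_numElt supf andbT (lt_le_trans _ le)// (lt_le_trans ltNy0)//.
  by apply: integral_ge0 => x _; rewrite lee_fin sqr_ge0.
have aS' : exists S, forall n, \sum_(0 <= k < n) a k <= S by exists S.
split => [C0|C0].
  have K0 : 0 < K.
    rewrite mulr_gt0//; first exact: lt_le_trans (mixing_constant_ge1 a0 aS' mixa).
    apply: powR_gt0; rewrite divr_gt0 ?sqrtr_gt0//.
    rewrite fine_gt0//; apply/andP; split; last first.
      by move: lf; rewrite inE => /andP[_]; rewrite inE.
    (* A zero norm would make [f] vanish almost everywhere, hence [C = 0]. *)
    rewrite lt_neqAle Lnorm_ge0 andbT; apply: contraTneq C0 => N0.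
    rewrite /C (asymptotic_variance_ae0 hmu a0 aS mixa mf f0 f2 fV) ?ltxx//.
    have mEf : measurable_fun setT (EFin \o f) by exact/measurable_EFinP.
    have := Lnorm_eq0_eq0 mEf _ (esym N0); rewrite lte_fin => /(_ (lt_le_trans ltr01 r1)).
    by apply: filterS => x /= fx _; case: (fx I).
  (* [B] is the constant of [walk_clt]. It is fixed before the probability space and the walk are
     introduced, so [N0] depends on neither. *)
  set B := 2 * ((rate_cst mu nu a f V0 (corrector nu f) (corrector_bound a V0) delta *
     (1 + (delta / 2 * C)^-1) + 2 * mvar_bound V0 (corrector_bound a V0) * S +
     2 * vcorr_bound a V0 (corrector_bound a V0) + 2 * corrector_bound a V0) *
     C `^ (- (delta / 2)) + 3) + (10 + 10 * abs_gaussian R).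
  have e1 : 0 < 1 / (1 + delta) by rewrite divr_gt0// addr_gt0.
  have e2 : 0 < delta / (1 + delta) by rewrite divr_gt0// addr_gt0.
  have [N0 hN0] := rate_threshold B C0 K0 e1 e2.
  exists N0 => d' Omega P X iidX N /hN0[Np t1 BK].
  apply: ge_sup; first by eexists; exists 0.
  move=> _ [x _ <-].
  apply: (le_trans (walk_clt hmu a0 aS mixa mf f0 f2 fV iidX x d01 lfr C0 Np t1)).
  by rewrite mul1r mulrA ler_wpM2r// invr_ge0 powR_ge0.
move=> d' Omega P X iidX.
apply: (Lnorm2_cvg0 (Q := 2 * (mvar_bound V0 (corrector_bound a V0) * S) + 8 * corrector_bound a V0 ^+ 2)).
  move=> N; have := walk_sum_L2 hmu a0 aS mixa mf f0 f2 fV iidX N.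
  by rewrite -/C C0 mul0r add0r.
move=> N; apply: measurable_sum => k; apply: (measurableT_comp mf).
exact: measurable_random_walk.
Qed.
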